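(* Let $\mathcal{C}=\{B_1,\dots,B_m\}$ be a set of blocks (bipolar directed graphs) with north poles $N_i$, south poles $S_i$ and probabilities $p_i$, and let $\mathcal{B}_0,\mathcal{B}_1,\mathcal{B}_2,\dots$ be a sequence of bipolar networks grown from $\mathcal{C}$ using linear preferential attachment with parameters $\chi$ and $\rho$. Let $r$ be a positive integer (such that there are at least $r$ essential outdegrees) and let $k_1<k_2<\dots<k_r$ be the first (smallest) $r$ essential outdegrees. Let $\mathcal{Y}_n=(Y_{n,1},\dots,Y_{n,r})$, where $Y_{n,i}$ is the number of vertices of outdegree $k_i$ in $\mathcal{B}_n$. With $w_k=\chi k+\rho$, define $$f(k)=\sum_{i=1}^m p_i\,\bigl|\{v\in V(B_i)\setminus\{N_i,S_i\}:\deg^+(v)=k\}\bigr|\quad(k\ge1),\qquad g(k)=\sum_{i:\ \deg^+(N_i)=k+1}p_i\quad(k\ge0),$$ $$\lambda_1=\sum_{k\ge1}\bigl(w_kf(k)+\chi k\,g(k)\bigr),$$ and define $\psi=(\psi_1,\dots,\psi_r)$ by $\psi_1=f(k_1)/\bigl(\lambda_1+w_{k_1}(1-g(0))\bigr)$ and, recursively for $i=2,\dots,r$, $$\psi_i=\frac{1}{\lambda_1+w_{k_i}(1-g(0))}\Bigl(f(k_i)+\sum_{j=1}^{i-1}w_{k_j}\,g(k_i-k_j)\,\psi_j\Bigr).$$ For each block $B_i$ let $$s_i=\sum_{u\in V(B_i)}(\chi\deg^+(u)+\rho)-\chi-\rho=\chi(|E(B_i)|-1)+\rho(|V(B_i)|-1).$$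 Suppose that there exists a constant $s$ such that $s_i=s$ for all $i=1,\dots,m$. Then the convergence $$n^{-1/2}\bigl(\mathcal{Y}_n-n\lambda_1\psi\bigr)\xrightarrow{d}\mathcal{N}(0,\Sigma)$$ (for some covariance matrix $\Sigma$) holds together with convergence of all moments. In particular, $n^{-1/2}(\mathbb{E}\mathcal{Y}_n-n\lambda_1\psi)\to0$, and so $n\lambda_1\psi$ can be replaced by $\mathbb{E}\mathcal{Y}_n$ in this convergence.
   Context: Parameters: $\chi\ge0$ and $\rho\in\mathbb{R}$ are real numbers with $\chi+\rho>0$; $w_k:=\chi k+\rho$ for positive integers $k$. Blocks: $\deg^-(v)$ and $\deg^+(v)$ denote the indegree and outdegree of a vertex $v$ of a directed graph; $v$ is a source if $\deg^-(v)=0$ and a sink if $\deg^+(v)=0$. A bipolar directed graph is a finite connected directed graph with exactly one source $N$ (the north pole) and exactly one sink $S$ (the south pole), $N\ne S$. $\mathcal{C}=\{B_1,\dots,B_m\}$ is a finite set of bipolar directed graphs, called blocks, with north poles $N_i$ and south poles $S_i$; each $B_i$ is assigned a probability $p_i>0$, with $p_1+\dots+p_m=1$. $V(B_i)$ and $E(B_i)$ are the vertex set and the set of arcs of $B_i$. Bipolar networks: $\mathcal{B}_0$ is a copy of one of the blocks (chosen arbitrarily, deterministically or at random); the vertices of $\mathcal{B}_0$ corresponding to the north and south poles of that block are the master source $N$ and the master sink $S$ of all subsequent networks. For $n\ge1$, given $\mathcal{B}_{n-1}$, a vertex $v\ne S$ of $\mathcal{B}_{n-1}$ (the latch) is chosen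 with probability $\dfrac{\chi\deg^+(v)+\rho}{\sum_{u\in V(\mathcal{B}_{n-1})\setminus\{S\}}(\chi\deg^+(u)+\rho)}$; then one of the arcs $(v,u)$ leading out of $v$ is chosen uniformly at random among all arcs leading out of $v$; then, independently of these choices and of the past, a block is chosen, $B_i$ being chosen with probability $p_i$. $\mathcal{B}_n$ is obtained from $\mathcal{B}_{n-1}$ by deleting the arc $(v,u)$ and adding a new copy of $B_i$ with $N_i$ fused (identified) with $v$ and $S_i$ fused with $u$. Essential outdegrees: a positive integer $k$ is an essential outdegree if with positive probability there is some $n$ such that $\mathcal{B}_n$ has at least two vertices of outdegree $k$; otherwise $k$ is a nonessential outdegree. $\mathcal{N}(0,\Sigma)$ is the (possibly degenerate) multivariate normal distribution with mean $0$ and covariance matrix $\Sigma$. Convergence $Z_n\xrightarrow{d}Z$ of random vectors in $\mathbb{R}^r$ holds in all moments if in addition every (mixed) moment of $Z_n$ converges to the corresponding moment of $Z$. *)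

(* Defs.v *)
(* MathComp-Analysis; [R : realType] throughout. *)
From HB Require Import structures.
From mathcomp Require Import all_boot all_order all_algebra.
From mathcomp Require Import all_classical all_reals all_analysis.
Set Implicit Arguments.
Unset Strict Implicit.
Unset Printing Implicit Defensive.
Import Order.TTheory GRing.Theory Num.Theory.
Import numFieldNormedType.Exports.
Local Open Scope classical_set_scope.
Local Open Scope ring_scope.

(* A finite directed graph with two distinguished distinct vertices, up to
   relabelling: [inner] is the number of other vertices, the poles are the
   vertices 0 and 1, and the list [arcs] of pairs (tail, head) is read as a
   multiset, since fusing blocks may create parallel arcs. *)
Record network := Network {
  inner : nat;
  arcs : seq ('I_inner.+2 * 'I_inner.+2)
}.

Definition network_code (G : network) :
    {n : nat & seq ('I_n.+2 * 'I_n.+2)} :=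
  existT (fun n => seq ('I_n.+2 * 'I_n.+2)) (inner G) (arcs G).
Definition network_decode (x : {n : nat & seq ('I_n.+2 * 'I_n.+2)}) : network :=
  @Network (projT1 x) (projT2 x).
Lemma network_codeK : cancel network_code network_decode.
Proof. by case. Qed.
HB.instance Definition _ := Countable.copy network (can_type network_codeK).

Definition vertex (G : network) := 'I_(inner G).+2.

Definition north (G : network) : vertex G := ord0.
Definition south (G : network) : vertex G :=
  @Ordinal (inner G).+2 1 (isT : (1 < (inner G).+2)%N).

Definition outdeg (G : network) (v : vertex G) : nat :=
  count (fun a => a.1 == v) (arcs G).
Definition indeg (G : network) (v : vertex G) : nat :=
  count (fun a => a.2 == v) (arcs G).

Definition adjacent (G : network) : rel (vertex G) :=
  fun x y => ((x, y) \in arcs G) || ((y, x) \in arcs G).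

Definition bipolar (G : network) : Prop :=
  [/\ forall x y : vertex G, connect (@adjacent G) x y,
      forall v : vertex G, indeg v = 0%N <-> v = north G
    & forall v : vertex G, outdeg v = 0%N <-> v = south G].

(* Position in the enlarged network of a vertex of the new block [B]: its poles
   are fused with the ends of [a], its other vertices are appended after those
   of [G].  [fintype.split] separates the poles of [B], 0 and 1, from the rest. *)
Definition fuse (G B : network) (a : vertex G * vertex G) (x : vertex B) :
    'I_((inner G).+2 + inner B) :=
  match @fintype.split 2 (inner B) x with
  | inl pole => lshift (inner B) (if pole == ord0 then a.1 else a.2)
  | inr y => rshift (inner G).+2 y
  end.

Definition attach (G : network) (a : vertex G * vertex G) (B : network) :
    network :=
  @Network (inner G + inner B)
    ([seq (lshift (inner B) b.1, lshift (inner B) b.2) | b <- rem a (arcs G)]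
     ++ [seq (fuse a b.1, fuse a b.2) | b <- arcs B]).

Definition num_outdeg (G : network) (k : nat) : nat :=
  #|[set v : vertex G | outdeg v == k]%SET|.

Section Growth.
Context {R : realType}.
Variables (chi rho : R).

Definition w (k : nat) : R := chi * k%:R + rho.

Definition latch_prob (G : network) (v : vertex G) : R :=
  w (outdeg v) / \sum_(u : vertex G | u != south G) w (outdeg u).

Variables (m : nat) (blocks : 'I_m -> network) (p : 'I_m -> R).

(* The probability that one growth step turns [G] into [H]: choose the latch,
   then an arc leading out of it, then a block. *)
Definition step_prob (G H : network) : R :=
  \sum_(v : vertex G | v != south G) latch_prob v *
    \sum_(a <- arcs G | a.1 == v) (outdeg v)%:R^-1 *
      \sum_(i < m) p i * (attach a (blocks i) == H)%:R.

Definition f (k : nat) : R :=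
  \sum_(i < m) p i *
    #|[set v : vertex (blocks i) |
        [&& v != north (blocks i), v != south (blocks i)
          & outdeg v == k]]%SET|%:R.

Definition g (k : nat) : R :=
  \sum_(i < m | outdeg (north (blocks i)) == k.+1) p i.

Definition lambda1 : R :=
  limn (fun n => \sum_(1 <= k < n) (w k * f k + chi * k%:R * g k)).

Definition excess (B : network) : R :=
  \sum_(u : vertex B) (chi * (outdeg u)%:R + rho) - chi - rho.

Lemma excessE (B : network) :
  excess B = chi * ((size (arcs B))%:R - 1) + rho * ((inner B).+2%:R - 1).
Proof.
rewrite /excess big_split /= -mulr_sumr sumr_const card_ord -natr_sum.
have -> : (\sum_(u : vertex B) outdeg u = size (arcs B))%N.
  rewrite /outdeg; elim: (arcs B) => [|a s IHs] /=; first by rewrite big1.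
  rewrite big_split /= IHs (bigD1 a.1) //= eqxx big1 ?addn0 // => u.
  by rewrite eq_sym => /negbTE ->.
by rewrite !mulrBr !mulr1 !mulr_natr -[LHS]addrA addrACA.
Qed.

(* [B 0], [B 1], ... is a sequence of bipolar networks grown from the blocks:
   a Markov chain started from one of the blocks, with arbitrary initial law. *)
Definition grown {d : measure_display} {T : measurableType d}
    (P : probability T R) (B : nat -> T -> network) : Prop :=
  [/\ forall n G, measurable [set t | B n t = G],
      P [set t | exists i, B 0%N t = blocks i] = 1%E
    & forall n (G : nat -> network),
        P [set t | forall j, (j <= n.+1)%N -> B j t = G j] =
        (P [set t | forall j, (j <= n)%N -> B j t = G j] *
          (step_prob (G n) (G n.+1))%:E)%E].

End Growth.

Section RandomVectors.
Context {R : realType}.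

Definition essential {d : measure_display} {T : measurableType d}
    (P : probability T R) (B : nat -> T -> network) (k : nat) : Prop :=
  (0 < k)%N /\
  (0 < P [set t | exists n, (2 <= num_outdeg (B n t) k)%N])%E.

(* [k] enumerates in increasing order the [r] smallest elements of [E]. *)
Definition first_elements (E : nat -> Prop) (r : nat) (k : 'I_r -> nat) : Prop :=
  [/\ forall i j : 'I_r, (i < j)%N -> (k i < k j)%N,
      forall i, E (k i)
    & forall l i, E l -> (l <= k i)%N -> exists j, l = k j].

Definition vec (r : nat) (x : r.-tuple R) : 'rV[R]_r := \row_i tnth x i.

(* [normal_prob m s] takes the standard deviation [s], and is not the Dirac
   measure at [m] when [s = 0]. *)
Definition centered_normal (v : R) : set R -> \bar R :=
  if v == 0 then \d_(0 : R) else normal_prob 0 (Num.sqrt v).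

(* [mu] is the law N(0, Sigma): every linear combination of the coordinates is
   a centered, possibly degenerate, normal variable of the right variance. *)
Definition is_multinormal (r : nat) (Sigma : 'M[R]_r)
    (mu : probability (r.-tuple R) R) : Prop :=
  [/\ Sigma^T = Sigma,
      forall a : 'rV[R]_r, 0 <= (a *m Sigma *m a^T) 0 0
    & forall (a : 'rV[R]_r) (A : set R), measurable A ->
        mu [set x | A ((a *m (vec x)^T) 0 0)] =
        centered_normal ((a *m Sigma *m a^T) 0 0) A].

Section Convergence.
Context {d : measure_display} {T : measurableType d}.
Variables (P : probability T R) (r : nat).

Definition cvg_in_distribution (Z : nat -> T -> 'rV[R]_r)
    (mu : probability (r.-tuple R) R) : Prop :=
  forall h : 'rV[R]_r -> R, continuous h ->
    (exists M : R, forall x, `|h x| <= M) ->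
    ('E_P[fun t => h (Z n t)])%E @[n --> \oo] --> (\int[mu]_x (h (vec x))%:E)%E.

Definition cvg_all_moments (Z : nat -> T -> 'rV[R]_r)
    (mu : probability (r.-tuple R) R) : Prop :=
  forall alpha : 'I_r -> nat,
    ('E_P[fun t => (\prod_i Z n t 0 i ^+ alpha i)%R])%E @[n --> \oo] -->
    (\int[mu]_x (\prod_i tnth x i ^+ alpha i)%R%:E)%E.

Definition mean_vector (X : T -> 'rV[R]_r) : 'rV[R]_r :=
  \row_i fine ('E_P[fun t => X t 0%R i])%E.

End Convergence.
End RandomVectors.

Definition outdeg_counts (R : realType) (r : nat) (k : 'I_r -> nat)
    (G : network) : 'rV[R]_r :=
  \row_i (num_outdeg G (k i))%:R.

(* Main.v *)
From HB Require Import structures.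
Require Import Defs.
From mathcomp Require Import all_boot all_order all_algebra.
From mathcomp Require Import all_classical all_reals all_analysis measurable_realfun.
From mathcomp Require Import ring lra.
Set Implicit Arguments.
Unset Strict Implicit.
Unset Printing Implicit Defensive.
Import Order.TTheory GRing.Theory Num.Theory.
Import numFieldNormedType.Exports.
Local Open Scope classical_set_scope.
Local Open Scope ring_scope.

(** * Elementary inequalities *)

Section Inequalities.
Context {R : realType}.
Implicit Types (x y v : R).

Lemma ge0_of_derive_ge0 (F F' : R -> R) :
  (forall x, is_derive x 1 F (F' x)) -> F 0 = 0 ->
  (forall x, 0 <= x -> 0 <= F' x) -> forall x, 0 <= x -> 0 <= F x.
Proof.
move=> dF F0 F'ge0 x x0; rewrite -F0.
apply: (@ger0_derive1_le_cc _ F 0 x).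
- by move=> y _; case: (dF y).
- move=> y; rewrite in_itv /= => /andP[y0 _].
  by rewrite derive1E; case: (dF y) => _ ->; rewrite F'ge0 // ltW.
- by apply: derivable_within_continuous => y _; case: (dF y).
- by rewrite in_itv /= lexx x0.
- by rewrite in_itv /= lexx x0.
- exact: x0.
Qed.

Lemma sin_cos_taylor_ge0 x : 0 <= x ->
  [/\ 0 <= cos x - 1 + x ^+ 2 / 2, cos x - 1 + x ^+ 2 / 2 <= x ^+ 4 / 24,
      0 <= x - sin x & x - sin x <= x ^+ 3 / 6].
Proof.
pose g2 y : R := y - sin y.
pose g1 y : R := cos y - 1 + y ^+ 2 / 2.
pose g3 y : R := sin y - y + y ^+ 3 / 6.
pose g4 y : R := 1 - y ^+ 2 / 2 + y ^+ 4 / 24 - cos y.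
have d2 y : is_derive y 1 g2 (1 - cos y) by apply: is_deriveB.
have d1 y : is_derive y 1 g1 (- sin y + y).
  by apply: is_derive_eq; rewrite /GRing.scale /=; lra.
have d3 y : is_derive y 1 g3 (cos y - 1 + y ^+ 2 / 2).
  by apply: is_derive_eq; rewrite /GRing.scale /=; lra.
have d4 y : is_derive y 1 g4 (- y + y ^+ 3 / 6 + sin y).
  by apply: is_derive_eq; rewrite /GRing.scale /=; lra.
have h2 : forall y, 0 <= y -> 0 <= g2 y.
  apply: (@ge0_of_derive_ge0 g2 _ d2); first by rewrite /g2 sin0 subr0.
  by move=> y _; rewrite subr_ge0 cos_le1.
have h1 : forall y, 0 <= y -> 0 <= g1 y.
  apply: (@ge0_of_derive_ge0 g1 _ d1); first by rewrite /g1 cos0 expr0n /= mul0r; lra.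
  by move=> y /h2; rewrite /g2; lra.
have h3 : forall y, 0 <= y -> 0 <= g3 y.
  apply: (@ge0_of_derive_ge0 g3 _ d3); first by rewrite /g3 sin0 expr0n /= mul0r; lra.
  by move=> y /h1.
have h4 : forall y, 0 <= y -> 0 <= g4 y.
  apply: (@ge0_of_derive_ge0 g4 _ d4).
    by rewrite /g4 cos0 !expr0n /= !mul0r; lra.
  by move=> y /h3; rewrite /g3; lra.
move=> x0; move: (h1 x x0) (h4 x x0) (h2 x x0) (h3 x x0).
by rewrite /g1 /g4 /g2 /g3 => *; split=> //; lra.
Qed.

Lemma cos_taylor x : 0 <= cos x - 1 + x ^+ 2 / 2 <= x ^+ 4 / 24.
Proof.
wlog x0 : x / 0 <= x => [hw|].
  have [/hw//|/ltW x0] := leP 0 x; have := hw (- x).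
  have -> : (- x) ^+ 4 = x ^+ 4 by ring.
  by rewrite cosN sqrrN; apply; rewrite oppr_ge0.
by have [-> ->] := sin_cos_taylor_ge0 x0.
Qed.

Lemma sin_taylor x : `|sin x - x| <= `|x| ^+ 3 / 6.
Proof.
wlog x0 : x / 0 <= x => [hw|].
  have [/hw//|/ltW x0] := leP 0 x; have := hw (- x).
  by rewrite sinN -opprD !normrN; apply; rewrite oppr_ge0.
have [_ _ a b] := sin_cos_taylor_ge0 x0.
by rewrite distrC (ger0_norm a) (ger0_norm x0).
Qed.

Lemma normB_cos_le1 s x y : `|cos s * x - sin s * y| <= `|x| + `|y|.
Proof.
rewrite (le_trans (ler_normB _ _)) // !normrM lerD //.
  by rewrite ler_piMl // cos_max.
by rewrite ler_piMl // sin_max.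
Qed.

Lemma cos_shift_taylor3 s x : `|x| <= 1 ->
  `|cos (s + x) - (cos s - x * sin s - x ^+ 2 / 2 * cos s)| <= `|x| ^+ 3.
Proof.
move=> x1; have -> : cos (s + x) - (cos s - x * sin s - x ^+ 2 / 2 * cos s) =
   cos s * (cos x - 1 + x ^+ 2 / 2) - sin s * (sin x - x) by rewrite cosD; ring.
rewrite (le_trans (normB_cos_le1 _ _ _)) //.
have /andP[a b] := cos_taylor x; rewrite (ger0_norm a).
have := sin_taylor x.
have : x ^+ 4 <= `|x| ^+ 3.
  rewrite -(@ger0_norm _ (x ^+ 4)) ?exprn_even_ge0 // normrX exprS.
  by rewrite ler_piMl // exprn_ge0.
have : 0 <= `|x| ^+ 3 by rewrite exprn_ge0.
by lra.
Qed.

Lemma cos_shift_taylor2 s y : `|y| <= 1 ->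
  `|cos (s - y) - (cos s + y * sin s)| <= y ^+ 2.
Proof.
move=> y1; have -> : cos (s - y) - (cos s + y * sin s) =
   cos s * (cos y - 1) - sin s * (y - sin y) by rewrite cosB; ring.
rewrite (le_trans (normB_cos_le1 _ _ _)) //.
have /andP[a b] := cos_taylor y.
rewrite ler0_norm; last by rewrite subr_le0 cos_le1.
rewrite distrC; have := sin_taylor y.
have : `|y| ^+ 3 <= y ^+ 2.
  by rewrite -(real_normK (num_real y)) exprS ler_piMl // sqr_ge0.
have : 0 <= y ^+ 2 by rewrite sqr_ge0.
by lra.
Qed.

Lemma cos_lipschitz s x : `|cos (s + x) - cos s| <= 2 * `|x|.
Proof.
have [x1|x1] := leP `|x| 1; last first.
  rewrite (le_trans (ler_normB _ _)) //.
  by have := cos_max (s + x); have := cos_max s; lra.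
have -> : cos (s + x) - cos s = cos s * (cos x - 1) - sin s * sin x.
  by rewrite cosD; ring.
rewrite (le_trans (normB_cos_le1 _ _ _)) //.
have /andP[a b] := cos_taylor x.
rewrite ler0_norm; last by rewrite subr_le0 cos_le1.
have -> : sin x = (sin x - x) + x by ring.
have := ler_normD (sin x - x) x; have := sin_taylor x.
have : x ^+ 2 <= `|x|.
  by rewrite -(real_normK (num_real x)) expr2 ler_piMl.
have : `|x| ^+ 3 <= x ^+ 2.
  by rewrite -(real_normK (num_real x)) exprS ler_piMl // exprn_ge0.
have : 0 <= x ^+ 2 by rewrite sqr_ge0.
have -> : - (cos x - 1) = x ^+ 2 / 2 - (cos x - 1 + x ^+ 2 / 2) by ring.
by lra.
Qed.

Lemma expR_le_quadratic x : `|x| <= 1 / 2 -> expR x <= 1 + x + 2 * x ^+ 2.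
Proof.
rewrite ler_norml => /andP[x1 x2].
have h := expR_ge1Dx (- x).
have p : 0 < 1 - x by lra.
rewrite -[leLHS]invrK -expRN.
rewrite (@le_trans _ _ (1 - x)^-1) //.
  by rewrite lef_pV2 ?posrE ?expR_gt0 //; lra.
rewrite -div1r ler_pdivrMr //.
have -> : (1 + x + 2 * x ^+ 2) * (1 - x) = 1 + x ^+ 2 * (1 - 2 * x) by ring.
by rewrite lerDl mulr_ge0 ?sqr_ge0 //; lra.
Qed.

Lemma expRN_bounds v : 0 <= v -> 1 - v <= expR (- v) <= 1 - v + v ^+ 2.
Proof.
move=> v0; apply/andP; split; first exact: expR_ge1Dx.
rewrite expRN (@le_trans _ _ (1 + v)^-1) //.
  by rewrite lef_pV2 ?posrE ?expR_gt0 ?expR_ge1Dx //; lra.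
rewrite -div1r ler_pdivrMr; last by lra.
have -> : (1 - v + v ^+ 2) * (1 + v) = 1 + v ^+ 3 by ring.
by rewrite lerDl exprn_ge0.
Qed.

Lemma ler_norm_expR x : `|x| <= expR x + expR (- x).
Proof.
have := expR_ge1Dx x; have := expR_ge1Dx (- x).
have := expR_gt0 x; have := expR_gt0 (- x).
by rewrite ler_norml => *; apply/andP; split; lra.
Qed.

Definition cosh x : R := (expR x + expR (- x)) / 2.
Definition sinh x : R := (expR x - expR (- x)) / 2.

Lemma cosh_gt0 x : 0 < cosh x.
Proof. by rewrite divr_gt0 // addr_gt0 ?expR_gt0. Qed.

Lemma is_derive_cosh x : is_derive x 1 cosh (sinh x).
Proof.
apply: is_derive_eq; rewrite /sinh /GRing.scale /=; lra.
Qed.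

Lemma is_derive_sinh x : is_derive x 1 sinh (cosh x).
Proof.
apply: is_derive_eq; rewrite /cosh /GRing.scale /=; lra.
Qed.

Lemma coshN x : cosh (- x) = cosh x.
Proof. by rewrite /cosh opprK addrC. Qed.

Lemma cos_cosh_taylor x : `|cos x + cosh x - 2| <= 2 * (x ^+ 4 * cosh x).
Proof.
wlog x0 : x / 0 <= x => [hw|].
  have [/hw//|/ltW x0] := leP 0 x; have := hw (- x).
  have -> : (- x) ^+ 4 = x ^+ 4 by ring.
  by rewrite cosN coshN; apply; rewrite oppr_ge0.
have ic := is_derive_cosh; have ish := is_derive_sinh.
have cp y : 0 <= cosh y by rewrite ltW // cosh_gt0.
have pp (u v : R) : 0 <= u -> 0 <= v -> 0 <= u * v by exact: mulr_ge0.
have s0 : forall y, 0 <= y -> 0 <= sinh y.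
  by apply: (@ge0_of_derive_ge0 sinh _ is_derive_sinh) => //; rewrite /sinh oppr0 subrr mul0r.
have c1 y : 0 <= y -> 0 <= cosh y - 1.
  apply: (@ge0_of_derive_ge0 (fun y => cosh y - 1) sinh) => //.
    by move=> z; apply: is_derive_eq; rewrite subr0.
  by rewrite /cosh oppr0 expR0; lra.
have s1 y : 0 <= y -> 0 <= sinh y - y.
  apply: (@ge0_of_derive_ge0 (fun y => sinh y - y) (fun y => cosh y - 1)) => //.
  by rewrite /sinh oppr0 expR0; lra.
have c2 y : 0 <= y -> 0 <= cosh y - 1 - y ^+ 2 / 2.
  apply: (@ge0_of_derive_ge0 (fun y => cosh y - 1 - y ^+ 2 / 2)
    (fun y => sinh y - y)) => //.
    by move=> z; apply: is_derive_eq; rewrite /GRing.scale /=; lra.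
  by rewrite /cosh oppr0 expR0 expr0n /=; lra.
have k0 y : 0 <= y -> 0 <= y * cosh y - sinh y.
  apply: (@ge0_of_derive_ge0 (fun y => y * cosh y - sinh y)
    (fun y => y * sinh y)) => //.
  - by move=> z; apply: is_derive_eq; rewrite /GRing.scale /=; lra.
  - by rewrite /sinh oppr0 expR0; lra.
  - by move=> z z0; rewrite mulr_ge0 ?s0.
have k1 y : 0 <= y -> 0 <= y ^+ 2 * cosh y - cosh y + 1.
  apply: (@ge0_of_derive_ge0 (fun y => y ^+ 2 * cosh y - cosh y + 1)
    (fun y => y ^+ 2 * sinh y + y * cosh y + (y * cosh y - sinh y))) => //.
  - by move=> z; apply: is_derive_eq; rewrite /GRing.scale /=; lra.
  - by rewrite /cosh oppr0 expR0 expr0n /=; lra.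
  - move=> z z0; apply: addr_ge0 (k0 z z0).
    by apply: addr_ge0; [exact: pp (exprn_ge0 _ z0) (s0 _ z0)|exact: pp z0 (cp z)].
have k2 y : 0 <= y -> 0 <= y ^+ 3 * cosh y - sinh y + y.
  apply: (@ge0_of_derive_ge0 (fun y => y ^+ 3 * cosh y - sinh y + y)
    (fun y => y ^+ 3 * sinh y + 2 * (y ^+ 2 * cosh y) +
              (y ^+ 2 * cosh y - cosh y + 1))) => //.
  - by move=> z; apply: is_derive_eq; rewrite /GRing.scale /=; lra.
  - by rewrite /sinh oppr0 expR0 expr0n /=; lra.
  - move=> z z0; apply: addr_ge0 (k1 z z0).
    by apply: addr_ge0; [exact: pp (exprn_ge0 _ z0) (s0 _ z0)|
      exact: pp (ler0n _ _) (pp _ _ (exprn_ge0 _ z0) (cp z))].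
have k3 y : 0 <= y -> 0 <= y ^+ 4 * cosh y - cosh y + 1 + y ^+ 2 / 2.
  apply: (@ge0_of_derive_ge0 (fun y => y ^+ 4 * cosh y - cosh y + 1 + y ^+ 2 / 2)
    (fun y => y ^+ 4 * sinh y + 3 * (y ^+ 3 * cosh y) +
              (y ^+ 3 * cosh y - sinh y + y))) => //.
  - by move=> z; apply: is_derive_eq; rewrite /GRing.scale /=; lra.
  - by rewrite /cosh oppr0 expR0 !expr0n /=; lra.
  - move=> z z0; apply: addr_ge0 (k2 z z0).
    by apply: addr_ge0; [exact: pp (exprn_ge0 _ z0) (s0 _ z0)|
      exact: pp (ler0n _ _) (pp _ _ (exprn_ge0 _ z0) (cp z))].
have /andP[a b] := cos_taylor x.
have c := c2 x x0; have e := k3 x x0.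
have h : x ^+ 4 <= x ^+ 4 * cosh x.
  by rewrite ler_peMr ?exprn_ge0 //; have := c1 x x0; lra.
have := exprn_ge0 4 x0.
by rewrite ger0_norm => *; lra.
Qed.

Definition harm (n : nat) : R := \sum_(j < n) j.+1%:R^-1.
Definition isqrt_sum (n : nat) : R := \sum_(j < n) (Num.sqrt j.+1%:R)^-1.
Definition root4 (n : nat) : R := Num.sqrt (Num.sqrt n%:R).

Lemma root4_ge0 n : 0 <= root4 n. Proof. exact: sqrtr_ge0. Qed.

Lemma sqr_root4 n : root4 n ^+ 2 = Num.sqrt n%:R.
Proof. by rewrite sqr_sqrtr // sqrtr_ge0. Qed.

Lemma root4_ge1 n : (0 < n)%N -> 1 <= root4 n.
Proof.
move=> n0; rewrite -[leLHS]sqrtr1 ler_sqrt ?ler01 //.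
by rewrite -[leLHS]sqrtr1 ler_sqrt ?ler01 // ler1n.
Qed.

Lemma harm_ge0 n : 0 <= harm n.
Proof. by rewrite sumr_ge0 // => i _; rewrite invr_ge0. Qed.

Lemma harm_le n : harm n <= 4 * root4 n.
Proof.
elim: n => [|n ih]; first by rewrite /harm big_ord0 mulr_ge0 // root4_ge0.
rewrite /harm big_ord_recr /= -/(harm n).
have e k : root4 k ^+ 4 = k%:R.
  by rewrite (exprM _ 2 2) sqr_root4 sqr_sqrtr.
have := e n; have := e n.+1; have := root4_ge0 n; have := root4_ge1 (ltn0Sn n).
move: ih; set x := root4 n; set y := root4 n.+1; rewrite -(natr1 n) => ih y1 x0 ey ex.
have xy : x <= y by rewrite !ler_sqrt ?ler_nat ?sqrtr_ge0.
suff : (n%:R + 1)^-1 <= 4 * (y - x) by lra.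
rewrite -ey -div1r ler_pdivrMr ?exprn_gt0 //; last by lra.
have d : y ^+ 4 - x ^+ 4 = 1 by rewrite ex ey; ring.
have {1}-> : 1 = (y - x) * ((y + x) * (y ^+ 2 + x ^+ 2)) by rewrite -[LHS]d; ring.
have -> : 4 * (y - x) * y ^+ 4 = (y - x) * (4 * y ^+ 4) by ring.
rewrite ler_wpM2l ?subr_ge0 //.
have x2 : x ^+ 2 <= y ^+ 2 by rewrite ler_sqr // nnegrE; lra.
apply: (@le_trans _ _ ((y + y) * (y ^+ 2 + y ^+ 2))).
  apply: ler_pM; rewrite ?addr_ge0 ?sqr_ge0 //; lra.
have -> : (y + y) * (y ^+ 2 + y ^+ 2) = 4 * (y ^+ 3 * 1) by ring.
rewrite (exprSr y 3) ler_wpM2l // ler_wpM2l // exprn_ge0 //; lra.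
Qed.

Lemma isqrt_sum_ge0 n : 0 <= isqrt_sum n.
Proof. by rewrite sumr_ge0 // => i _; rewrite invr_ge0 sqrtr_ge0. Qed.

Lemma isqrt_sum_le n : isqrt_sum n <= 2 * Num.sqrt n%:R.
Proof.
elim: n => [|n ih]; first by rewrite /isqrt_sum big_ord0 mulr_ge0 // sqrtr_ge0.
rewrite /isqrt_sum big_ord_recr /= -/(isqrt_sum n).
have e k : Num.sqrt k%:R ^+ 2 = k%:R :> R by rewrite sqr_sqrtr.
have y0 : 0 < Num.sqrt n.+1%:R :> R by rewrite sqrtr_gt0.
have x0 : 0 <= Num.sqrt n%:R :> R by rewrite sqrtr_ge0.
have xy : Num.sqrt n%:R <= Num.sqrt n.+1%:R :> R by rewrite ler_sqrt ?ler_nat.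
have := e n; have := e n.+1; rewrite -(natr1 n) in xy y0 *.
move: ih xy y0 x0; set x := Num.sqrt n%:R; set y := Num.sqrt _ => ih xy y0 x0 ey ex.
suff : y^-1 <= 2 * (y - x) by lra.
rewrite -div1r ler_pdivrMr //.
have d : y ^+ 2 - x ^+ 2 = 1 by rewrite ex ey; ring.
have {1}-> : 1 = (y - x) * (y + x) by rewrite -[LHS]d; ring.
have -> : 2 * (y - x) * y = (y - x) * (2 * y) by ring.
rewrite ler_wpM2l ?subr_ge0 //; lra.
Qed.

End Inequalities.

(** * Laws with finitely many atoms *)

Section FiniteLaw.
Context {R : realType} {V : eqType}.
Implicit Types (L : seq (R * V)) (h : V -> R).

Definition Ex L h : R := \sum_(x <- L) x.1 * h x.2.

Definition is_law L : Prop :=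
  (forall x, x \in L -> 0 <= x.1) /\ \sum_(x <- L) x.1 = 1.

Lemma eq_Ex L h h' : (forall x, x \in L -> h x.2 = h' x.2) -> Ex L h = Ex L h'.
Proof. by move=> e; apply: eq_big_seq => x /e ->. Qed.

Lemma ExD L h h' : Ex L (fun x => h x + h' x) = Ex L h + Ex L h'.
Proof. by rewrite -big_split; apply: eq_bigr => x _; rewrite mulrDr. Qed.

Lemma ExZ L c h : Ex L (fun x => c * h x) = c * Ex L h.
Proof. by rewrite mulr_sumr; apply: eq_bigr => x _; rewrite mulrCA. Qed.

Lemma ExN L h : Ex L (fun x => - h x) = - Ex L h.
Proof. by rewrite -sumrN; apply: eq_bigr => x _; rewrite mulrN. Qed.

Lemma ExB L h h' : Ex L (fun x => h x - h' x) = Ex L h - Ex L h'.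
Proof. by rewrite ExD ExN. Qed.

Lemma Ex_sum L (I : Type) (s : seq I) (A : pred I) (H : I -> V -> R) :
  Ex L (fun x => \sum_(i <- s | A i) H i x) = \sum_(i <- s | A i) Ex L (H i).
Proof.
by rewrite /Ex exchange_big /=; apply: eq_bigr => x _; rewrite mulr_sumr.
Qed.

Lemma Ex_cst L c : is_law L -> Ex L (fun=> c) = c.
Proof. by case=> _ L1; rewrite /Ex -mulr_suml L1 mul1r. Qed.

Lemma Ex_le L h h' : is_law L -> (forall x, x \in L -> h x.2 <= h' x.2) ->
  Ex L h <= Ex L h'.
Proof.
by case=> L0 _ e; rewrite /Ex !big_seq; apply: ler_sum => x xL; rewrite ler_wpM2l ?L0 ?e.
Qed.

Lemma Ex_ge0 L h : is_law L -> (forall x, x \in L -> 0 <= h x.2) -> 0 <= Ex L h.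
Proof.
by case=> L0 _ e; rewrite /Ex big_seq; apply: sumr_ge0 => x xL; rewrite mulr_ge0 ?L0 ?e.
Qed.

Lemma Ex_norm L h : is_law L -> `|Ex L h| <= Ex L (fun x => `|h x|).
Proof.
case=> L0 _; apply: le_trans (ler_norm_sum _ _ _) _.
rewrite /Ex !big_seq; apply: ler_sum => x xL.
by rewrite normrM ger0_norm // L0.
Qed.

Lemma Ex_le_cst L h c : is_law L -> (forall x, x \in L -> h x.2 <= c) ->
  Ex L h <= c.
Proof. by move=> lL e; rewrite -[leRHS](Ex_cst c lL); exact: Ex_le. Qed.

Lemma Ex_norm_le L h c : is_law L -> (forall x, x \in L -> `|h x.2| <= c) ->
  `|Ex L h| <= c.
Proof. by move=> lL e; exact: le_trans (Ex_norm h lL) (Ex_le_cst lL e). Qed.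

End FiniteLaw.

(** * Trigonometric polynomials approximate bounded continuous functions *)

Section Trig.
Context {R : realType} {r : nat}.
Implicit Types (a x y s : 'rV[R]_r) (h p q : 'rV[R]_r -> R).

Definition dot a x : R := (a *m x^T) 0 0.

Lemma dotE a x : dot a x = \sum_i a 0 i * x 0 i.
Proof. by rewrite /dot mxE; apply: eq_bigr => i _; rewrite mxE. Qed.

Lemma dotDl a b x : dot (a + b) x = dot a x + dot b x.
Proof. by rewrite /dot mulmxDl mxE. Qed.

Lemma dotNl a x : dot (- a) x = - dot a x.
Proof. by rewrite /dot mulNmx mxE. Qed.

Lemma dotDr a x y : dot a (x + y) = dot a x + dot a y.
Proof. by rewrite /dot linearD /= mulmxDr mxE. Qed.

Lemma dotZl c a x : dot (c *: a) x = c * dot a x.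
Proof. by rewrite /dot -scalemxAl mxE. Qed.

Lemma dotZr c a x : dot a (c *: x) = c * dot a x.
Proof. by rewrite /dot linearZ /= -scalemxAr mxE. Qed.

Lemma dot0l x : dot 0 x = 0.
Proof. by rewrite /dot mul0mx mxE. Qed.

Lemma dot_delta i x : dot (delta_mx 0 i) x = x 0 i.
Proof.
rewrite dotE (bigD1 i) //= mxE !eqxx mul1r big1 ?addr0 // => j /negbTE ji.
by rewrite mxE eqxx ji mul0r.
Qed.

Inductive trigpoly : ('rV[R]_r -> R) -> Prop :=
| trig_cos a c : trigpoly (fun x => cos (dot a x + c))
| trig_add p q : trigpoly p -> trigpoly q -> trigpoly (fun x => p x + q x)
| trig_scale c p : trigpoly p -> trigpoly (fun x => c * p x).

Lemma trig_ext p q : p =1 q -> trigpoly p -> trigpoly q.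
Proof. by move=> /funext ->. Qed.

Lemma trig_cst c : trigpoly (fun=> c).
Proof.
apply: (@trig_ext (fun x => c * cos (dot 0 x + 0))).
  by move=> x; rewrite dot0l addr0 cos0 mulr1.
exact/trig_scale/trig_cos.
Qed.

Lemma trig_mul p q : trigpoly p -> trigpoly q -> trigpoly (fun x => p x * q x).
Proof.
move=> tp tq; elim: tp => [a c|p1 p2 _ ih1 _ ih2|c p1 _ ih].
- elim: tq => [b e|q1 q2 _ ih1 _ ih2|e q1 _ ih].
  + apply: (@trig_ext (fun x => 2^-1 * cos (dot (a + b) x + (c + e)) +
                                2^-1 * cos (dot (a - b) x + (c - e)))).
      move=> x; rewrite !dotDl dotNl.
      rewrite (_ : _ + _ + (c + e) = (dot a x + c) + (dot b x + e)); last by ring.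
      rewrite (_ : _ - _ + (c - e) = (dot a x + c) - (dot b x + e)); last by ring.
      rewrite cosD cosB; lra.
    by apply: trig_add; apply: trig_scale; exact: trig_cos.
  + apply: (@trig_ext _ _ _ (trig_add ih1 ih2)) => x; ring.
  + apply: (@trig_ext _ _ _ (trig_scale e ih)) => x; ring.
- apply: (@trig_ext _ _ _ (trig_add ih1 ih2)) => x; ring.
- apply: (@trig_ext _ _ _ (trig_scale c ih)) => x; ring.
Qed.

Lemma trig_sin i c : trigpoly (fun x => sin (c * x 0 i)).
Proof.
apply: (@trig_ext (fun x => cos (dot (c *: delta_mx 0 i) x + - (pi / 2)))).
  by move=> x; rewrite dotZl dot_delta cosBpihalf.
exact: trig_cos.
Qed.

(** The average of [F] at the end of a walk started at [y] that scans the list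
    [l] of directions and makes the step [e] in each direction [i] with
    probability [s 0 i], independently: a Bernstein operator in several
    variables. *)
Fixpoint walk s (l : seq 'I_r) (e : R) (F : 'rV[R]_r -> R) y : R :=
  if l is i :: l' then (1 - s 0 i) * walk s l' e F y +
    s 0 i * walk s l' e F (y + e *: delta_mx 0 i)
  else F y.

Lemma walk_le s l e F G y : (forall i, 0 <= s 0 i <= 1) ->
  (forall z, F z <= G z) -> walk s l e F y <= walk s l e G y.
Proof.
move=> s01 FG; elim: l y => [|i l ih] y /=; first exact: FG.
have /andP[s0 s1] := s01 i.
by rewrite lerD // ler_wpM2l ?ih // subr_ge0.
Qed.

Lemma walk_cst s l e c y : walk s l e (fun=> c) y = c.
Proof. by elim: l y => [|i l ih] y //=; rewrite !ih; ring. Qed.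

Lemma walkD s l e F G y :
  walk s l e (fun z => F z + G z) y = walk s l e F y + walk s l e G y.
Proof. by elim: l y => [|i l ih] y //=; rewrite !ih; ring. Qed.

Lemma walkZ s l e c F y :
  walk s l e (fun z => c * F z) y = c * walk s l e F y.
Proof. by elim: l y => [|i l ih] y //=; rewrite !ih; ring. Qed.

Lemma walk_sum s l e (I : Type) (u : seq I) (F : I -> 'rV[R]_r -> R) y :
  walk s l e (fun z => \sum_(i <- u) F i z) y = \sum_(i <- u) walk s l e (F i) y.
Proof.
elim: u => [|i u ih].
  rewrite big_nil -[RHS](walk_cst s l e 0 y); congr walk.
  by apply/funext => z; rewrite big_nil.
rewrite big_cons -ih -walkD; congr walk.
by apply/funext => z; rewrite big_cons.
Qed.

(** The second moment of a coordinate around any point [c]. *)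
Lemma walk_sqr s l e y i c :
  walk s l e (fun z => (z 0 i - c) ^+ 2) y =
  (count_mem i l)%:R * (e ^+ 2 * (s 0 i * (1 - s 0 i))) +
  (y 0 i + (count_mem i l)%:R * (e * s 0 i) - c) ^+ 2.
Proof.
elim: l y => [|j l ih] y /=; first by rewrite !mul0r add0r addr0.
rewrite !ih !mxE eqxx (eq_sym i j) /= natrD.
by have [->|_] := eqVneq j i; rewrite /= ?mulr1n ?mulr0n; ring.
Qed.

Lemma trig_walk (S : 'rV[R]_r -> 'rV[R]_r) l e F y :
  (forall i, trigpoly (fun x => S x 0 i)) ->
  trigpoly (fun x => walk (S x) l e F y).
Proof.
move=> tS; elim: l y => [|i l ih] y /=; first exact: trig_cst.
apply: trig_add; apply: trig_mul => //.
apply: (@trig_ext (fun x => 1 + (-1) * S x 0 i)); first by move=> x; rewrite mulN1r.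
by apply: trig_add; [exact: trig_cst|exact: trig_scale].
Qed.

End Trig.

Section TrigApprox.
Context {R : realType} {r : nat}.
Implicit Types (x y s : 'rV[R]_r) (h : 'rV[R]_r -> R).

Lemma continuous_asin_clamp (b : R) : 0 <= b -> b < 1 ->
  continuous (fun y : R => asin (Num.max (- b) (Num.min b (2 * y - 1)))).
Proof.
move=> b0 b1 y; set z := Num.max (- b) (Num.min b (2 * y - 1)).
have zb : - b <= z <= b.
  by rewrite /z le_max lexx /= ge_max ge_min lexx /= andbT; lra.
have ca : {for z, continuous (@asin R)}.
  by apply: continuous_asin; move/andP: zb => [? ?]; apply/andP; split; lra.
have cz : continuous (fun y : R => Num.max (- b) (Num.min b (2 * y - 1))).
  move=> u.
  have c1 : {for u, continuous (fun y : R => 2 * y - 1)}.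
    apply: continuousB; last exact: cst_continuous.
    by apply: continuousM; [exact: cst_continuous|exact: cvg_id].
  exact: (continuous_max (@cst_continuous _ _ (- b) u)
            (continuous_min (@cst_continuous _ _ b u) c1)).
exact: (continuous_comp (cz y) ca).
Qed.

Lemma continuous_rowE (f : 'rV[R]_r -> 'rV[R]_r) :
  (forall i, continuous (fun x => f x 0 i)) -> continuous f.
Proof.
move=> cf x; have FF : Filter (nbhs x) := nbhs_filter x.
apply/(@cvgrPdist_lt _ _ _ (nbhs x) FF) => e e0.
have : \forall y \near x, forall i, `|f x 0 i - f y 0 i| < e.

  apply: (@filter_forall _ _ _ (nbhs x) FF) => i.
  by move: (cf i x) => /cvgrPdist_lt/(_ e e0).
apply: filterS => y hy.
rewrite [ltLHS](_ : _ = mx_norm (f x - f y)) // mx_normrE; apply/bigmax_ltP; split=> // -[j i] _ /=.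
by rewrite !mxE ord1.
Qed.

Lemma norm_coord_le x i : `|x 0 i| <= `|x|.
Proof.
rewrite [leRHS](_ : _ = mx_norm x) // mx_normrE.
exact: (le_bigmax _ (fun ij : 'I_1 * 'I_r => `|x ij.1 ij.2|) (0, i)).
Qed.

(** Uniform continuity of a continuous function near a compact box. *)
Lemma box_uniform_continuity (F : 'rV[R]_r -> R) (eps : R) : 0 < eps ->
  continuous F -> exists2 delta, 0 < delta & forall s y,
    (forall i, 0 <= s 0 i <= 1) -> (forall i, `|y 0 i - s 0 i| < delta) ->
    `|F y - F s| <= eps.
Proof.
move=> eps0 cF.
have cK : compact [set s : 'rV[R]_r | forall i, `[(0:R), (1:R)]%classic (s ord0 i)].
  apply: (@rV_compact R r (fun=> `[0, 1]%classic)) => _; exact: segment_compact.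
pose P (d : R) s := forall y, `|y - s| < d -> `|F y - F s| <= eps.
have hcov : \forall d \near 0^'+, [set s : 'rV[R]_r | forall i,
    `[(0:R), (1:R)]%classic (s ord0 i)] `<=` P d.
  apply: ((compact_near_coveringP _).1 cK R 0^'+ P).
  move=> s _.
  have /(@cvgrPdist_lt _ _ _ (nbhs s) (nbhs_filter s)) /(_ (eps / 2)) := cF s.
  rewrite divr_gt0 // => /(_ isT) /nbhs_ballP[e /= e0 he].
  exists (ball s (e / 2), [set d | 0 < d < e / 2]) => /=.
    split; first by apply: nbhsx_ballx; rewrite divr_gt0.
    by near=> d; apply/andP; split => //; near: d; apply: nbhs_right_lt; rewrite divr_gt0.
  move=> [s' d] /= [bs /andP[d0 de]] y yd.
  have bs' : ball s e s' by apply: le_ball bs; lra.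
  have by' : ball s e y.
    move: bs; rewrite -!ball_normE /= => bs.
    rewrite (_ : s - y = (s - s') - (y - s')); last by rewrite opprB addrA subrK.
    by rewrite (le_lt_trans (ler_normB _ _)) //; lra.
  have := he _ bs'; have := he _ by' => /= h1 h2.
  rewrite (_ : F y - F s' = (F s - F s') - (F s - F y)); last by ring.
  by rewrite (le_trans (ler_normB _ _)) //; lra.
near (0 : R)^'+ => d.
exists d => // s y s01 yd.
have := near hcov d.
rewrite /P => /(_ _ s) h; apply: h => //.
rewrite [ltLHS](_ : _ = mx_norm (y - s)) // mx_normrE; apply/bigmax_ltP.
by split=> // -[j i] _ /=; rewrite !mxE ord1.
Unshelve. all: by end_near. Qed.


(** The coordinates of [x] in the cube [-K, K] are continuous functions of
    [(1 + sin (x 0 i / K)) / 2], which stays in the unit interval wherever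
    [x] is: applying a Bernstein operator in these variables to [h] gives a
    trigonometric polynomial that keeps the bound of [h] on the whole space. *)
Lemma trig_approx h (M K eps : R) : continuous h -> (forall x, `|h x| <= M) ->
  0 < K -> 0 < eps ->
  exists p, [/\ trigpoly p, forall x, `|p x| <= M &
    forall x, (forall i, `|x 0 i| <= K) -> `|p x - h x| <= eps].
Proof.
move=> ch hM K0 eps0.
have pi2 : 1 <= pi / 2 :> R := pihalf_ge1 R.
have s1lt : sin (1 : R) < 1.
  rewrite lt_neqAle sin_le1 andbT; apply/negP => /eqP s1.
  have : cos (1 : R) = 0 by apply: sin1cos0; rewrite s1 normr1.
  by move=> c1; have := cos1_gt0 R; rewrite c1 ltxx.
have s1ge : 0 <= sin (1 : R).
  by rewrite sin_ge0_pi //; have := pi_ge2 R; rewrite ler01 /=; lra.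
pose nu (y : R) : R := asin (Num.max (- sin 1) (Num.min (sin 1) (2 * y - 1))).
have cnu : continuous nu by exact: continuous_asin_clamp.
pose G (y : 'rV[R]_r) : 'rV[R]_r := \row_i (K * nu (y 0 i)).
have cG : continuous G.
  apply: continuous_rowE => i.
  have -> : (fun x => G x 0 i) = (fun x => K * nu (x 0 i)).
    by apply/funext => z; rewrite mxE.
  have cK : continuous (fun y : R => K * nu y).
    by move=> y; apply: continuousM; [exact: cst_continuous|exact: cnu].
  move=> z; have cz : {for z, continuous (fun x : 'rV[R]_r => x 0 i)} by exact: coord_continuous.
  exact: (continuous_comp cz (cK (z 0 i))).
pose F := h \o G.
have cF : continuous F by move=> x; apply: continuous_comp; [exact: cG|exact: ch].
pose S (x : 'rV[R]_r) : 'rV[R]_r := \row_i (2^-1 + 2^-1 * sin (K^-1 * x 0 i)).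
have S01 x i : 0 <= S x 0 i <= 1.
  rewrite mxE; have := sin_le1 (K^-1 * x 0 i); have := sin_geN1 (K^-1 * x 0 i).
  by move=> *; apply/andP; split; lra.
have GS x : (forall i, `|x 0 i| <= K) -> F (S x) = h x.
  move=> xK; rewrite /F /=; congr h; apply/rowP => i; rewrite !mxE /nu.
  have u1 : -1 <= K^-1 * x 0 i <= 1.
    by rewrite -ler_norml normrM gtr0_norm ?invr_gt0 // mulrC ler_pdivrMr // mul1r.
  have [ua ub] := andP u1.
  rewrite (_ : 2 * _ - 1 = sin (K^-1 * x 0 i)); last by field.
  have i1 : (1 : R) \in `[(- (pi / 2)), pi / 2] by rewrite in_itv /=; apply/andP; split; lra.
  have iN1 : (- 1 : R) \in `[(- (pi / 2)), pi / 2] by rewrite in_itv /=; apply/andP; split; lra.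
  have iu : K^-1 * x 0 i \in `[(- (pi / 2)), pi / 2] by rewrite in_itv /=; apply/andP; split; lra.
  have lesin : {in `[(- (pi / 2)), pi / 2] &, {mono (@sin R) : x y / x <= y}}.
    by apply: le_mono_in => y z yI zI yz; rewrite ltr_sin.
  have sle : sin (K^-1 * x 0 i) <= sin 1 by rewrite lesin.
  have sge : - sin 1 <= sin (K^-1 * x 0 i) by rewrite -sinN lesin.
  rewrite (min_idPr sle) (max_idPr sge) sinK // mulrA divff ?mul1r // gt_eqF //.
have M0 : 0 <= M := le_trans (normr_ge0 _) (hM 0).
have [delta d0 hd] : exists2 delta, 0 < delta & forall s y,
    (forall i, 0 <= s 0 i <= 1) -> (forall i, `|y 0 i - s 0 i| < delta) ->
    `|F y - F s| <= eps / 2.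
  by apply: box_uniform_continuity => //; rewrite divr_gt0.
have FM z : `|F z| <= M by exact: hM.
pose c := 2 * M / delta ^+ 2.
have c0 : 0 <= c by rewrite divr_ge0 ?sqr_ge0 ?mulr_ge0.
have bound s z : (forall i, 0 <= s 0 i <= 1) ->
    `|F z - F s| <= eps / 2 + c * \sum_i (z 0 i - s 0 i) ^+ 2.
  move=> s01; have [far|near_] := pselect (exists i, delta <= `|z 0 i - s 0 i|).
    have [i hi] := far.
    rewrite (@le_trans _ _ (2 * M)) //.
      by rewrite (le_trans (ler_normB _ _)) //; have := FM z; have := FM s; lra.
    rewrite -[leLHS]add0r lerD ?divr_ge0 ?(ltW eps0) //.
    rewrite -[leLHS](@divfK _ (delta ^+ 2)) ?expf_neq0 ?gt_eqF // ler_wpM2l //.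
    rewrite (bigD1 i) //= -[leLHS]addr0 lerD ?sumr_ge0 // => [|j _]; last exact: sqr_ge0.
    by rewrite -(real_normK (num_real (_ - _))) ler_sqr ?nnegrE // ltW.
  rewrite (@le_trans _ _ (eps / 2)) //.
    apply: hd => // i; rewrite ltNge; apply/negP => hi; apply: near_.
    by exists i.
  by rewrite lerDl mulr_ge0 // sumr_ge0 // => i _; exact: sqr_ge0.
pose N := (Num.truncn (c * r%:R / (eps / 2))).+1.
have N0 : 0 < N%:R :> R by rewrite ltr0n.
have hN : c * (r%:R / N%:R) <= eps / 2.
  rewrite mulrA ler_pdivrMr // [leRHS]mulrC -ler_pdivrMr ?divr_gt0 //.
  by apply: ltW; exact: truncnS_gt.
pose l := flatten (nseq N (enum 'I_r)).
have cl i : count_mem i l = N.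
  rewrite count_flatten map_nseq sumn_nseq -[RHS]mul1n; congr muln.
  by rewrite count_uniq_mem ?enum_uniq // mem_enum.
exists (fun x => walk (S x) l N%:R^-1 F 0); split.
- apply: trig_walk => i; apply: (@trig_ext _ _ (fun x => 2^-1 + 2^-1 * sin (K^-1 * x 0 i))).
    by move=> x; rewrite mxE.
  by apply: trig_add; [exact: trig_cst|apply: trig_scale; exact: trig_sin].
- move=> x; rewrite ler_norml; apply/andP; split.
    rewrite -[leLHS](walk_cst (S x) l N%:R^-1 (- M) 0); apply: walk_le => // z.
    by have := FM z; rewrite ler_norml => /andP[].
  rewrite -[leRHS](walk_cst (S x) l N%:R^-1 M 0); apply: walk_le => // z.
  by have := FM z; rewrite ler_norml => /andP[].
move=> x /GS <-; set s := S x.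
have key : walk s l N%:R^-1 (fun z => eps / 2 + c * \sum_i (z 0 i - s 0 i) ^+ 2) 0 <= eps.
  rewrite walkD walk_cst walkZ walk_sum.
  suff : c * \sum_i walk s l N%:R^-1 (fun z => (z 0 i - s 0 i) ^+ 2) 0 <= eps / 2.
    by move=> ?; lra.
  rewrite (le_trans _ hN) // ler_wpM2l //.
  rewrite (_ : r%:R / N%:R = \sum_(i < r) N%:R^-1); last first.
    by rewrite sumr_const card_ord -[RHS]mulr_natl.
  apply: ler_sum => i _.
  have z0 : (0 : 'rV[R]_r) 0 i = 0 by rewrite mxE.
  rewrite walk_sqr cl z0.
  rewrite (_ : _ + _ = N%:R^-1 * (s 0 i * (1 - s 0 i))); last first.
    by field; rewrite gt_eqF.
  have /andP[t0 t1] := S01 x i.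
  by rewrite ler_piMr ?invr_ge0 // mulr_ile1 // ?subr_ge0 // gerBl.
have step1 : walk s l N%:R^-1 F 0 - F s =
    walk s l N%:R^-1 (fun z => F z + (- F s)) 0 by rewrite walkD walk_cst.
rewrite step1 ler_norml; apply/andP; split.
  have : walk s l N%:R^-1 (fun z => (-1) * (F z + - F s)) 0 <= eps.
    apply: le_trans key; apply: walk_le; first exact: S01.
    move=> z; have := bound s z (S01 x); rewrite ler_norml => /andP[+ _]; lra.
  by rewrite walkZ; lra.
apply: le_trans key; apply: walk_le; first exact: S01.
by move=> z; have := bound s z (S01 x); rewrite ler_norml => /andP[_].
Qed.

End TrigApprox.

(** * Convergence of characteristic functions implies convergence in law and
    of moments *)

Lemma cvg_EFin_seq {R : realType} (u : nat -> R) (l : R) :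
  u n @[n --> \oo] --> l -> (u n)%:E @[n --> \oo] --> l%:E.
Proof. by move=> ul; apply: cvg_EFin; [exact: nearW|exact: ul]. Qed.

Section Determination.
Context {R : realType} {r : nat} (Sigma : 'M[R]_r).
Variable mu : probability (r.-tuple R) R.
Implicit Types (a x : 'rV[R]_r) (h p : 'rV[R]_r -> R).

Definition quad (S : 'M[R]_r) a : R := (a *m S *m a^T) 0 0.

Hypothesis mu_char : forall a c,
  \int[mu]_x cos (dot a (vec x) + c) = expR (- (quad Sigma a / 2)) * cos c.

Variable L : nat -> seq (R * 'rV[R]_r).
Hypothesis lawL : forall n, is_law (L n).
Hypothesis L_char : forall a c,
  Ex (L n) (fun x => cos (dot a x + c)) @[n --> \oo] -->
  expR (- (quad Sigma a / 2)) * cos c.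

Lemma measurable_dot_vec a :
  measurable_fun setT (fun x : r.-tuple R => dot a (vec x)).
Proof.
rewrite (_ : (fun _ => _) = (fun x : r.-tuple R => \sum_(i < r) a 0 i * tnth x i)); last first.
  by apply/funext => x; rewrite dotE; apply: eq_bigr => i _; rewrite mxE.
apply: measurable_sum => i; apply: measurable_funM => //; exact: measurable_tnth.
Qed.

Lemma trig_bounded p : trigpoly p -> exists M, forall x, `|p x| <= M.
Proof.
elim=> [a c|p1 p2 _ [M1 h1] _ [M2 h2]|c p1 _ [M1 h1]].
- by exists 1 => x; exact: cos_max.
- by exists (M1 + M2) => x; rewrite (le_trans (ler_normD _ _)) // lerD.
- by exists (`|c| * M1) => x; rewrite normrM ler_wpM2l.
Qed.

Lemma trig_measurable p : trigpoly p ->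
  measurable_fun setT (fun x : r.-tuple R => p (vec x)).
Proof.
elim=> [a c|p1 p2 _ h1 _ h2|c p1 _ h1].
- apply: (@measurableT_comp _ _ _ _ _ _ (@cos R)); first exact: continuous_measurable_fun (@continuous_cos R).
  by apply: measurable_funD => //; exact: measurable_dot_vec.
- exact: measurable_funD.
- exact: measurable_funM.
Qed.

Lemma bounded_integrable (h : r.-tuple R -> R) M : measurable_fun setT h ->
  (forall y, `|h y| <= M) -> mu.-integrable setT (EFin \o h).
Proof.
move=> mh hM; apply: measurable_bounded_integrable => //.
  by rewrite [X in (X < _)%E]probability_setT ltry.
exists M; split; first exact: num_real.
by move=> N MN x _ /=; exact: le_trans (hM x) (ltW MN).
Qed.

Lemma trig_integrable p : trigpoly p ->
  mu.-integrable setT (EFin \o (fun x : r.-tuple R => p (vec x))).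
Proof.
move=> tp; have [M hM] := trig_bounded tp.
by apply: (@bounded_integrable _ M); [exact: trig_measurable|move=> x; exact: hM].
Qed.

Lemma trig_cvg p : trigpoly p ->
  Ex (L n) p @[n --> \oo] --> \int[mu]_x p (vec x).
Proof.
elim=> [a c|p1 p2 t1 h1 t2 h2|c p1 t1 h1].
- by rewrite mu_char; exact: L_char.
- rewrite RintegralD //; [|exact: trig_integrable|exact: trig_integrable].
  under eq_fun do rewrite ExD.
  exact: cvgD.
- rewrite RintegralZl //; last exact: trig_integrable.
  under eq_fun do rewrite ExZ.
  by apply: cvgM => //; exact: cvg_cst.
Qed.

(** Bounded continuous functions are pointwise limits of trigonometric
    polynomials with the same bound. *)
Lemma trig_seq h (M : R) : continuous h -> (forall x, `|h x| <= M) ->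
  exists p : nat -> 'rV[R]_r -> R, forall n, [/\ trigpoly (p n),
    forall x : 'rV[R]_r, `|p n x| <= M & forall x : 'rV[R]_r, (forall i, `|x 0 i| <= n.+1%:R) ->
      `|p n x - h x| <= n.+1%:R^-1].
Proof.
move=> ch hM.
have H n := @trig_approx R r h M n.+1%:R n.+1%:R^-1 ch hM (ltr0Sn R n).
have H' n : exists q, [/\ trigpoly q, forall x : 'rV[R]_r, `|q x| <= M & forall x : 'rV[R]_r,
    (forall i, `|x 0 i| <= n.+1%:R) -> `|q x - h x| <= n.+1%:R^-1].
  by apply: H; rewrite invr_gt0.
by have [p hp] := choice H'; exists p.
Qed.

Lemma invS_cvg0 : (n.+1%:R^-1 : R) @[n --> \oo] --> 0.
Proof. exact: cvg_harmonic. Qed.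

Lemma trig_seq_cvg h (p : nat -> 'rV[R]_r -> R) x :
  (forall n x, (forall i, `|x 0 i| <= n.+1%:R) -> `|p n x - h x| <= n.+1%:R^-1) ->
  p n x @[n --> \oo] --> h x.
Proof.
move=> hp; apply/cvgrPdist_le => e e0.
have h0 := (@cvgrPdist_le _ _ _ _ _ _ _).1 invS_cvg0 _ e0.
near=> n.
have hn : `|x| <= n%:R by near: n; exact: nbhs_infty_ger.
have : `|0 - n.+1%:R^-1| <= e by near: n; exact: h0.
rewrite sub0r normrN ger0_norm // => he.
rewrite distrC (le_trans (hp n x _)) //; 
move=> i; rewrite (le_trans (norm_coord_le x i)) // (le_trans hn) //.
by rewrite ler_nat.
Unshelve. all: by end_near. Qed.

Lemma continuous_measurable h (M : R) : continuous h -> (forall x, `|h x| <= M) ->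
  measurable_fun setT (fun x : r.-tuple R => h (vec x)).
Proof.
move=> ch hM; have [p hp] := trig_seq ch hM.
apply: (@measurable_fun_cvg _ _ _ _ (fun n (x : r.-tuple R) => p n (vec x))).
  by move=> n; apply: trig_measurable; case: (hp n).
by move=> x _; apply: trig_seq_cvg => n; case: (hp n).
Qed.

Lemma continuous_integrable h (M : R) : continuous h -> (forall x, `|h x| <= M) ->
  mu.-integrable setT (EFin \o (fun x : r.-tuple R => h (vec x))).
Proof.
move=> ch hM; apply: (@bounded_integrable _ M); first exact: continuous_measurable hM.
by move=> x; exact: hM.
Qed.

Lemma trig_seq_cvg_integral h (p : nat -> 'rV[R]_r -> R) (M : R) :
  continuous h -> (forall x, `|h x| <= M) ->
  (forall n, trigpoly (p n)) -> (forall n x, `|p n x| <= M) ->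
  (forall x, p n x @[n --> \oo] --> h x) ->
  \int[mu]_x p n (vec x) @[n --> \oo] --> \int[mu]_x h (vec x).
Proof.
move=> ch hM tp pM ph.
have [_ _ D] := @dominated_convergence _ _ _ mu setT measurableT
  (fun n (x : r.-tuple R) => (p n (vec x))%:E) (fun x : r.-tuple R => (h (vec x))%:E) (fun=> M%:E)
  (fun n => (measurable_EFinP _ _).2 (trig_measurable (tp n)))
  ((measurable_EFinP _ _).2 (continuous_measurable ch hM))
  (aeW _ (fun (x : r.-tuple R) _ => cvg_EFin_seq (ph (vec x))))
  (@bounded_integrable (fun=> M) `|M| (measurable_cst M) (fun=> lexx _))
  (aeW _ (fun (x : r.-tuple R) n _ => pM n (vec x))).
apply: fine_cvg; rewrite fineK; first exact: D.
exact: integrable_fin_num (continuous_integrable ch hM).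
Qed.

Hypothesis L_exp : forall (theta : R) i, exists C N0, forall n, (N0 <= n)%N ->
  Ex (L n) (fun x => expR (theta * x 0 i)) <= C.

Definition expsum x : R := 1 + \sum_i (expR (x 0 i) + expR (- x 0 i)).

Lemma L_expsum : exists C N0, forall n, (N0 <= n)%N -> Ex (L n) expsum <= C.
Proof.
have [C1 /choice[N1 h1]] := choice (L_exp 1).
have [C2 /choice[N2 h2]] := choice (L_exp (-1)).
exists (1 + \sum_i (C1 i + C2 i)), (\max_i maxn (N1 i) (N2 i))%N => n hn.
rewrite ExD Ex_cst // Ex_sum lerD2l; apply: ler_sum => i _.
have : (maxn (N1 i) (N2 i) <= n)%N by apply: leq_trans hn; exact: leq_bigmax.
rewrite geq_max => /andP[n1 n2]; rewrite ExD lerD //.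
  by apply: le_trans (h1 i n n1); apply: Ex_le => // y _; rewrite mul1r.
by apply: le_trans (h2 i n n2); apply: Ex_le => // y _; rewrite mulN1r.
Qed.

Lemma norm_exp_le (K : nat) x : `|x| ^+ K <= K`!%:R * expsum x.
Proof.
have eN y : expR `|y| <= expR y + expR (- y) :> R.
  have := expR_gt0 y; have := expR_gt0 (- y).
  by have [y0|y0] := leP 0 y; [rewrite ger0_norm|rewrite ltr0_norm] => // *; lra.
have h1 : `|x| ^+ K <= K`!%:R * expR `|x|.
  case: K => [|K]; first by rewrite expr0 fact0 mul1r -expR0 ler_expR.
  rewrite mulrC -ler_pdivrMr ?ltr0n ?fact_gt0 //.
  by rewrite (le_trans _ (expR_ge1Dxn K (normr_ge0 x))) // lerDr.
rewrite (le_trans h1) // ler_wpM2l //.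
have S0 : 0 <= \sum_i (expR (x 0 i) + expR (- x 0 i)).
  by rewrite sumr_ge0 // => i _; rewrite addr_ge0 ?expR_ge0.
have [x0|xN] := eqVneq `|x| 0; first by rewrite x0 expR0 /expsum lerDl.
have [[j i] /= ji] := mx_norm_neq0 xN.
rewrite (_ : `|x| = `|x 0 i|); last by rewrite -(ord1 j) -ji.
rewrite (le_trans (eN _)) // /expsum (bigD1 i) //= addrCA lerDl addr_ge0 //.
by rewrite sumr_ge0 // => l _; rewrite addr_ge0 ?expR_ge0.
Qed.

Lemma L_moment2 : exists C N0, forall n, (N0 <= n)%N -> forall i,
  Ex (L n) (fun x => x 0 i ^+ 2) <= C.
Proof.
have [C [N0 h]] := L_expsum; exists (2 * C), N0 => n hn i.
apply: (@le_trans _ _ (Ex (L n) (fun x => 2 * expsum x))); last first.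
  by rewrite ExZ ler_wpM2l // h.
apply: Ex_le => // -[q x] _ /=; apply: le_trans (norm_exp_le 2 x).
by rewrite -(real_normK (num_real (x 0 i))) ler_sqr ?nnegrE // norm_coord_le.
Qed.

Lemma continuous_cvg h (M : R) : continuous h -> (forall x, `|h x| <= M) ->
  Ex (L n) h @[n --> \oo] --> \int[mu]_x h (vec x).
Proof.
move=> ch hM; have [p hp] := trig_seq ch hM.
have tp n : trigpoly (p n) by case: (hp n).
have pM n x : `|p n x| <= M by case: (hp n) => _ /(_ x).
have papp n : forall x, (forall i, `|x 0 i| <= n.+1%:R) -> `|p n x - h x| <= n.+1%:R^-1.
  by case: (hp n).
have ph x : p n x @[n --> \oo] --> h x by exact: trig_seq_cvg.
have Ip := trig_seq_cvg_integral ch hM tp pM ph.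
have M0 : 0 <= M := le_trans (normr_ge0 _) (hM 0).
have [C0 [N0 hC0]] := L_moment2.
pose C := Num.max C0 0.
have C_ge0 : 0 <= C by rewrite le_max lexx orbT.
have hC n : (N0 <= n)%N -> forall i, Ex (L n) (fun x => x 0 i ^+ 2) <= C.
  by move=> hn i; rewrite le_max hC0.
pose D := 1 + 2 * M * (r%:R * C).
have D0 : 0 < D by rewrite ltr_pwDl // !mulr_ge0.
have approx n m : (N0 <= n)%N -> `|Ex (L n) h - Ex (L n) (p m)| <= D * m.+1%:R^-1.
  move=> hn; rewrite -ExB (le_trans (Ex_norm _ (lawL n))) //.
  have m0 : 0 < m.+1%:R :> R by rewrite ltr0n.
  apply: (@le_trans _ _ (Ex (L n) (fun x => m.+1%:R^-1 +
     (2 * M * m.+1%:R^-1) * \sum_i x 0 i ^+ 2))).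
    apply: Ex_le => // -[q x] _ /=; have [far|near_] := pselect (exists i, m.+1%:R < `|x 0 i|).
      have [i hi] := far.
      rewrite (@le_trans _ _ (2 * M)) //.
        by rewrite (le_trans (ler_normB _ _)) //; have := hM x; have := pM m x; lra.
      rewrite -[leLHS]add0r lerD ?invr_ge0 // -mulrA ler_peMr ?mulr_ge0 //.
      rewrite mulrC ler_pdivlMr // mul1r (bigD1 i) //= -[leLHS]addr0 lerD //; last first.
        by rewrite sumr_ge0 // => j _; exact: sqr_ge0.
      have m1 : 1 <= m.+1%:R :> R by rewrite ler1n.
      rewrite -(real_normK (num_real (x 0 i))) expr2.
      by rewrite (le_trans (ltW hi)) // ler_peMr // (le_trans m1) // ltW.
    rewrite distrC (le_trans (papp m x _)) //.
      by move=> i; rewrite leNgt; apply/negP => hi; apply: near_; exists i.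
    rewrite lerDl mulr_ge0 // ?mulr_ge0 // ?invr_ge0 // sumr_ge0 // => i _; exact: sqr_ge0.
  rewrite ExD Ex_cst // ExZ Ex_sum.
  rewrite (_ : D * _ = m.+1%:R^-1 + 2 * M * m.+1%:R^-1 * (r%:R * C)); last first.
    by rewrite /D; ring.
  rewrite lerD2l ler_wpM2l ?mulr_ge0 ?invr_ge0 //.
  rewrite (_ : r%:R * C = \sum_(i < r) C); last by rewrite sumr_const card_ord mulr_natl.
  by apply: ler_sum => i _; exact: hC.
apply/cvgrPdist_le => e e0.
have e3 : 0 < e / 3 by rewrite divr_gt0.
have : \forall m \near \oo, D * m.+1%:R^-1 <= e / 3 /\
    `|\int[mu]_x h (vec x) - \int[mu]_x p m (vec x)| <= e / 3.
  have [Ip' cm] := ((@cvgrPdist_le _ _ _ _ _ _ _).1 Ip _ e3, (@cvgrPdist_le _ _ _ _ _ _ _).1 invS_cvg0 _ (divr_gt0 e3 D0)).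
  near=> m; have h1 : `|\int[mu]_x h (vec x) - \int[mu]_x p m (vec x)| <= e / 3.
    by near: m; exact: Ip'.
  have : `|0 - m.+1%:R^-1| <= e / 3 / D by near: m; exact: cm.
  rewrite sub0r normrN (@ger0_norm _ (m.+1%:R^-1)) ?invr_ge0 // => h2.
  by split => //; rewrite mulrC -ler_pdivlMr.
case=> m0 _ /(_ m0 (leqnn _)) [h1 h2].
have h3 := (@cvgrPdist_le _ _ _ _ _ _ _).1 (trig_cvg (tp m0)) _ e3.
near=> n.
have hn : (N0 <= n)%N by near: n; exact: nbhs_infty_ge.
have h5 : `|\int[mu]_x p m0 (vec x) - Ex (L n) (p m0)| <= e / 3.
  by near: n; exact: h3.
have h4 := le_trans (approx n m0 hn) h1.
rewrite (_ : _ - _ = (\int[mu]_x h (vec x) - \int[mu]_x p m0 (vec x)) +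
  ((\int[mu]_x p m0 (vec x) - Ex (L n) (p m0)) - (Ex (L n) h - Ex (L n) (p m0)))); last by ring.
rewrite (le_trans (ler_normD _ _)) // (_ : e = e / 3 + (e / 3 + e / 3)); last by field.
by rewrite lerD // (le_trans (ler_normB _ _)) // lerD.
Unshelve. all: by end_near. Qed.

Lemma continuous_cvg_square (F : 'rV[R]_r -> R) : continuous F ->
  measurable_fun setT (fun x : r.-tuple R => F (vec x)) ->
  (exists C N0, forall n, (N0 <= n)%N -> Ex (L n) (fun x => F x ^+ 2) <= C) ->
  mu.-integrable setT (EFin \o (fun x : r.-tuple R => F (vec x))) /\
  Ex (L n) F @[n --> \oo] --> \int[mu]_x F (vec x).
Proof.
move=> cF mF [C0 [N0 hC0]].
pose C := Num.max C0 0.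
have C_ge0 : 0 <= C by rewrite le_max lexx orbT.
have hC n : (N0 <= n)%N -> Ex (L n) (fun x => F x ^+ 2) <= C.
  by move=> hn; rewrite le_max hC0.
have mF2 : measurable_fun setT (fun x : r.-tuple R => F (vec x) ^+ 2).
  exact: measurable_funX.
pose G (j : nat) x : R := Num.min (F x ^+ 2) j%:R.
have G0 j x : 0 <= G j x by rewrite /G le_min sqr_ge0 /=.
have cG j : continuous (G j).
  have c1 : continuous (fun y : R => Num.min (y ^+ 2) j%:R).
    move=> y; have c0 : {for y, continuous (fun y : R => y ^+ 2)} by exact: exprn_continuous.
    have c2 : {for y, continuous (fun _ : R => j%:R : R)} by exact: cst_continuous.
    exact: (continuous_min c0 c2).
  by move=> x; exact: (continuous_comp (cF x) (c1 (F x))).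
have Gj j x : `|G j x| <= j%:R by rewrite ger0_norm // /G ge_min lexx orbT.
have IG j : \int[mu]_x G j (vec x) <= C.
  have := continuous_cvg (@cG j) (Gj j) => /cvg_lim <- //.
  apply: limr_le; first by apply/cvg_ex; eexists; exact: continuous_cvg (@cG j) (Gj j).
  near=> n; have hn : (N0 <= n)%N by near: n; exact: nbhs_infty_ge.
  by apply: le_trans (hC n hn); apply: Ex_le => // y _; rewrite /G ge_min lexx.
have I2 : (\int[mu]_x (F (vec x) ^+ 2)%:E <= C%:E)%E.
  have lG (x : r.-tuple R) : limn (fun j => (G j (vec x))%:E) = (F (vec x) ^+ 2)%:E.
    apply/cvg_lim => //; apply: cvg_EFin_seq.
    apply: cvg_near_cst; near=> j; rewrite /G; apply/min_idPl.
    by near: j; exact: nbhs_infty_ger.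
  have mG j : measurable_fun setT (fun x : r.-tuple R => (G j (vec x))%:E).
    by apply/measurable_EFinP; exact: continuous_measurable (@cG j) (Gj j).
  have G0e j (x : r.-tuple R) : setT x -> (0 <= (G j (vec x))%:E)%E by rewrite lee_fin.
  have Gnd (x : r.-tuple R) : setT x -> {homo (fun j => (G j (vec x))%:E) : i j / (i <= j)%N >-> (i <= j)%E}.
    by move=> _ i j ij; rewrite lee_fin /G le_min !ge_min lexx ler_nat ij orbT.
  have mc := @monotone_convergence _ _ _ mu setT measurableT _ mG G0e Gnd.
  under eq_integral do rewrite -lG.
  rewrite mc; apply: lime_le.
    apply: ereal_nondecreasing_is_cvgn => i j ij.
    by apply: ge0_le_integral => // x Tx; [exact: G0e|exact: Gnd].
  near=> j; rewrite -[leLHS]fineK; first by rewrite lee_fin; exact: IG.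
  exact: integrable_fin_num (continuous_integrable (@cG j) (Gj j)).
have F2i : mu.-integrable setT (EFin \o (fun x : r.-tuple R => F (vec x) ^+ 2)).
  apply/integrableP; split; first exact/measurable_EFinP.
  under eq_integral do rewrite /= ger0_norm ?sqr_ge0 //.
  by rewrite (le_lt_trans I2) // ltry.
have i1 : mu.-integrable setT (EFin \o (fun _ : r.-tuple R => 1 : R)).
  by apply: (@bounded_integrable _ 1) => // y; rewrite normr1.
have Fi : mu.-integrable setT (EFin \o (fun x : r.-tuple R => F (vec x))).
  apply: (@le_integrable _ _ _ mu setT measurableT _
    (EFin \o (fun x : r.-tuple R => 1 + F (vec x) ^+ 2))).
  - exact/measurable_EFinP.
  - move=> x _; rewrite /= lee_fin [leRHS]ger0_norm ?addr_ge0 ?sqr_ge0 //.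
    rewrite -(real_normK (num_real (F (vec x)))); set y := `|_|.
    have : 0 <= (y - 1) ^+ 2 by rewrite sqr_ge0.
    by rewrite sqrrB1; have : 0 <= y := normr_ge0 _; have := sqr_ge0 y; lra.
  - have := integrableD measurableT i1 F2i.
    by apply: eq_integrable => // x _; rewrite /= EFinD.
split=> //.
have RI2 : \int[mu]_x (F (vec x) ^+ 2) <= C.
  rewrite -lee_fin fineK //; exact: integrable_fin_num F2i.
pose H (j : nat) x : R := Num.max (- j%:R) (Num.min j%:R (F x)).
have cH j : continuous (H j).
  have c1 : continuous (fun y : R => Num.max (- j%:R) (Num.min j%:R y)).
    move=> y; have c0 : {for y, continuous (fun y : R => y)} by exact: cvg_id.
    have c2 : {for y, continuous (fun _ : R => j%:R : R)} by exact: cst_continuous.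
    have c3 : {for y, continuous (fun _ : R => - j%:R : R)} by exact: cst_continuous.
    exact: (continuous_max c3 (continuous_min c2 c0)).
  by move=> x; exact: (continuous_comp (cF x) (c1 (F x))).
have Hj j x : `|H j x| <= j%:R.
  rewrite ler_norml /H le_max lexx /= ge_max ge_min lexx /= andbT.
  by rewrite (@le_trans _ _ 0) // oppr_le0.
have Hi j := continuous_integrable (@cH j) (Hj j).
have FH j x : (0 < j)%N -> `|F x - H j x| <= F x ^+ 2 * j%:R^-1.
  move=> j0; have jp : 0 < j%:R :> R by rewrite ltr0n.
  rewrite ler_pdivlMr //.
  have [Fj|Fj] := leP `|F x| j%:R.
    have [a b] := andP (etrans (esym (ler_norml _ _)) Fj).
    by rewrite /H (min_idPr b) (max_idPr a) subrr normr0 mul0r sqr_ge0.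
  rewrite -(real_normK (num_real (F x))) expr2 ler_pM //; last exact: ltW.
  rewrite /H; have [F0|F0] := leP 0 (F x).
    move: Fj; rewrite (ger0_norm F0) => Fj.
    rewrite (min_idPl (ltW Fj)) max_r; last by rewrite (@le_trans _ _ 0) // oppr_le0.
    by rewrite ger0_norm ?subr_ge0 ?(ltW Fj) // gerBl.
  move: Fj; rewrite (ltr0_norm F0) => Fj.
  rewrite (@min_idPr _ _ j%:R (F x) _) ?(le_trans (ltW F0)) // max_l; last by lra.
  by rewrite ler0_norm; lra.
apply/cvgrPdist_le => e e0.
have e3 : 0 < e / 3 by rewrite divr_gt0.
pose j := (Num.truncn (C / (e / 3))).+1.
have jp : 0 < j%:R :> R by rewrite ltr0n.
have hj : C * j%:R^-1 <= e / 3.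
  by rewrite ler_pdivrMr // mulrC -ler_pdivrMr // ltW // truncnS_gt.
have h3 := (@cvgrPdist_le _ _ _ _ _ _ _).1 (continuous_cvg (@cH j) (Hj j)) _ e3.
near=> n.
have hn : (N0 <= n)%N by near: n; exact: nbhs_infty_ge.
have h5 : `|\int[mu]_x H j (vec x) - Ex (L n) (H j)| <= e / 3 by near: n; exact: h3.
have h4 : `|Ex (L n) F - Ex (L n) (H j)| <= e / 3.
  apply: le_trans hj; rewrite -ExB (le_trans (Ex_norm _ (lawL n))) //.
  apply: (@le_trans _ _ (Ex (L n) (fun x => j%:R^-1 * F x ^+ 2))).
    by apply: Ex_le => // y _; rewrite [leRHS]mulrC FH.
  by rewrite ExZ mulrC ler_wpM2r ?invr_ge0 // hC.
have h6 : `|\int[mu]_x F (vec x) - \int[mu]_x H j (vec x)| <= e / 3.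
  have iB : mu.-integrable setT (EFin \o (fun x : r.-tuple R => F (vec x) - H j (vec x))).
    have := integrableB measurableT Fi (Hi j).
    by apply: eq_integrable => // x _; rewrite /= EFinB.
  apply: le_trans hj; rewrite -RintegralB // (le_trans (le_normr_Rintegral _ iB)) //.
  apply: (@le_trans _ _ (\int[mu]_x (j%:R^-1 * F (vec x) ^+ 2))).
    apply: le_Rintegral => //; first exact: integrable_norm.
      exact: (integrableZl _ (j%:R^-1) F2i).
    by move=> x _; rewrite [leRHS]mulrC FH.
  by rewrite RintegralZl // mulrC ler_wpM2r ?invr_ge0.
rewrite (_ : _ - _ = (\int[mu]_x F (vec x) - \int[mu]_x H j (vec x)) +
  ((\int[mu]_x H j (vec x) - Ex (L n) (H j)) - (Ex (L n) F - Ex (L n) (H j)))); last by ring.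
rewrite (le_trans (ler_normD _ _)) // (_ : e = e / 3 + (e / 3 + e / 3)); last by field.
by rewrite lerD // (le_trans (ler_normB _ _)) // lerD.
Unshelve. all: by end_near. Qed.


Lemma continuous_monomial (alpha : 'I_r -> nat) :
  continuous (fun x => \prod_i x 0 i ^+ alpha i).
Proof.
elim: (index_enum _) => [|i l ih] x.
  rewrite (_ : (fun _ => _) = (fun=> 1)); first exact: cst_continuous.
  by apply/funext => y; rewrite big_nil.
rewrite (_ : (fun _ => _) = (fun y : 'rV[R]_r =>
    y 0 i ^+ alpha i * \prod_(j <- l) y 0 j ^+ alpha j)); last first.
  by apply/funext => y; rewrite big_cons.
have c1 : {for x, continuous (fun x : 'rV[R]_r => x 0 i)} by exact: coord_continuous.
have c2 := continuous_comp c1 (@exprn_continuous R (alpha i) (x 0 i)).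
exact: (cvgM c2 (ih x)).
Qed.

Lemma norm_monomial_le (alpha : 'I_r -> nat) x :
  `|\prod_i x 0 i ^+ alpha i| <= `|x| ^+ (\sum_i alpha i)%N.
Proof.
rewrite normr_prod -prodrXr; apply: ler_prod => i _.
by rewrite normr_ge0 normrX lerXn2r ?nnegrE // norm_coord_le.
Qed.

Lemma moment_cvg (alpha : 'I_r -> nat) :
  mu.-integrable setT (EFin \o (fun y : r.-tuple R => \prod_i tnth y i ^+ alpha i)) /\
  Ex (L n) (fun x => \prod_i x 0 i ^+ alpha i) @[n --> \oo] -->
  \int[mu]_y \prod_i tnth y i ^+ alpha i.
Proof.
have e : (fun y : r.-tuple R => \prod_i tnth y i ^+ alpha i) =
    (fun y => \prod_i vec y 0 i ^+ alpha i).
  by apply/funext => y; apply: eq_bigr => i _; rewrite mxE.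
have me : measurable_fun setT (fun y : r.-tuple R => \prod_i tnth y i ^+ alpha i).
  by apply: measurable_prod => i _; apply: measurable_funX; exact: measurable_tnth.
rewrite e in me *.
apply: (@continuous_cvg_square (fun x => \prod_i x 0 i ^+ alpha i)).
- exact: continuous_monomial.
- exact: me.
have [C [N0 hC]] := L_expsum.
pose K := (\sum_i alpha i)%N; exists ((K * 2)`!%:R * C), N0 => n hn.
apply: (@le_trans _ _ (Ex (L n) (fun x => (K * 2)`!%:R * expsum x))); last first.
  by rewrite ExZ ler_wpM2l // hC.
apply: Ex_le => // -[q x] _ /=; apply: le_trans (norm_exp_le _ x).
by rewrite exprM -(real_normK (num_real (\prod_i _))) ler_sqr ?nnegrE ?exprn_ge0 // norm_monomial_le.
Qed.

Context {d : measure_display} {T : measurableType d} (P : probability T R).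
Variable Z : nat -> T -> 'rV[R]_r.
Hypothesis Z_law : forall n h, ('E_P[fun t => h (Z n t)] = (Ex (L n) h)%:E)%E.

Theorem char_determines :
  cvg_in_distribution P Z mu /\ cvg_all_moments P Z mu.
Proof.
split=> [h ch [M hM]|alpha].
  under eq_fun do rewrite Z_law.
  rewrite (_ : (\int[mu]_x (h (vec x))%:E)%E = (\int[mu]_x h (vec x))%:E).
    exact/cvg_EFin_seq/(continuous_cvg ch hM).
  by rewrite fineK //; exact: integrable_fin_num (continuous_integrable ch hM).
have [im cm] := moment_cvg alpha.
under eq_fun do rewrite (Z_law _ (fun x => \prod_i x 0 i ^+ alpha i)).
rewrite (_ : (\int[mu]_y (\prod_i tnth y i ^+ alpha i)%:E)%E =
  (\int[mu]_y \prod_i tnth y i ^+ alpha i)%:E); first exact: cvg_EFin_seq.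
by rewrite fineK //; exact: integrable_fin_num im.
Qed.

End Determination.

(** * Gaussian measures *)

Section AffineChange.
Context {R : realType}.
Local Notation leb := (@lebesgue_measure R).
Implicit Types (c b m s t : R) (A : set R).

Definition affine c b (x : measurableTypeR R) : measurableTypeR R := c * x + b.

Lemma measurable_affine c b : measurable_fun setT (affine c b).
Proof.
by apply: measurable_funD => //; exact: measurable_funM.
Qed.

HB.instance Definition _ c b := isMeasurableFun.Build _ _ _ _ (affine c b)
  (measurable_affine c b).

Lemma lebesgue_affine c b A : c != 0 -> measurable A ->
  leb A = (`|c|%:E * pushforward leb (affine c b) A)%E.
Proof.
move=> c0 mA.
have nc : 0 <= `|c| by [].
apply: (@lebesgue_measure_unique R (mscale (NngNum nc) (pushforward leb (affine c b)))) => //.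
move=> _ [[x y]] _ <- /=.
rewrite [RHS](_ : _ = (`|c|%:E * leb (affine c b @^-1` `]x, y]%classic))%E) //.
have [cp|cn] := ltP 0 c.
  rewrite (_ : _ @^-1` _ = `](x - b) / c, (y - b) / c]%classic); last first.
    apply/seteqP; split=> z /=; rewrite !in_itv /= /affine => /andP[h1 h2];
    apply/andP; split.
    - by rewrite ltr_pdivrMr // ltrBlDr mulrC.
    - by rewrite ler_pdivlMr // lerBrDr mulrC.
    - by rewrite -ltrBlDr mulrC -ltr_pdivrMr.
    - by rewrite -lerBrDr mulrC -ler_pdivlMr.
  rewrite !lebesgue_measure_itv /= !lte_fin ltr_pM2r ?invr_gt0 // ltrD2r.
  case: ifPn => _; last by rewrite mule0.
  rewrite -!EFinB -EFinM gtr0_norm //; congr EFin; field.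
  by rewrite gt_eqF.
have {cn} cn : c < 0 by rewrite lt_neqAle c0.
rewrite (_ : _ @^-1` _ = `[(y - b) / c, (x - b) / c[%classic); last first.
  apply/seteqP; split=> z /=; rewrite !in_itv /= /affine => /andP[h1 h2];
  apply/andP; split.
  - by rewrite ler_ndivrMr // lerBrDr mulrC.
  - by rewrite ltr_ndivlMr // ltrBlDr mulrC.
  - by rewrite -ltrBlDr mulrC -ltr_ndivlMr.
  - by rewrite -lerBrDr mulrC -ler_ndivrMr.
rewrite !lebesgue_measure_itv /= !lte_fin ltr_nM2r ?invr_lt0 // ltrD2r.
case: ifPn => _; last by rewrite mule0.
rewrite -!EFinB -EFinM ltr0_norm //; congr EFin; field.
by rewrite lt_eqF.
Qed.

Lemma normal_pdf_affine c b m s x : c != 0 -> s != 0 ->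
  `|c| * normal_pdf (c * m + b) (`|c| * s) (c * x + b) = normal_pdf m s x.
Proof.
move=> c0 s0; have cs : `|c| * s != 0 by rewrite mulf_neq0 ?normr_eq0.
rewrite !normal_pdfE // /normal_peak /normal_fun.
have -> : c * x + b - (c * m + b) = c * (x - m) by ring.
rewrite !exprMn real_normK ?num_real //.
have -> : - (c ^+ 2 * (x - m) ^+ 2) / ((c ^+ 2 * s ^+ 2) *+ 2) =
  - (x - m) ^+ 2 / (s ^+ 2 *+ 2) by field; rewrite s0 c0.
rewrite mulrA; congr (_ * _).
have -> : (c ^+ 2 * s ^+ 2 * pi) *+ 2 = c ^+ 2 * (s ^+ 2 * pi *+ 2).
  by rewrite mulrnAr mulrA.
by rewrite sqrtrM ?sqr_ge0 // sqrtr_sqr invfM mulrA divff ?mul1r // normr_eq0.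
Qed.

(** The image of a normal law under an affine map is normal. *)
Lemma normal_prob_affine c b m s A : c != 0 -> s != 0 -> measurable A ->
  normal_prob m s (affine c b @^-1` A) =
  normal_prob (c * m + b) (`|c| * s) A.
Proof.
move=> c0 s0 mA; rewrite /normal_prob.
have nc : 0 <= `|c| by [].
pose pf := (fun x => (normal_pdf (c * m + b) (`|c| * s) x)%:E).
have mp : measurable_fun A pf.
  by apply: measurable_funTS; apply/measurable_EFinP; exact: measurable_normal_pdf.
have p0 x : (0 <= pf x)%E by rewrite lee_fin normal_pdf_ge0.
rewrite -/pf (@eq_measure_integral _ (measurableTypeR R) _ A
  (mscale (NngNum nc) (pushforward leb (affine c b)))); last first.
  by move=> E mE EA; exact: lebesgue_affine.
rewrite ge0_integral_mscale //; last by move=> x _; exact: p0.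
have ma := @measurable_affine c b.
rewrite (@ge0_integral_pushforward _ _ _ _ _ _ ma leb A pf mA mp); last first.
  by move=> x _; exact: p0.
have mA' : measurable (affine c b @^-1` A) by rewrite -[X in measurable X]setTI; exact: ma.
rewrite -ge0_integralZl //=.
- by apply: eq_integral => x _; rewrite /pf /= -EFinM normal_pdf_affine.
- apply: measurable_funTS; apply/measurable_EFinP.
  by apply: measurableT_comp; [exact: measurable_normal_pdf|exact: ma].
Qed.

Lemma ge0_integral_normal_prob m s (f : R -> \bar R) :
  measurable_fun setT f -> (forall x, (0 <= f x)%E) ->
  (\int[normal_prob m s]_x f x = \int[leb]_x (f x * (normal_pdf m s x)%:E))%E.
Proof.
move=> mf f0.
pose nu : {finite_measure set (measurableTypeR R) -> \bar R} := normal_prob m s.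
have dom : nu `<< leb by exact: normal_prob_dominates.
rewrite -(@Radon_Nikodym_SigmaFinite.change_of_variables _ _ _ nu leb dom) //.
have mrn : measurable_fun setT (Radon_Nikodym_SigmaFinite.f nu leb).
  by apply: (measurable_int leb); exact: Radon_Nikodym_SigmaFinite.f_integrable.
have mpdf : measurable_fun setT (fun x => (normal_pdf m s x)%:E).
  by apply/measurable_EFinP; exact: measurable_normal_pdf.
apply: ae_eq_integral => //; [exact: emeasurable_funM|exact: emeasurable_funM|].
apply: ae_eqe_mul2l => /=; apply: integral_ae_eq => //=.
  exact: Radon_Nikodym_SigmaFinite.f_integrable.
by move=> E _ mE; rewrite -Radon_Nikodym_SigmaFinite.f_integral.
Qed.

(** Completing the square in [x]. *)
Lemma normal_pdf_mix c t x z : 0 < t ->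
  normal_pdf (c * x) t z * normal_pdf 0 1 x =
  normal_pdf 0 (Num.sqrt (c ^+ 2 + t ^+ 2)) z *
  normal_pdf (c * z / (c ^+ 2 + t ^+ 2)) (t / Num.sqrt (c ^+ 2 + t ^+ 2)) x.
Proof.
move=> t0; have q0 : 0 < c ^+ 2 + t ^+ 2 by rewrite ltr_wpDl ?sqr_ge0 ?exprn_gt0.
set u := Num.sqrt _.
have u0 : 0 < u by rewrite sqrtr_gt0.
have u2 : u ^+ 2 = c ^+ 2 + t ^+ 2 by rewrite sqr_sqrtr // ltW.
rewrite !normal_pdfE ?gt_eqF ?divr_gt0 // /normal_peak /normal_fun.
rewrite -!u2 mulrACA [RHS]mulrACA -!invfM -!expRD; congr (_^-1 * expR _).
  rewrite -!sqrtrM ?mulrn_wge0 ?mulr_ge0 ?sqr_ge0 ?pi_ge0 //.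
  congr Num.sqrt; field; rewrite gt_eqF //.
all: try first [exact: (ltW t0)|exact: (ltW u0)].
have c2 : c ^+ 2 = u ^+ 2 - t ^+ 2 by rewrite u2 addrK.
have e : (t ^+ 2 * u ^+ 2 * 2) * (- (z - c * x) ^+ 2 / (t ^+ 2 *+ 2) + - (x - 0) ^+ 2 / (1 ^+ 2 *+ 2)) =
  (t ^+ 2 * u ^+ 2 * 2) * (- (z - 0) ^+ 2 / (u ^+ 2 *+ 2) +
     - (x - c * z / u ^+ 2) ^+ 2 / ((t / u) ^+ 2 *+ 2)).
  have -> : (t ^+ 2 * u ^+ 2 * 2) * (- (z - c * x) ^+ 2 / (t ^+ 2 *+ 2) + - (x - 0) ^+ 2 / (1 ^+ 2 *+ 2))
    = - u ^+ 2 * (z ^+ 2 - 2 * z * c * x + c ^+ 2 * x ^+ 2) - t ^+ 2 * u ^+ 2 * x ^+ 2.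
    by field; rewrite gt_eqF.
  have -> : (t ^+ 2 * u ^+ 2 * 2) * (- (z - 0) ^+ 2 / (u ^+ 2 *+ 2) +
     - (x - c * z / u ^+ 2) ^+ 2 / ((t / u) ^+ 2 *+ 2)) =
     - t ^+ 2 * z ^+ 2 - (u ^+ 4 * x ^+ 2 - 2 * u ^+ 2 * x * c * z + c ^+ 2 * z ^+ 2).
    by field; rewrite !gt_eqF.
  by rewrite c2; ring.
have n0 : t ^+ 2 * u ^+ 2 * 2 != 0 by rewrite !mulf_neq0 ?expf_neq0 ?gt_eqF.
exact: (mulfI n0 e).
Qed.

(** If [X] is standard normal and, given [X], [Z] is normal with mean [c X] and
    standard deviation [t], then [Z] is normal. *)
Lemma normal_prob_mix c t A : 0 < t -> measurable A ->
  (\int[normal_prob 0 1]_x normal_prob (c * x) t A =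
   normal_prob 0 (Num.sqrt (c ^+ 2 + t ^+ 2)) A)%E.
Proof.
move=> t0 mA; have q0 : 0 < c ^+ 2 + t ^+ 2 by rewrite ltr_wpDl ?sqr_ge0 ?exprn_gt0.
set u := Num.sqrt _.
have u0 : 0 < u by rewrite sqrtr_gt0.
pose G (xz : measurableTypeR R * measurableTypeR R) :=
  (normal_pdf (c * xz.1) t xz.2 * \1_A xz.2)%:E.
have mG : measurable_fun setT G.
  apply/measurable_EFinP; apply: measurable_funM; last first.
    by apply: measurableT_comp => //; exact: measurable_indic.
  rewrite (_ : (fun _ => _) = (fun xz : measurableTypeR R * measurableTypeR R =>
    normal_peak t * expR (- (xz.2 - c * xz.1) ^+ 2 / (t ^+ 2 *+ 2)))); last first.
    by apply/funext => xz; rewrite normal_pdfE // gt_eqF.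
  apply: measurable_funM => //; apply: measurableT_comp => //.
  apply: measurable_funM => //; apply: measurableT_comp => //.
  apply: measurable_funX; apply: measurable_funB => //.
  exact: measurable_funM.
have G0 xz : (0 <= G xz)%E by rewrite lee_fin mulr_ge0 ?normal_pdf_ge0 // indicE.
have FE x : normal_prob (c * x) t A = (\int[leb]_z G (x, z))%E.
  rewrite /normal_prob integral_mkcond; apply: eq_integral => z _.
  by rewrite /G /= patchE indicE; case: ifPn => zA; rewrite ?mulr1 ?mulr0.
under eq_integral do rewrite FE.
rewrite ge0_integral_normal_prob; last 2 first.
- exact: (@measurable_fun_fubini_tonelli_F _ _ _ _ _ leb G mG G0).
- by move=> x; exact: integral_ge0.
pose H (xz : measurableTypeR R * measurableTypeR R) :=
  (G xz * (normal_pdf 0 1 xz.1)%:E)%E.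
have mH : measurable_fun setT H.
  apply: emeasurable_funM => //; apply/measurable_EFinP.
  by apply: measurableT_comp; [exact: measurable_normal_pdf|exact: measurable_fst].
have H0 xz : (0 <= H xz)%E by rewrite mule_ge0 // lee_fin normal_pdf_ge0.
transitivity (\int[leb]_x \int[leb]_z H (x, z))%E.
  apply: eq_integral => x _; rewrite -ge0_integralZr //.
  - exact: measurableT_comp.
  - by rewrite lee_fin normal_pdf_ge0.
rewrite (@fubini_tonelli _ _ _ _ _ leb leb H mH H0).
rewrite [RHS]integral_mkcond; apply: eq_integral => z _.
rewrite patchE; case: ifPn => zA; last first.
  rewrite integral0_eq // => x _.
  by rewrite /H /G /= indicE (negbTE zA) mulr0 mul0e.
transitivity (\int[leb]_x ((normal_pdf 0 u z)%:E *
   (normal_pdf (c * z / (c ^+ 2 + t ^+ 2)) (t / u) x)%:E))%E.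
  apply: eq_integral => x _.
  by rewrite /H /G /= indicE zA mulr1 -!EFinM normal_pdf_mix.
rewrite ge0_integralZl //.
- by rewrite integral_normal_pdf mule1.
- by apply/measurable_EFinP; exact: measurable_normal_pdf.
- by move=> x _; rewrite lee_fin normal_pdf_ge0.
- by rewrite lee_fin normal_pdf_ge0.
Qed.

End AffineChange.

Section ProductProbability.
Context {d1 d2 : measure_display} {T1 : measurableType d1}
  {T2 : measurableType d2} {R : realType}.
Variables (P1 : probability T1 R) (P2 : probability T2 R).

Definition prod_prob : set (T1 * T2) -> \bar R := (P1 \x P2)%E.

HB.instance Definition _ := Measure.on prod_prob.

Lemma prod_prob_setT : prod_prob setT = 1%E.
Proof.
rewrite /prod_prob -setXTT.
transitivity (P1 setT * P2 setT)%E; first exact: product_measure1E.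
by rewrite !probability_setT mule1.
Qed.

HB.instance Definition _ := Measure_isProbability.Build _ _ _ prod_prob
  prod_prob_setT.

End ProductProbability.

Section NormalChar.
Context {R : realType}.
Implicit Types (s t c : R) (h : R -> R).
Local Notation N01 := (normal_prob (0 : R) 1).

Lemma bounded_integrable_prob d (T : measurableType d) (P : probability T R)
  (h : T -> R) (M : R) : measurable_fun setT h -> (forall x, `|h x| <= M) ->
  P.-integrable setT (EFin \o h).
Proof.
move=> mh hM; apply: measurable_bounded_integrable => //.
  by rewrite [X in (X < _)%E]probability_setT ltry.
exists M; split; first exact: num_real.
by move=> N MN x _ /=; exact: le_trans (hM x) (ltW MN).
Qed.

Lemma measurable_cos_affine s t : measurable_fun setT (fun x : R => cos (s * x + t)).
Proof.
apply: (@measurableT_comp _ _ _ _ _ _ (@cos R)).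
  exact: continuous_measurable_fun (@continuous_cos R).
by apply: measurable_funD => //; exact: measurable_funM.
Qed.

Lemma measurable_sin_linear s : measurable_fun setT (fun x : R => sin (s * x)).
Proof.
apply: (@measurableT_comp _ _ _ _ _ _ (@sin R)).
  exact: continuous_measurable_fun (@continuous_sin R).
exact: (measurable_funM (measurable_cst s) (@measurable_id _ _ setT)).
Qed.

Lemma measurable_cos_linear s : measurable_fun setT (fun x : R => cos (s * x)).
Proof.
by have := measurable_cos_affine s 0; under eq_fun do rewrite addr0.
Qed.

Lemma measurable_expR_linear s : measurable_fun setT (fun x : R => expR (s * x)).
Proof.
by apply: (@measurableT_comp _ _ _ _ _ _ (@expR R)).
Qed.

(** A measure whose value on every set is that of the image of [P] by [phi]
    integrates bounded functions like [P] does after composition. *)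
Lemma Rintegral_image d1 d2 (T1 : measurableType d1) (T2 : measurableType d2)
  (P : probability T1 R) (phi : T1 -> T2) (nu : {measure set T2 -> \bar R})
  (h : T2 -> R) (M : R) : measurable_fun setT phi ->
  (forall A, measurable A -> nu A = P (phi @^-1` A)) ->
  measurable_fun setT h -> (forall x, `|h x| <= M) ->
  \int[nu]_x h x = \int[P]_x h (phi x).
Proof.
move=> mphi nuE mh hM; rewrite /Rintegral; congr fine.
rewrite (@eq_measure_integral _ _ _ setT (pushforward P phi)); last first.
  by move=> A mA _; exact: nuE.
rewrite integral_pushforward //.
- exact/measurable_EFinP.
- rewrite preimage_setT.
  apply: (@bounded_integrable_prob _ _ P (h \o phi) M); first exact: measurableT_comp.
  by move=> x; exact: hM.
Qed.

Lemma normal_cst c : \int[N01]_x (fun=> c) x = c.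
Proof.
rewrite (Rintegral_cst _ measurableT).
by rewrite [X in fine X](_ : _ = 1%E) ?mulr1 //; exact: probability_setT.
Qed.

Definition normal_cos t : R := \int[N01]_x cos (t * x).

Lemma normal_scale c h (M : R) : c != 0 -> measurable_fun setT h ->
  (forall x, `|h x| <= M) ->
  \int[normal_prob 0 `|c|]_x h x = \int[N01]_x h (c * x).
Proof.
move=> c0 mh hM.
rewrite (@Rintegral_image _ _ _ _ (normal_prob 0 1) (affine c 0) (normal_prob 0 `|c|) h M) //.
- by apply: eq_Rintegral => x _; rewrite /affine addr0.
- move=> A mA; have := @normal_prob_affine R c 0 0 1 A c0 (oner_neq0 _) mA.
  by rewrite mulr0 addr0 mulr1 => e; exact: esym e.
Qed.

Lemma normal_sin t : \int[N01]_x sin (t * x) = 0.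
Proof.
have ms := @measurable_sin_linear.
have N1 : (-1 : R) != 0 by rewrite oppr_eq0 oner_neq0.
have := normal_scale N1 (ms t) (fun x => sin_max _).
rewrite normrN1 => e; suff : \int[N01]_x sin (t * x) = - \int[N01]_x sin (t * x) by lra.
rewrite {1}e -[RHS]mulN1r -RintegralZl //.
  by apply: eq_Rintegral => x _; rewrite mulN1r mulrN sinN mulN1r.
by apply: (@bounded_integrable_prob _ _ N01 _ 1 (ms t)) => x; exact: sin_max.
Qed.

Lemma Rintegral_cos_phase t c :
  \int[N01]_x cos (t * x + c) = normal_cos t * cos c.
Proof.
have ms := @measurable_sin_linear.
have isn : N01.-integrable setT (EFin \o (fun x : R => sin (t * x))).
  by apply: (@bounded_integrable_prob _ _ N01 _ 1 (ms t)) => x; exact: sin_max.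
have ic : N01.-integrable setT (EFin \o (fun x : R => cos (t * x))).
  by apply: (@bounded_integrable_prob _ _ N01 _ 1 (measurable_cos_linear t)) => x; exact: cos_max.
transitivity (\int[N01]_x (cos c * cos (t * x) + (- sin c) * sin (t * x))).
  by apply: eq_Rintegral => x _; rewrite cosD; ring.
rewrite RintegralD //; last 2 first.
- exact: (integrableZl _ (cos c) ic).
- exact: (integrableZl _ (- sin c) isn).
by rewrite !RintegralZl // normal_sin mulr0 addr0 mulrC.
Qed.

(** The sum of two independent standard normal variables is [sqrt 2] times a
    standard normal variable. *)
Lemma normal_cos_sqrt2 t : normal_cos (t * Num.sqrt 2) = normal_cos t ^+ 2.
Proof.
have s2 : Num.sqrt 2 != 0 :> R by rewrite gt_eqF // sqrtr_gt0.
have mct := measurable_cos_linear t.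
have := normal_scale s2 mct (fun x => cos_max _).
have -> : `|Num.sqrt (2 : R)| = Num.sqrt 2 by rewrite ger0_norm // sqrtr_ge0.
move=> e1.
have -> : normal_cos (t * Num.sqrt 2) = \int[N01]_x cos (t * (Num.sqrt 2 * x)).
  by apply: eq_Rintegral => x _; rewrite mulrA.
rewrite -e1.
pose phi (xy : measurableTypeR R * measurableTypeR R) : measurableTypeR R := xy.2 + xy.1.
have mphi : measurable_fun setT phi by exact: measurable_funD.
pose PP := prod_prob N01 N01.
have PPE A : measurable A -> normal_prob 0 (Num.sqrt 2) A = PP (phi @^-1` A).
  move=> mA; have := @normal_prob_mix R 1 1 A ltr01 mA.
  rewrite expr1n -[1 + 1]/2 => <-.
  apply: eq_integral => x _; rewrite /= mul1r.
  have := @normal_prob_affine R 1 x 0 1 A (oner_neq0 _) (oner_neq0 _) mA.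
  rewrite mulr0 add0r normr1 mulr1 => <-; congr (normal_prob _ _ _).
  by apply/seteqP; split=> y; rewrite /xsection /= inE /phi /affine /= mul1r.
transitivity (\int[PP]_z cos (t * phi z)).
  exact: (@Rintegral_image _ _ _ _ PP phi (normal_prob 0 (Num.sqrt 2))
    (fun x => cos (t * x)) 1 mphi PPE mct (fun x => cos_max _)).
have iPP : PP.-integrable setT (EFin \o (fun z => cos (t * phi z))).
  apply: (@bounded_integrable_prob _ _ PP _ 1) => [|x]; last exact: cos_max.
  exact: (measurableT_comp mct mphi).
rewrite /Rintegral -(integral12_prod_meas1 iPP) /fubini_F.
transitivity (\int[N01]_x (normal_cos t * cos (t * x))).
  rewrite /Rintegral; congr fine; apply: eq_integral => x _.
  have i : N01.-integrable setT (EFin \o (fun y : R => cos (t * y + t * x))).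
    exact: (@bounded_integrable_prob _ _ N01 _ 1 (measurable_cos_affine t (t * x))
      (fun y => cos_max _)).
  rewrite -Rintegral_cos_phase /Rintegral (fineK (integrable_fin_num measurableT i)).
  by apply: eq_integral => y _; rewrite /phi /= mulrDr.
have ic : N01.-integrable setT (EFin \o (fun x : R => cos (t * x))).
  exact: (@bounded_integrable_prob _ _ N01 _ 1 mct (fun y => cos_max _)).
rewrite (RintegralZl _ measurableT ic) expr2 //.
Qed.

Lemma normal_mgf t : (\int[N01]_x (expR (t * x))%:E = (expR (t ^+ 2 / 2))%:E)%E.
Proof.
have me : measurable_fun setT (fun x : R => (expR (t * x))%:E).
  by apply/measurable_EFinP; exact: measurable_expR_linear.
rewrite (ge0_integral_normal_prob 0 1 me) => [|x]; last by rewrite lee_fin expR_ge0.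
transitivity (\int[@lebesgue_measure R]_x ((expR (t ^+ 2 / 2))%:E * (normal_pdf t 1 x)%:E))%E.
  apply: eq_integral => x _; rewrite -!EFinM !normal_pdfE ?oner_neq0 // /normal_fun.
  congr EFin; rewrite mulrCA [RHS]mulrCA; congr (_ * _); rewrite -!expRD.
  by congr expR; field.
rewrite ge0_integralZl //.
- by rewrite integral_normal_pdf mule1.
- by apply/measurable_EFinP; exact: measurable_normal_pdf.
- by move=> x _; rewrite lee_fin normal_pdf_ge0.
Qed.

Lemma expR_integrable t : N01.-integrable setT (EFin \o (fun x : R => expR (t * x))).
Proof.
apply/integrableP; split.
  by apply/measurable_EFinP; exact: measurable_expR_linear.
under eq_integral do rewrite /= ger0_norm ?expR_ge0 //.
by rewrite normal_mgf ltry.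
Qed.

Lemma cosh_integrable t : N01.-integrable setT (EFin \o (fun x : R => cosh (t * x))).
Proof.
have i := integrableZl measurableT (2^-1)
  (integrableD measurableT (expR_integrable t) (expR_integrable (- t))).
apply: eq_integrable i => // x _.
by rewrite /= -EFinD -EFinM /cosh mulNr mulrC.
Qed.

Lemma normal_cosh t : \int[N01]_x cosh (t * x) = expR (t ^+ 2 / 2).
Proof.
transitivity (\int[N01]_x (2^-1 * expR (t * x) + 2^-1 * expR (- t * x))).
  by apply: eq_Rintegral => x _; rewrite /cosh mulNr -mulrDr mulrC.
rewrite (RintegralD measurableT (integrableZl measurableT (2^-1) (expR_integrable t))
  (integrableZl measurableT (2^-1) (expR_integrable (- t)))).
rewrite !(RintegralZl _ measurableT (expR_integrable _)).
by rewrite /Rintegral !normal_mgf /= sqrrN; lra.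
Qed.

Lemma quartic_cosh_le t x : `|t| <= 1 ->
  (t * x) ^+ 4 * cosh (t * x) <= 48 * t ^+ 4 * cosh (2 * x).
Proof.
move=> t1.
have -> : (t * x) ^+ 4 * cosh (t * x) = t ^+ 4 * (x ^+ 4 * cosh (t * x)) by ring.
have -> : 48 * t ^+ 4 * cosh (2 * x) = t ^+ 4 * (48 * cosh (2 * x)) by ring.
apply: ler_wpM2l; first exact: exprn_even_ge0.
have eN y : expR `|y| <= expR y + expR (- y) :> R.
  have := expR_gt0 y; have := expR_gt0 (- y).
  by have [y0|y0] := leP 0 y; [rewrite ger0_norm|rewrite ltr0_norm] => // *; lra.
have h1 : x ^+ 4 <= 24 * expR `|x|.
  rewrite -(@ger0_norm _ (x ^+ 4)) ?exprn_even_ge0 // normrX.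
  have := expR_ge1Dxn 3 (normr_ge0 x); rewrite (_ : 4`! = 24)%N //.
  by move=> h; rewrite -ler_pdivrMl // mulrC; apply: le_trans h; rewrite lerDr.
have h2 : cosh (t * x) <= expR `|x|.
  have tx : `|t * x| <= `|x| by rewrite normrM ler_piMl.
  have := ler_norm (t * x); have := ler_norm (- (t * x)); rewrite normrN => a b.
  have : expR (t * x) <= expR `|x| by rewrite ler_expR (le_trans b).
  have : expR (- (t * x)) <= expR `|x| by rewrite ler_expR (le_trans a).
  by rewrite /cosh; lra.
apply: (@le_trans _ _ (24 * expR `|x| * expR `|x|)).
  apply: ler_pM => //; [exact: exprn_even_ge0|exact/ltW/cosh_gt0].
rewrite -mulrA -expRD (_ : `|x| + `|x| = 2 * `|x|); last by ring.
have := eN (2 * x); rewrite normrM (@ger0_norm _ 2) // /cosh; lra.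
Qed.

Lemma normal_cos_approx t : `|t| <= 1 ->
  `|normal_cos t - (2 - expR (t ^+ 2 / 2))| <= 96 * expR 2 * t ^+ 4.
Proof.
move=> t1.
have ic : N01.-integrable setT (EFin \o (fun x : R => cos (t * x))).
  exact: (@bounded_integrable_prob _ _ N01 _ 1 (measurable_cos_linear t) (fun y => cos_max _)).
have i2 : N01.-integrable setT (EFin \o (fun _ : R => 2 : R)).
  by apply: (@bounded_integrable_prob _ _ N01 (fun=> 2) 2) => // x; rewrite ger0_norm.
have iB : N01.-integrable setT (EFin \o (fun x : R => cosh (t * x) - 2)).
  have := integrableB measurableT (cosh_integrable t) i2.
  by apply: eq_integrable.
have iA : N01.-integrable setT (EFin \o (fun x : R => cos (t * x) + (cosh (t * x) - 2))).
  have := integrableD measurableT ic iB.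
  by apply: eq_integrable.
have -> : normal_cos t - (2 - expR (t ^+ 2 / 2)) =
    \int[N01]_x (cos (t * x) + (cosh (t * x) - 2)).
  rewrite (RintegralD measurableT ic iB) (RintegralB measurableT (cosh_integrable t) i2).
  rewrite normal_cosh normal_cst.
  by rewrite /normal_cos opprB.
rewrite (le_trans (le_normr_Rintegral measurableT iA)) //.
have iC := integrableZl measurableT (96 * t ^+ 4) (cosh_integrable 2).
rewrite (@le_trans _ _ (\int[N01]_x (96 * t ^+ 4 * cosh (2 * x)))) //.
  apply: (le_Rintegral measurableT _ iC).
    exact: integrable_norm.
  move=> x _ /=; rewrite addrA (le_trans (cos_cosh_taylor _)) //.
  by have := quartic_cosh_le x t1; lra.
rewrite (RintegralZl _ measurableT (cosh_integrable 2)) normal_cosh.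
by rewrite expr2 mulfK // mulrAC.
Qed.

Lemma normal_cos_le1 t : `|normal_cos t| <= 1.
Proof.
have ic : N01.-integrable setT (EFin \o (fun x : R => cos (t * x))).
  exact: (@bounded_integrable_prob _ _ N01 _ 1 (measurable_cos_linear t) (fun y => cos_max _)).
have i1 : N01.-integrable setT (EFin \o (fun _ : R => 1 : R)).
  by apply: (@bounded_integrable_prob _ _ N01 (fun=> 1) 1) => // x; rewrite normr1.
rewrite (le_trans (le_normr_Rintegral measurableT ic)) //.
rewrite (@le_trans _ _ (\int[N01]_x (1 : R))) //.
  apply: (le_Rintegral measurableT _ i1); first exact: integrable_norm.
  by move=> x _; exact: cos_max.
by rewrite normal_cst.
Qed.

Lemma normB_exprn_le (x y : R) k : `|x| <= 1 -> `|y| <= 1 ->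
  `|x ^+ k - y ^+ k| <= k%:R * `|x - y|.
Proof.
move=> x1 y1; elim: k => [|k ih]; first by rewrite !expr0 subrr normr0 mul0r.
have -> : x ^+ k.+1 - y ^+ k.+1 = x * (x ^+ k - y ^+ k) + (x - y) * y ^+ k.
  by rewrite !exprS; ring.
rewrite (le_trans (ler_normD _ _)) //.
rewrite (_ : k.+1%:R * `|x - y| = k%:R * `|x - y| + `|x - y|); last by rewrite -natr1; ring.
rewrite lerD // normrM.
  by rewrite (le_trans _ ih) // ler_piMl.
by rewrite ler_piMr // normrX exprn_ile1.
Qed.

(** Since the normal law is 2-stable, its characteristic function at [t] is
    the [2 ^ n]-th power of its value at [t / 2 ^ (n / 2)], which is known up to
    an error of order [t ^ 4 / 4 ^ n] from the moment generating function. *)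
Lemma normal_cosE t : normal_cos t = expR (- (t ^+ 2 / 2)).
Proof.
pose q : R := Num.sqrt 2.
have q0 : 0 < q by rewrite sqrtr_gt0.
have q2 : q ^+ 2 = 2 by rewrite sqr_sqrtr.
pose u n : R := t / q ^+ n.
have uE n : normal_cos t = normal_cos (u n) ^+ (2 ^ n).
  elim: n => [|n ih]; first by rewrite /u expr0 divr1 expr1.
  rewrite ih expnS mulnC exprM -exprAC; congr (_ ^+ _).
  rewrite -normal_cos_sqrt2 -/q; congr normal_cos; rewrite /u exprS.
  by field; rewrite ?expf_neq0 // gt_eqF.
have u2 n : u n ^+ 2 = t ^+ 2 / 2 ^+ n by rewrite /u exprMn exprVn -exprAC q2.
pose K : R := 96 * expR 2 + 1.
have K0 : 0 < K by rewrite addr_gt0 // mulr_gt0 // expR_gt0.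
have small n : t ^+ 2 <= 2 ^+ n ->
    `|normal_cos t - expR (- (t ^+ 2 / 2))| <= K * t ^+ 4 / 2 ^+ n.
  move=> tn; have p0 : 0 < 2 ^+ n :> R by rewrite exprn_gt0.
  have v1 : u n ^+ 2 <= 1 by rewrite u2 ler_pdivrMr // mul1r.
  have v0 : 0 <= u n ^+ 2 by rewrite sqr_ge0.
  have -> : expR (- (t ^+ 2 / 2)) = expR (- (u n ^+ 2 / 2)) ^+ (2 ^ n).
    rewrite -expRM_natl natrX u2; congr expR; field.
    by rewrite gt_eqF.
  rewrite (uE n) (le_trans (normB_exprn_le _ (normal_cos_le1 _) _)) //.
    by rewrite ger0_norm ?expR_ge0 // -expR0 ler_expR oppr_le0 divr_ge0.
  have u1 : `|u n| <= 1 by rewrite -(ler_sqr) ?nnegrE // expr1n real_normK ?num_real.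
  have e1 := normal_cos_approx u1.
  have e2 : `|2 - expR (u n ^+ 2 / 2) - expR (- (u n ^+ 2 / 2))| <= u n ^+ 4.
    set v := u n ^+ 2 / 2.
    have vh : `|v| <= 1 / 2 by rewrite ger0_norm /v; lra.
    have vh' : `|- v| <= 1 / 2 by rewrite normrN.
    have := expR_le_quadratic vh; have := expR_le_quadratic vh'.
    have := expR_ge1Dx v; have := expR_ge1Dx (- v).
    have -> : u n ^+ 4 = 4 * v ^+ 2 by rewrite /v; field.
    rewrite sqrrN; have := sqr_ge0 v => *; rewrite ler_norml; apply/andP; split; lra.
  have e3 : `|normal_cos (u n) - expR (- (u n ^+ 2 / 2))| <= K * u n ^+ 4.
    have -> : normal_cos (u n) - expR (- (u n ^+ 2 / 2)) =
      (normal_cos (u n) - (2 - expR (u n ^+ 2 / 2))) +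
      (2 - expR (u n ^+ 2 / 2) - expR (- (u n ^+ 2 / 2))) by ring.
    by rewrite (le_trans (ler_normD _ _)) // /K mulrDl mul1r lerD.
  apply: (@le_trans _ _ (2 ^+ n * (K * u n ^+ 4))).
    by rewrite natrX ler_wpM2l // ltW.
  rewrite (exprM _ 2 2) u2 (_ : _ * _ = K * t ^+ 4 / 2 ^+ n) //.
  by field; rewrite gt_eqF.
apply/eqP; rewrite -subr_eq0 -normr_le0; apply/ler_addgt0Pl => e e0; rewrite addr0.
pose M := Num.max (t ^+ 2) (K * t ^+ 4 / e).
have [n hn] : exists n, M <= 2 ^+ n.
  exists (Num.truncn M).+1; rewrite (le_trans (ltW (truncnS_gt M))) //.
  by rewrite -natrX ler_nat ltnW // ltn_expl.
have p0 : 0 < 2 ^+ n :> R by rewrite exprn_gt0.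
apply: (le_trans (small n _)).
  by rewrite (le_trans _ hn) // le_max lexx.
rewrite ler_pdivrMr // [leRHS]mulrC -ler_pdivrMr // (le_trans _ hn) //.
by rewrite le_max lexx orbT.
Qed.

End NormalChar.

Section Multinormal.
Context {R : realType} {r : nat}.
Implicit Types (l a : 'rV[R]_r) (S : 'M[R]_r) (v c : R).
Local Notation N01 := (normal_prob (0 : R) 1).

Definition shift_along l (gx : measurableTypeR R * r.-tuple R) : r.-tuple R :=
  [tuple tnth gx.2 i + gx.1 * l 0 i | i < r].

Lemma measurable_shift_along l : measurable_fun setT (shift_along l).
Proof.
apply/measurable_fun_tnthP => i.
rewrite (_ : _ \o _ = (fun gx : measurableTypeR R * r.-tuple R =>
    tnth gx.2 i + gx.1 * l 0 i)); last by apply/funext => gx; rewrite /= tnth_mktuple.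
apply: measurable_funD; last exact: measurable_funM.
by apply: (@measurableT_comp _ _ _ _ _ _ (fun x : r.-tuple R => tnth x i)) => //; exact: measurable_tnth.
Qed.

HB.instance Definition _ l := isMeasurableFun.Build _ _ _ _ (shift_along l)
  (measurable_shift_along l).

Lemma dot_shift_along a l gx :
  dot a (vec (shift_along l gx)) = dot a (vec gx.2) + gx.1 * dot a l.
Proof.
rewrite !dotE mulr_sumr -big_split; apply: eq_bigr => i _ /=.
by rewrite !mxE tnth_mktuple; ring.
Qed.

(** Adding an independent centered normal variable of standard deviation [|c|]
    to a centered normal variable of variance [v]. *)
Lemma centered_normal_mix v c (A : set R) : 0 <= v -> measurable A ->
  (\int[N01]_x centered_normal v [set y : R | A (y + x * c)%R] =
   centered_normal (v + c ^+ 2)%R A)%E.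
Proof.
move=> v0 mA; rewrite /centered_normal.
have [->|vN0] := eqVneq v 0; last first.
  have vp : 0 < v by rewrite lt_neqAle eq_sym vN0.
  rewrite gt_eqF ?ltr_wpDr ?sqr_ge0 //.
  have sp : 0 < Num.sqrt v by rewrite sqrtr_gt0.
  have e : v + c ^+ 2 = c ^+ 2 + Num.sqrt v ^+ 2 by rewrite sqr_sqrtr // addrC.
  rewrite e; apply: etrans (normal_prob_mix c sp mA).
  apply: eq_integral => x _.
  have := @normal_prob_affine R 1 (x * c) 0 (Num.sqrt v) A (oner_neq0 _) (lt0r_neq0 sp) mA.
  rewrite mulr0 add0r normr1 mul1r [c * x]mulrC => <-; congr (normal_prob _ _ _).
  by apply/seteqP; split=> y; rewrite /affine /= mul1r.
rewrite add0r sqrf_eq0; have [->|c0] := eqVneq c 0.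
  under eq_integral do rewrite mulr0.
  rewrite (_ : [set y | A (y + 0)] = A); last by apply/seteqP; split=> y /=; rewrite addr0.
  rewrite integral_cst // [X in (_ * X)%E](_ : _ = 1%E) ?mule1 //; exact: probability_setT.
rewrite sqrtr_sqr.
have := @normal_prob_affine R c 0 0 1 A c0 (oner_neq0 _) mA.
rewrite mulr0 addr0 mulr1 => <-.
have mA' : measurable (affine c 0 @^-1` A).
  by rewrite -[X in measurable X]setTI; exact: measurable_affine.
transitivity (\int[N01]_x (\1_(affine c 0 @^-1` A) x)%:E)%E.
  apply: eq_integral => x _; rewrite diracE indicE; congr ((_ _)%:R%:E).
  by apply/idP/idP; rewrite !inE /affine /= addr0 add0r mulrC.
by rewrite integral_indic // setIT.
Qed.

Definition outer l : 'M[R]_r := l^T *m l.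

Lemma quad_outer a l : quad (outer l) a = dot a l ^+ 2.
Proof.
have e : l *m a^T = (a *m l^T)^T by rewrite trmx_mul trmxK.
by rewrite /quad /outer mulmxA -mulmxA e mxE big_ord_recl big_ord0 addr0 expr2 /dot [X in _ * X]mxE.
Qed.

Lemma quadD S S' a : quad (S + S') a = quad S a + quad S' a.
Proof. by rewrite /quad mulmxDr mulmxDl mxE. Qed.

Lemma multinormal_add S (mu : probability (r.-tuple R) R) l :
  is_multinormal S mu ->
  is_multinormal (S + outer l) (distribution (prod_prob N01 mu) (shift_along l)).
Proof.
case=> Ssym Spos Slaw; split.
- by rewrite linearD /= Ssym /outer trmx_mul trmxK.
- by move=> a; rewrite -/(quad _ a) quadD addr_ge0 ?Spos // quad_outer sqr_ge0.
move=> a A mA; rewrite -/(quad _ a) quadD quad_outer -centered_normal_mix ?Spos //.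
apply: eq_integral => x _ /=.
have mA' : measurable [set y : R | A (y + x * dot a l)].
  rewrite (_ : [set y | _] = affine 1 (x * dot a l) @^-1` A); last first.
    by apply/seteqP; split=> y; rewrite /affine /= mul1r.
  by rewrite -[X in measurable X]setTI; exact: measurable_affine.
rewrite -Slaw //; congr (mu _); apply/seteqP.
split=> y; rewrite /xsection /= inE.
  change (A (dot a (vec (shift_along l (x, y)))) -> A (dot a (vec y) + x * dot a l)).
  by rewrite dot_shift_along.
change (A (dot a (vec y) + x * dot a l) -> A (dot a (vec (shift_along l (x, y))))).
by rewrite dot_shift_along.
Qed.

Lemma multinormal0 : is_multinormal (0 : 'M[R]_r)
  (dirac [tuple (0 : R) | i < r] : probability (r.-tuple R) R).
Proof.
have z a : (a *m (0 : 'M[R]_r) *m a^T) 0 0 = 0 by rewrite mulmx0 mul0mx mxE.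
split=> [|a|a A mA]; [by rewrite trmx0|by rewrite z|].
rewrite z /centered_normal eqxx /= !diracE; congr ((_ _)%:R%:E).
have e x : vec x = 0 -> A ((a *m (vec x)^T) 0 0) = A 0.
  by move=> ->; rewrite trmx0 mulmx0 mxE.
apply/idP/idP; rewrite !inE /= e //.
all: by apply/rowP => i; rewrite !mxE tnth_mktuple.
Qed.

Lemma dotC a l : dot a l = dot l a.
Proof. by rewrite !dotE; apply: eq_bigr => i _; rewrite mulrC. Qed.

Lemma dot_mulmx_sym S a l : S^T = S -> dot (a *m S) l = dot (l *m S) a.
Proof. by move=> Ssym; rewrite dotC /dot trmx_mul Ssym mulmxA. Qed.

Lemma dot_mulmx_delta S (i j : 'I_r) :
  dot (delta_mx 0 i *m S) (delta_mx 0 j) = S i j.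
Proof. by rewrite dotC dot_delta -rowE mxE. Qed.

Lemma psd_row0 S i : S^T = S -> (forall a, 0 <= quad S a) -> S i i = 0 ->
  forall j, S i j = 0.
Proof.
move=> Ssym Spos Sii j.
have key t : 0 <= t * (S i j *+ 2) + S j j.
  have := Spos (t *: delta_mx 0 i + delta_mx 0 j); rewrite /quad -/(dot _ _).
  have Sji : S j i = S i j by rewrite -{1}Ssym mxE.
  rewrite mulmxDl -scalemxAl !dotDr !dotDl !dotZr !dotZl !dot_mulmx_delta.
  by rewrite Sii Sji; lra.
apply/eqP/negP => /negP Sij.
have := key (- (S j j + 1) / (S i j *+ 2)).
by rewrite divfK ?mulrn_eq0 //; lra.
Qed.

(** Every positive semidefinite [S] is the covariance of a Gaussian law: one
    pivot at a time, [S] is a sum of outer products, each of which is added by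
    an independent normal variable. *)
Lemma multinormal_exists S : S^T = S -> (forall a, 0 <= quad S a) ->
  exists mu : probability (r.-tuple R) R, is_multinormal S mu.
Proof.
suff H : forall k S, S^T = S -> (forall a, 0 <= quad S a) ->
    (forall i : 'I_r, (k <= i)%N -> forall j, S i j = 0) ->
    exists mu : probability (r.-tuple R) R, is_multinormal S mu.
  by move=> Ssym Spos; apply: (H r) => // i; rewrite leqNgt ltn_ord.
move=> {S}; elim=> [|k ih] S Ssym Spos Sk.
  exists (dirac [tuple (0 : R) | i < r]).
  rewrite (_ : S = 0); first exact: multinormal0.
  by apply/matrixP => i j; rewrite Sk // mxE.
have [rk|kr] := leqP r k.
  by apply: (ih S) => // i ki; have := leq_trans rk ki; rewrite leqNgt ltn_ord.
pose i := Ordinal kr.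
have ik (i' : 'I_r) : (k <= i')%N -> i' = i \/ (k < i')%N.
  by rewrite leq_eqVlt => /predU1P[e|]; [left; exact/val_inj|right].
have [Sii|Sii] := eqVneq (S i i) 0.
  by apply: (ih S) => // i' /ik[->|]; [exact: psd_row0|exact: Sk].
have Sji j : S j i = S i j by rewrite -{1}Ssym mxE.
have Sip : 0 < S i i.
  rewrite lt_neqAle eq_sym Sii -(dot_mulmx_delta S); exact: Spos.
have sq : Num.sqrt (S i i) ^+ 2 = S i i by rewrite sqr_sqrtr // ltW.
have sN : Num.sqrt (S i i) != 0 by rewrite gt_eqF // sqrtr_gt0.
pose l : 'rV[R]_r := (Num.sqrt (S i i))^-1 *: (delta_mx 0 i *m S).
have lE j : l 0 j = S i j / Num.sqrt (S i i) by rewrite mxE -rowE mxE mulrC.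
have oE x y : outer l x y = S i x * S i y / S i i.
  by rewrite /outer mxE big_ord_recl big_ord0 addr0 mxE !lE -[in RHS]sq; field.
pose S' := S - outer l.
have S'sym : S'^T = S' by rewrite /S' linearB /= Ssym /outer trmx_mul trmxK.
have S'pos a : 0 <= quad S' a.
  pose t := dot (a *m S) (delta_mx 0 i).
  have t' : dot (delta_mx 0 i *m S) a = t by rewrite dot_mulmx_sym.
  have e : quad S (a - (t / S i i) *: delta_mx 0 i) = quad S a - t ^+ 2 / S i i.
    rewrite -scaleNr {1}/quad -/(dot _ _) mulmxDl -scalemxAl !dotDr !dotDl !dotZr !dotZl.
    rewrite -/t t' dot_mulmx_delta -[dot (a *m S) a]/(quad S a).
    by field.
  have -> : quad S' a = quad S a - t ^+ 2 / S i i.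
    have : quad S a = quad S' a + quad (outer l) a by rewrite -quadD subrK.
    rewrite quad_outer => ->; rewrite /l dotZr [dot a _]dotC t' exprMn exprVn sq.
    by rewrite [_^-1 * _]mulrC addrK.
  by rewrite -e; exact: Spos.
have [|mu hmu] := ih S' S'sym S'pos.
  have S'E x y : S' x y = S x y - outer l x y by rewrite /S' mxE [X in _ + X]mxE.
  move=> i' /ik[->|ki'] j; rewrite S'E oE.
    by rewrite mulrAC divff // mul1r subrr.
  have h0 : S i' j = 0 by exact: Sk.
  have h1 : S i i' = 0 by rewrite -Sji Sk.
  by rewrite h0 h1 !mul0r subrr.
exists (distribution (prod_prob N01 mu) (shift_along l)).
by rewrite -[S](subrK (outer l)); exact: multinormal_add.
Qed.

Lemma multinormal_char S (mu : probability (r.-tuple R) R) a c :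
  is_multinormal S mu ->
  \int[mu]_x cos (dot a (vec x) + c) = expR (- (quad S a / 2)) * cos c.
Proof.
case=> _ Spos Slaw.
pose q := quad S a.
have q0 : 0 <= q by exact: Spos.
have mdot : measurable_fun setT (fun x : r.-tuple R => dot a (vec x)).
  exact: measurable_dot_vec.
have mcc : measurable_fun setT (fun y : R => cos (y + c)).
  have := @measurable_cos_affine R 1 c.
  by under eq_fun do rewrite mul1r.
have law A : measurable A -> mu [set x | A (dot a (vec x))] = centered_normal q A.
  by move=> mA; exact: Slaw.
move: law; rewrite /centered_normal -/q; have [qz|qn] := eqVneq q 0 => law.
  rewrite qz mul0r oppr0 expR0 mul1r.
  have := @Rintegral_image R _ _ _ _ mu (fun x : r.-tuple R => dot a (vec x))
    (dirac (0 : R)) (fun y => cos (y + c)) 1 mdot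
    (fun A mA => esym (law A mA)) mcc (fun x => cos_max _).
  move=> <-; rewrite /Rintegral integral_dirac //.
    by rewrite diracT mul1e /= add0r.
  exact/measurable_EFinP.
have qp : 0 < q by rewrite lt_neqAle eq_sym qn.
have sN : Num.sqrt q != 0 by rewrite gt_eqF // sqrtr_gt0.
have := @Rintegral_image R _ _ _ (measurableTypeR R) mu (fun x : r.-tuple R => dot a (vec x))
  (normal_prob 0 (Num.sqrt q)) (fun y => cos (y + c)) 1 mdot
  (fun A mA => esym (law A mA)) mcc (fun x => cos_max _).
move=> <-.
have := @normal_scale R (Num.sqrt q) (fun y => cos (y + c)) 1 sN mcc (fun x => cos_max _).
have -> : `|Num.sqrt q| = Num.sqrt q by rewrite ger0_norm // sqrtr_ge0.
by move=> ->; rewrite Rintegral_cos_phase normal_cosE sqr_sqrtr.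
Qed.

End Multinormal.

(** * A Lyapunov equation *)

Section Lyapunov.
Context {R : realType} {r : nat}.
Implicit Types (a : 'rV[R]_r) (X A M Q S : 'M[R]_r).

Definition l1 X : R := \sum_i \sum_j `|X i j|.

Lemma l1_ge0 X : 0 <= l1 X.
Proof. by rewrite sumr_ge0 // => i _; rewrite sumr_ge0. Qed.

Lemma l1_eq0 X : l1 X = 0 -> X = 0.
Proof.
move=> X0; apply/matrixP => i j; rewrite mxE; apply/eqP; rewrite -normr_eq0; apply/eqP.
have h0 i' : 0 <= \sum_j `|X i' j| by rewrite sumr_ge0.
have /psumr_eq0P h := X0; have /psumr_eq0P h' := h (fun i _ => h0 i) i isT.
by rewrite (h' (fun _ _ => normr_ge0 _) j isT).
Qed.

Lemma l1T X : l1 X^T = l1 X.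
Proof.
rewrite /l1 exchange_big; apply: eq_bigr => i _; apply: eq_bigr => j _.
by rewrite mxE.
Qed.

Lemma l1D X Y : l1 (X + Y) <= l1 X + l1 Y.
Proof.
rewrite /l1 -big_split; apply: ler_sum => i _; rewrite -big_split.
by apply: ler_sum => j _; rewrite mxE ler_normD.
Qed.

Lemma l1Z c X : l1 (c *: X) = `|c| * l1 X.
Proof.
rewrite /l1 mulr_sumr; apply: eq_bigr => i _; rewrite mulr_sumr.
by apply: eq_bigr => j _; rewrite mxE normrM.
Qed.

Lemma l1_mul M X c : 0 <= c -> (forall j, \sum_i `|M i j| <= c) ->
  l1 (M *m X) <= c * l1 X.
Proof.
move=> c0 hM; apply: (@le_trans _ _ (\sum_i \sum_j \sum_k `|M i k| * `|X k j|)).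
  apply: ler_sum => i _; apply: ler_sum => j _; rewrite mxE.
  by rewrite (le_trans (ler_norm_sum _ _ _)) //; apply: ler_sum => k _; rewrite normrM.
rewrite exchange_big /= /l1 [X in _ <= c * X]exchange_big /= mulr_sumr.
apply: ler_sum => j _; rewrite exchange_big /= mulr_sumr; apply: ler_sum => k _.
by rewrite -mulr_suml ler_wpM2r.
Qed.

Lemma l1_conj M X : (forall j, \sum_i `|M i j| <= 1) ->
  l1 (M *m X *m M^T) <= l1 X.
Proof.
move=> hM; rewrite -l1T trmx_mul trmxK.
rewrite (le_trans (l1_mul _ ler01 hM)) // mul1r l1T.
by rewrite (le_trans (l1_mul _ ler01 hM)) // mul1r.
Qed.

Lemma quad_l1 X a b : (forall i, `|a 0 i| <= b) -> `|quad X a| <= b ^+ 2 * l1 X.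
Proof.
move=> ab; rewrite /quad -/(dot _ _) dotE.
have -> : \sum_i (a *m X) 0 i * a 0 i = \sum_i \sum_j a 0 j * X j i * a 0 i.
  by apply: eq_bigr => i _; rewrite mxE mulr_suml.
rewrite exchange_big /= (le_trans (ler_norm_sum _ _ _)) // /l1 mulr_sumr.
apply: ler_sum => j _; rewrite (le_trans (ler_norm_sum _ _ _)) // mulr_sumr.
apply: ler_sum => i _; rewrite !normrM mulrAC expr2 ler_wpM2r //.
by apply: ler_pM.
Qed.

Definition lyap A (lam : R) X : 'M[R]_r := X + lam^-1 *: (A *m X + X *m A^T).

Lemma lyap_is_linear A lam : linear (lyap A lam).
Proof.
move=> c X Y; rewrite /lyap.
have -> : A *m (c *: X + Y) + (c *: X + Y) *m A^T =
    c *: (A *m X + X *m A^T) + (A *m Y + Y *m A^T).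
  by rewrite mulmxDr mulmxDl -scalemxAr -scalemxAl scalerDr addrACA.
by rewrite scalerDr scalerA [lam^-1 * c]mulrC -scalerA [c *: (X + _)]scalerDr addrACA.
Qed.

HB.instance Definition _ A lam :=
  GRing.isLinear.Build R 'M[R]_r 'M[R]_r _ (lyap A lam) (lyap_is_linear A lam).

Variables (A : 'M[R]_r) (lam : R).
Hypothesis lam_gt0 : 0 < lam.
Hypothesis A_off : forall i j, i != j -> A i j <= 0.
Hypothesis A_diag : forall j, 0 <= A j j.
Hypothesis A_col : forall j, 0 <= \sum_i A i j.

Lemma contraction_col t j : 0 <= t -> t * A j j <= 1 ->
  \sum_i `|(1%:M - t *: A) i j| <= 1.
Proof.
move=> t0 tA; rewrite (bigD1 j) //= !mxE eqxx ger0_norm ?subr_ge0 //.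
rewrite (eq_bigr (fun i => - (t * A i j))); last first.
  move=> i ij; rewrite !mxE (negbTE ij) sub0r normrN ler0_norm //.
  by rewrite mulr_ge0_le0 // A_off.
have := A_col j; rewrite (bigD1 j) //= => /(ler_wpM2l t0).
rewrite mulr0 mulrDr sumrN -mulr_sumr; lra.
Qed.

(** The congruences by [1 - t A] contract the norm [l1], while on the kernel of
    the Lyapunov operator they would expand it to first order in [t]. *)
Lemma lyap_inj X : lyap A lam X = 0 -> X = 0.
Proof.
move=> X0; apply: l1_eq0; apply/eqP; rewrite eq_le l1_ge0 andbT.
have AX : A *m X + X *m A^T = (- lam) *: X.
  have := congr1 (fun Y => lam *: Y) X0; rewrite /lyap scaler0 scalerDr scalerA.
  rewrite divff ?gt_eqF // scale1r => /eqP; rewrite addrC addr_eq0 => /eqP ->.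
  by rewrite scaleNr.
pose c := l1 (A *m X *m A^T).
have c0 : 0 <= c := l1_ge0 _.
pose s := \sum_j A j j.
have s0 : 0 <= s by rewrite sumr_ge0.
have sA j : A j j <= s by rewrite /s (bigD1 j) //= lerDl sumr_ge0.
have key t : 0 <= t -> t * s <= 1 -> t * (lam * l1 X) <= t * (t * c).
  move=> t0 ts.
  have hM j : \sum_i `|(1%:M - t *: A) i j| <= 1.
    by apply: contraction_col => //; apply: le_trans ts; rewrite ler_wpM2l.
  have e : (1%:M - t *: A) *m X *m (1%:M - t *: A)^T =
      (1 + t * lam) *: X + (t ^+ 2) *: (A *m X *m A^T).
    have -> : (1%:M - t *: A)^T = 1%:M - t *: A^T by rewrite linearB linearZ /= trmx1.
    have -> : (1%:M - t *: A) *m X = X - t *: (A *m X).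
      by rewrite mulmxBl mul1mx -scalemxAl.
    rewrite mulmxBr mulmx1 -scalemxAr mulmxBl -scalemxAl scalerBr scalerA -expr2.
    have lX : lam *: X = - (A *m X + X *m A^T) by rewrite AX scaleNr opprK.
    rewrite scalerDl scale1r -scalerA lX scalerN scalerDr.
    by rewrite !opprD opprK !addrA.
  have := l1_conj X hM; rewrite e.
  have := l1D ((1 + t * lam) *: X + t ^+ 2 *: (A *m X *m A^T)) (- (t ^+ 2) *: (A *m X *m A^T)).
  rewrite scaleNr addrK -scaleNr !l1Z normrN !ger0_norm ?exprn_ge0 ?addr_ge0 ?mulr_ge0 ?(ltW lam_gt0) //.
  by rewrite -/c; lra.
have keyl t : 0 < t -> t * s <= 1 -> lam * l1 X <= t * c.
  by move=> t0 ts; rewrite -(ler_pM2l t0) key // ltW.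
rewrite -(ler_pM2l lam_gt0) mulr0; apply/ler_addgt0Pr => e e0; rewrite add0r.
pose t := Num.min (s + 1)^-1 (e / (c + 1)).
have t0 : 0 < t by rewrite lt_min invr_gt0 divr_gt0 ?andbT //; lra.
apply: (le_trans (keyl t t0 _)).
  apply: (@le_trans _ _ ((s + 1)^-1 * s)); first by rewrite ler_wpM2r // ge_min lexx.
  by rewrite mulrC ler_pdivrMr; lra.
apply: (@le_trans _ _ (e / (c + 1) * c)); first by rewrite ler_wpM2r // ge_min lexx orbT.
by rewrite mulrAC ler_pdivrMr; nra.
Qed.

Lemma lyap_surj Q : exists S, lyap A lam S = Q.
Proof.
pose F := lin_mx (lyap A lam).
have F_free : row_free F.
  apply: inj_row_free => v.
  rewrite -[v]vec_mxK mul_vec_lin => /(congr1 vec_mx); rewrite mxvecK linear0.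
  by move=> /lyap_inj ->; rewrite linear0.
exists (vec_mx (mxvec Q *m invmx F)).
apply: (can_inj mxvecK); rewrite -mul_vec_lin vec_mxK.
by rewrite mulmxKV // -row_free_unit.
Qed.

End Lyapunov.

(** * Central limit theorem for a process with linear drift *)

Section CosCompare.
Context {R : realType}.
Implicit Types (s m y v E : R).

Lemma expRN_le1 v : 0 <= v -> expR (- v) <= 1.
Proof. by move=> v0; rewrite -expR0 ler_expR oppr_le0. Qed.

(** [E] stands for the mean of [cos (s + X)], where [X] has mean close to [- y]
    and second moment close to [v]. *)
Lemma cos_compare s m1 m2 y v E e1 e2 e3 :
  `|E - (cos s - m1 * sin s - m2 / 2 * cos s)| <= e1 -> `|m1 + y| <= e2 ->
  `|m2 - v| <= e3 -> `|y| <= 1 -> 0 <= v ->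
  `|E - expR (- (v / 2)) * cos (s - y)| <= e1 + e2 + e3 + y ^+ 2 + v ^+ 2 + v * `|y|.
Proof.
move=> h1 h2 h3 y1 v0; set e := expR (- (v / 2)).
have v20 : 0 <= v / 2 by rewrite divr_ge0.
have /andP[ea eb] := expRN_bounds v20.
have e0 : 0 <= e by exact: expR_ge0.
have e1' : e <= 1 by exact: expRN_le1.
have -> : E - e * cos (s - y) = (E - (cos s - m1 * sin s - m2 / 2 * cos s)) +
  (- (m1 + y) * sin s + (- ((m2 - v) / 2) * cos s + (- e * (cos (s - y) - (cos s + y * sin s))
   + ((1 - v / 2 - e) * cos s + (1 - e) * y * sin s)))) by field.
have a2 : `|- (m1 + y) * sin s| <= e2.
  by rewrite normrM normrN (le_trans _ h2) // ler_piMr // sin_max.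
have a3 : `|- ((m2 - v) / 2) * cos s| <= e3.
  rewrite normrM normrN normrM (@ger0_norm _ 2^-1) ?invr_ge0 //.
  apply: (@le_trans _ _ (`|m2 - v| / 2)); first by rewrite ler_piMr ?cos_max // divr_ge0.
  by have := normr_ge0 (m2 - v); lra.
have a4 : `|- e * (cos (s - y) - (cos s + y * sin s))| <= y ^+ 2.
  rewrite normrM normrN (ger0_norm e0) (le_trans _ (cos_shift_taylor2 s y1)) //.
  by rewrite ler_piMl.
have a5 : `|(1 - v / 2 - e) * cos s| <= v ^+ 2.
  rewrite normrM (le_trans (ler_piMr _ (cos_max _))) // ler_norml.
  have v2 := sqr_ge0 v; rewrite -/e in ea eb.
  have q : (v / 2) ^+ 2 = v ^+ 2 / 4 by field.
  by rewrite q in eb; apply/andP; split; lra.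
have a6 : `|(1 - e) * y * sin s| <= v * `|y|.
  rewrite normrM (le_trans (ler_piMr _ (sin_max _))) // normrM ler_wpM2r //.
  by rewrite ger0_norm; rewrite -/e in ea; lra.
have -> : e1 + e2 + e3 + y ^+ 2 + v ^+ 2 + v * `|y| =
    e1 + (e2 + (e3 + (y ^+ 2 + (v ^+ 2 + v * `|y|)))) by ring.
by do 5 (apply: le_trans (ler_normD _ _) _; apply: lerD => //).
Qed.

Lemma expRN_lipschitz x y : 0 <= x -> 0 <= y -> `|expR (- x) - expR (- y)| <= `|x - y|.
Proof.
wlog xy : x y / x <= y => [hw x0 y0|x0 y0].
  have [/hw|/ltW /hw h] := leP x y; first exact.
  by rewrite distrC [`|x - y|]distrC h.
have h : expR (- y) = expR (- x) * expR (- (y - x)) by rewrite -expRD; congr expR; ring.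
have yx0 : 0 <= y - x by rewrite subr_ge0.
have /andP[a b] := expRN_bounds yx0.
have c : expR (- (y - x)) <= 1 by exact: expRN_le1.
rewrite h -[X in `|X - _|]mulr1 -mulrBr normrM ger0_norm ?expR_ge0 //.
rewrite ger0_norm ?subr_ge0 // distrC (ger0_norm yx0).
apply: (@le_trans _ _ (1 * (1 - expR (- (y - x))))).
  by rewrite ler_wpM2r ?subr_ge0 // expRN_le1.
by lra.
Qed.

Lemma invsqrt_root4 n : (0 < n)%N -> (Num.sqrt n%:R)^-1 = (root4 n : R) ^- 2.
Proof. by move=> n0; rewrite sqr_root4. Qed.

Lemma cvg_root4 (f : nat -> R) l C N : (forall n, (N <= n)%N ->
  `|f n - l| <= C / root4 n) -> f n @[n --> \oo] --> l.
Proof.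
move=> h; apply/cvgrPdist_le => e e0.
pose D := `|C| / e.
have D0 : 0 <= D by rewrite divr_ge0 // ltW.
near=> n.
have hn : (N <= n)%N by near: n; exact: nbhs_infty_ge.
have n1 : (1 <= n)%N by near: n; exact: nbhs_infty_ge.
have hD : D ^+ 4 <= n%:R by near: n; exact: nbhs_infty_ger.
have r1 := @root4_ge1 R n n1.
have r0 : 0 < root4 n :> R by lra.
rewrite distrC (le_trans (h n hn)) // (@le_trans _ _ (`|C| / root4 n)) //.
  by rewrite ler_wpM2r ?invr_ge0 ?(ltW r0) // ler_norm.
rewrite ler_pdivrMr // mulrC -ler_pdivrMr // -/D.
have e4 : root4 n ^+ 4 = n%:R :> R by rewrite (exprM _ 2 2) sqr_root4 sqr_sqrtr.
by rewrite -(@ler_pXn2r _ 4) ?nnegrE ?(ltW r0) // e4.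
Unshelve. all: by end_near. Qed.

Lemma quadZl (r : nat) (X : 'M[R]_r) (a : 'rV[R]_r) c :
  quad X (c *: a) = c ^+ 2 * quad X a.
Proof.
by rewrite /quad linearZ /= -!scalemxAl -scalemxAr scalerA mxE expr2.
Qed.

Lemma quadB (r : nat) (X Y : 'M[R]_r) (a : 'rV[R]_r) :
  quad (X - Y) a = quad X a - quad Y a.
Proof. by rewrite /quad mulmxBr mulmxBl !mxE. Qed.

Lemma quadZr (r : nat) (X : 'M[R]_r) (a : 'rV[R]_r) c :
  quad (c *: X) a = c * quad X a.
Proof. by rewrite /quad -scalemxAr -scalemxAl mxE. Qed.

Lemma le0_root4 (x C : R) N : (forall n, (N <= n)%N -> x <= C / root4 n) -> x <= 0.
Proof.
move=> h; have h0 : Num.max 0 x @[n --> \oo] --> (0 : R).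
  apply: (@cvg_root4 _ _ `|C| N) => n hn; rewrite subr0.
  have r0 : 0 <= root4 n :> R := root4_ge0 n.
  rewrite ger0_norm ?le_max ?lexx // ge_max divr_ge0 //= (le_trans (h n hn)) //.
  by rewrite ler_wpM2r ?invr_ge0 // ler_norm.
have e : Num.max 0 x = 0 :> R by apply: (cvg_unique _ _ h0) => //; exact: cvg_cst.
by rewrite -e le_max lexx orbT.
Qed.

End CosCompare.

Section LinearDrift.
Context {R : realType} {V : eqType} {r : nat}.
Implicit Types (a u : 'rV[R]_r) (G : V) (beta c t : R).
Variables (L : nat -> seq (R * V)) (U : nat -> V -> 'rV[R]_r).
Variables (J : nat -> V -> seq (R * 'rV[R]_r)) (A Q : 'M[R]_r).
Variables (lam w0 C0 : R).
Hypothesis lam_gt0 : 0 < lam.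
Hypothesis w0_gt0 : 0 < w0.
Hypothesis C0_ge0 : 0 <= C0.
Let W (n : nat) : R := n%:R * lam + w0.
Hypothesis lawL : forall n, is_law (L n).
Hypothesis lawJ : forall n x, x \in L n -> is_law (J n x.2).
Hypothesis L_step : forall n (h : 'rV[R]_r -> R),
  Ex (L n.+1) (fun G => h (U n.+1 G)) =
  Ex (L n) (fun G => Ex (J n G) (fun u => h (U n G + u))).
Hypothesis J_bounded : forall n x e i, x \in L n -> e \in J n x.2 ->
  `|e.2 0 i| <= C0.
Hypothesis J_mean : forall n x i, x \in L n ->
  `|Ex (J n x.2) (fun u => u 0 i) + (U n x.2 *m A^T) 0 i / W n| <= C0 / W n.
Definition usum n G : R := \sum_i `|U n G 0 i|.
Hypothesis J_square : forall n x i j, x \in L n ->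
  `|Ex (J n x.2) (fun u => u 0 i * u 0 j) - Q i j| <=
  C0 * (1 + usum n x.2) / W n.
Hypothesis Q_sym : Q^T = Q.
Hypothesis A_off : forall i j, i != j -> A i j <= 0.
Hypothesis A_diag : forall j, 0 <= A j j.
Hypothesis A_col : forall j, 0 <= \sum_i A i j.

Let K1 : R := r%:R * C0.
Let K1_ge0 : 0 <= K1. Proof. exact: mulr_ge0. Qed.
Let kappa : R := (Num.min lam w0)^-1.
Let kappa_gt0 : 0 < kappa. Proof. by rewrite invr_gt0 lt_min lam_gt0. Qed.
Let kappa_ge0 : 0 <= kappa := ltW kappa_gt0.

Let W_gt0 n : 0 < W n.
Proof. by rewrite ltr_wpDl // mulr_ge0 // ltW. Qed.

Let W_inv n : (W n)^-1 <= kappa / n.+1%:R.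
Proof.
have m0 : 0 < Num.min lam w0 by rewrite lt_min lam_gt0.
rewrite -invfM lef_pV2 ?posrE ?mulr_gt0 //.
rewrite /W -natr1 mulrDr mulr1 mulrC lerD //; last by rewrite ge_min lexx orbT.
by rewrite ler_wpM2l // ge_min lexx.
Qed.

Let bounded a beta := forall i, `|a 0 i| <= beta.

Let T n a : 'rV[R]_r := a *m (1%:M - (W n)^-1 *: A).

Let dot_T n a u : dot (T n a) u = dot a u - dot a (u *m A^T) / W n.
Proof.
rewrite /T mulmxBr mulmx1 -scalemxAr dotDl dotNl dotZl mulrC.
by rewrite /dot trmx_mul trmxK mulmxA.
Qed.

Let J0 : nat := (Num.truncn ((\sum_j A j j) / lam)).+1.

Let J0P n j : (J0 <= n)%N -> (W n)^-1 * A j j <= 1.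
Proof.
move=> hn; rewrite mulrC ler_pdivrMr // mul1r.
apply: (@le_trans _ _ (\sum_j A j j)); first by rewrite (bigD1 j) //= lerDl sumr_ge0.
rewrite /W ler_wpDr ?(ltW w0_gt0) // -ler_pdivrMr //.
rewrite (le_trans (ltW (truncnS_gt _))) // ler_nat //.
Qed.

Let T_bounded n a beta : (J0 <= n)%N -> bounded a beta -> bounded (T n a) beta.
Proof.
move=> hn ab j; have b0 : 0 <= beta := le_trans (normr_ge0 _) (ab j).
rewrite /T mxE (le_trans (ler_norm_sum _ _ _)) //.
apply: (@le_trans _ _ (\sum_i beta * `|(1%:M - (W n)^-1 *: A) i j|)).
  by apply: ler_sum => i _; rewrite normrM ler_wpM2r.
rewrite -mulr_sumr ler_piMr // contraction_col ?J0P //.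
by rewrite invr_ge0 ltW.
Qed.

Let sum_ord_const (x : R) : \sum_(i < r) x = r%:R * x.
Proof. by rewrite sumr_const card_ord mulr_natl. Qed.

Let dot_bounded a beta u c : bounded a beta -> (forall i, `|u 0 i| <= c) ->
  0 <= c -> `|dot a u| <= beta * (r%:R * c).
Proof.
move=> ab uc c0; rewrite dotE (le_trans (ler_norm_sum _ _ _)) //.
apply: (@le_trans _ _ (\sum_(i < r) beta * c)).
  by apply: ler_sum => i _; rewrite normrM ler_pM.
by rewrite sum_ord_const mulrCA.
Qed.

Let dot_step n x e a beta : x \in L n -> e \in J n x.2 -> bounded a beta ->
  `|dot a e.2| <= beta * K1.
Proof. by move=> xL eJ ab; apply: dot_bounded => // i; exact: J_bounded eJ. Qed.

Let drift n x a beta : x \in L n -> bounded a beta ->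
  `|Ex (J n x.2) (fun u => dot a u) + dot a (U n x.2 *m A^T) / W n| <=
  beta * K1 / W n.
Proof.
move=> xL ab.
have -> : Ex (J n x.2) (fun u => dot a u) = \sum_i a 0 i * Ex (J n x.2) (fun u => u 0 i).
  under [RHS]eq_bigr do rewrite -ExZ.
  by rewrite -Ex_sum; apply: eq_Ex => y _; rewrite dotE.
rewrite dotE mulr_suml -big_split /= (le_trans (ler_norm_sum _ _ _)) //.
apply: (@le_trans _ _ (\sum_(i < r) beta * (C0 / W n))).
  apply: ler_sum => i _; rewrite -mulrA -mulrDr normrM ler_pM //.
  exact: J_mean.
by rewrite sum_ord_const /K1 !mulrA [r%:R * _]mulrC.
Qed.

Let usum_ge0 n G : 0 <= usum n G.
Proof. by rewrite sumr_ge0. Qed.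

Let square n x a beta : x \in L n -> bounded a beta ->
  `|Ex (J n x.2) (fun u => dot a u ^+ 2) - quad Q a| <=
  beta ^+ 2 * (r%:R * K1 * (1 + usum n x.2) / W n).
Proof.
move=> xL ab.
have -> : Ex (J n x.2) (fun u => dot a u ^+ 2) =
    \sum_i \sum_j a 0 i * a 0 j * Ex (J n x.2) (fun u => u 0 i * u 0 j).
  under [RHS]eq_bigr do under eq_bigr do rewrite -ExZ.
  under [RHS]eq_bigr do rewrite -Ex_sum.
  rewrite -Ex_sum; apply: eq_Ex => y _; rewrite dotE expr2 mulr_suml.
  by apply: eq_bigr => i _; rewrite mulr_sumr; apply: eq_bigr => j _; ring.
have -> : quad Q a = \sum_i \sum_j a 0 i * a 0 j * Q i j.
  rewrite /quad -/(dot _ _) dotE exchange_big; apply: eq_bigr => i _ /=.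
  by rewrite mxE mulr_suml; apply: eq_bigr => j _; ring.
rewrite -sumrB (le_trans (ler_norm_sum _ _ _)) //.
rewrite (_ : _ * _ = \sum_(i < r) \sum_(j < r) beta ^+ 2 * (C0 * (1 + usum n x.2) / W n)); last first.
  by rewrite !sum_ord_const /K1; ring.
apply: ler_sum => i _; rewrite -sumrB (le_trans (ler_norm_sum _ _ _)) //.
apply: ler_sum => j _; rewrite -mulrBr normrM ler_pM //; last exact: J_square.
by rewrite normrM expr2 ler_pM.
Qed.

Let B0 : R := \sum_(x <- L J0) usum J0 x.2.

Let usum_B0 x : x \in L J0 -> usum J0 x.2 <= B0.
Proof.
by move=> xL; rewrite /B0 (big_rem _ xL) /= lerDl sumr_ge0.
Qed.

Let B0_ge0 : 0 <= B0. Proof. by rewrite sumr_ge0. Qed.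

Let dot_usum a beta n G : bounded a beta -> `|dot a (U n G)| <= beta * usum n G.
Proof.
move=> ab; rewrite dotE (le_trans (ler_norm_sum _ _ _)) // /usum mulr_sumr.
by apply: ler_sum => i _; rewrite normrM ler_wpM2r.
Qed.

Let harmS n : harm n.+1 = harm n + n.+1%:R^-1 :> R.
Proof. by rewrite /harm big_ord_recr. Qed.

(** Exponential moments: backwards in time, the coefficient [a] of the linear
    statistic evolves by contractions, so that each step only contributes the
    size of the error in the drift and that of the conditional variance. *)
Let exp_bound n a beta : (J0 <= n)%N -> 0 <= beta -> beta * K1 <= 1 / 2 -> bounded a beta ->
  Ex (L n) (fun G => expR (dot a (U n G))) <=
  expR (beta * B0 + beta * K1 * kappa * harm n + 2 * (beta * K1) ^+ 2 * n%:R).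
Proof.
move=> hn b0 bK; elim: n hn a => [|n ih] hn a ab.
  by move: hn; rewrite /J0.
have [e|hn'] : J0 = n.+1 \/ (J0 <= n)%N by move: hn; rewrite leq_eqVlt => /predU1P[|]; [left|right].
  rewrite -e; apply: Ex_le_cst => // x xL; rewrite ler_expR.
  rewrite (le_trans (ler_norm _)) // (le_trans (dot_usum _ _ ab)) // -addrA.
  rewrite (le_trans (ler_wpM2l b0 (usum_B0 xL))) // lerDl addr_ge0 //.
    by rewrite mulr_ge0 ?harm_ge0 // mulr_ge0 // mulr_ge0.
  by rewrite mulr_ge0 // mulr_ge0 // sqr_ge0.
rewrite (L_step n (fun u => expR (dot a u))).
pose q := beta * K1 * (kappa / n.+1%:R) + 2 * (beta * K1) ^+ 2.
apply: (@le_trans _ _ (Ex (L n) (fun G => expR q * expR (dot (T n a) (U n G))))).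
  apply: Ex_le => // x xL; rewrite -expRD.
  under eq_fun do rewrite dotDr expRD.
  rewrite ExZ dot_T [q + _]addrC -addrA expRD ler_wpM2l ?expR_ge0 //.
  apply: (@le_trans _ _ (1 + (Ex (J n x.2) (fun u => dot a u) + 2 * (beta * K1) ^+ 2))).
    have <- : Ex (J n x.2) (fun u => 1 + (dot a u + 2 * (beta * K1) ^+ 2)) =
        1 + (Ex (J n x.2) (fun u => dot a u) + 2 * (beta * K1) ^+ 2).
      by rewrite !ExD !Ex_cst //; exact: lawJ.
    apply: Ex_le; first exact: lawJ.
    move=> e eJ; have de := dot_step xL eJ ab.
    rewrite (le_trans (expR_le_quadratic (le_trans de bK))) // addrA lerD2l.
    by rewrite ler_wpM2l // -(real_normK (num_real (dot a e.2))) lerXn2r ?nnegrE // mulr_ge0.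
  apply: le_trans (expR_ge1Dx _) _; rewrite ler_expR /q.
  have := drift xL ab; rewrite ler_norml => /andP[_ h1].
  rewrite addrA lerD2r addrC lerBrDr (le_trans h1) //.
  by rewrite ler_wpM2l ?W_inv // mulr_ge0.
rewrite ExZ; apply: (@le_trans _ _ (expR q * expR (beta * B0 + beta * K1 * kappa * harm n + 2 * (beta * K1) ^+ 2 * n%:R))).
  by rewrite ler_wpM2l ?expR_ge0 // ih //; exact: T_bounded.
rewrite -expRD ler_expR harmS -natr1 /q le_eqVlt; apply/orP; left; apply/eqP; ring.
Qed.

(** The mean of a linear statistic, by the same recursion. *)
Let mean_bound n a beta : (J0 <= n)%N -> 0 <= beta -> bounded a beta ->
  `|Ex (L n) (fun G => dot a (U n G))| <= beta * B0 + beta * K1 * kappa * harm n.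
Proof.
move=> hn b0; elim: n hn a => [|n ih] hn a ab.
  by move: hn; rewrite /J0.
have [e|hn'] : J0 = n.+1 \/ (J0 <= n)%N by move: hn; rewrite leq_eqVlt => /predU1P[|]; [left|right].
  rewrite -e; apply: Ex_norm_le => // x xL.
  rewrite (le_trans (dot_usum _ _ ab)) //.
  rewrite (le_trans (ler_wpM2l b0 (usum_B0 xL))) // lerDl.
  by rewrite mulr_ge0 ?harm_ge0 // mulr_ge0 // mulr_ge0.
rewrite (L_step n (fun u => dot a u)).
rewrite -[X in `|X|](subrK (Ex (L n) (fun G => dot (T n a) (U n G)))).
rewrite (le_trans (ler_normD _ _)) // harmS mulrDr addrA [leRHS]addrC lerD //; last first.
  by apply: ih => //; exact: T_bounded.
rewrite -ExB; apply: Ex_norm_le => // x xL.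
under eq_fun do rewrite dotDr.
rewrite ExD Ex_cst; last exact: lawJ.
rewrite dot_T (_ : _ - _ = Ex (J n x.2) (fun u => dot a u) + dot a (U n x.2 *m A^T) / W n); last by ring.
by rewrite (le_trans (drift xL ab)) // -[beta * K1 * kappa * _]mulrA ler_wpM2l ?W_inv // mulr_ge0.
Qed.



Let sqrt_ge1 n : (0 < n)%N -> 1 <= Num.sqrt n%:R :> R.
Proof. by move=> n0; rewrite -[leLHS]sqrtr1 ler_sqrt ?ler1n. Qed.

Let exp_moment theta : exists C N0, forall n i, (N0 <= n)%N ->
  Ex (L n) (fun G => expR (theta * ((Num.sqrt n%:R)^-1 * U n G 0 i))) <= C.
Proof.
exists (expR (`|theta| * B0 + 4 * (`|theta| * K1 * kappa) + 2 * (`|theta| * K1) ^+ 2)).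
exists (J0 + (Num.truncn (4 * (`|theta| * K1) ^+ 2)).+1)%N => n i hn.
have hJ : (J0 <= n)%N by apply: leq_trans hn; exact: leq_addr.
have n0 : (0 < n)%N by apply: leq_trans hJ.
have q1 := sqrt_ge1 n0; set q := Num.sqrt n%:R in q1 *.
have q0 : 0 < q by lra.
have qn : q ^+ 2 = n%:R by rewrite sqr_sqrtr.
set z := `|theta| in hn *; have z0 : 0 <= z by exact: normr_ge0.
have hK : 2 * (z * K1) <= q.
  rewrite -(@ler_pXn2r _ 2) ?nnegrE ?(ltW q0) ?mulr_ge0 // qn exprMn.
  have -> : 2 ^+ 2 = 4 :> R by ring.
  apply: le_trans (ltW (truncnS_gt _)) _; rewrite ler_nat (leq_trans _ hn) //.
  exact: leq_addl.
pose a : 'rV[R]_r := (theta / q) *: delta_mx 0 i.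
have ab : bounded a (z / q).
  move=> j; rewrite /a !mxE eqxx normrM; case: eqP => _; last first.
    by rewrite normr0 mulr0 divr_ge0 // ltW.
  by rewrite normr1 mulr1 normrM normfV (gtr0_norm q0).
have b0 : 0 <= z / q by rewrite divr_ge0 // ltW.
have bK : z / q * K1 <= 1 / 2 by rewrite mulrAC ler_pdivrMr //; lra.
have -> : Ex (L n) (fun G => expR (theta * (q^-1 * U n G 0 i))) = Ex (L n) (fun G => expR (dot a (U n G))).
  by apply: eq_Ex => x _; rewrite /a dotZl dot_delta mulrA.
rewrite (le_trans (exp_bound hJ b0 bK ab)) // ler_expR.
have qi : q^-1 <= 1 by rewrite invf_le1.
have bz : z / q <= z by rewrite ler_piMr.
have t0 : 0 <= root4 n :> R := root4_ge0 n.
have t1 := @root4_ge1 R n n0.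
have tq : root4 n ^+ 2 = q := sqr_root4 n.
apply: lerD; first apply: lerD.
- by rewrite ler_wpM2r.
- have -> : z / q * K1 * kappa * harm n = z * K1 * kappa * (harm n / q) by field; rewrite gt_eqF.
  rewrite [leRHS]mulrC ler_wpM2l ?mulr_ge0 // ler_pdivrMr //.
  rewrite (le_trans (harm_le n)) // ler_wpM2l // -tq expr2.
  by rewrite ler_peMl.
rewrite -qn le_eqVlt; apply/orP; left; apply/eqP; field; rewrite gt_eqF //.
Qed.

Let usum_mean : exists C N1, [/\ 0 <= C, (J0 <= N1)%N & forall n, (N1 <= n)%N ->
  Ex (L n) (usum n) <= C * Num.sqrt n%:R].
Proof.
have [C [N hC]] := exp_moment 1; have [C' [N' hC']] := exp_moment (-1).
exists (r%:R * (`|C| + `|C'|)), (J0 + (N + N'))%N; split=> [||n hn].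
- by rewrite mulr_ge0 // addr_ge0.
- exact: leq_addr.
have hJ : (J0 <= n)%N by apply: leq_trans hn; exact: leq_addr.
have n0 : (0 < n)%N by apply: leq_trans hJ.
have q1 := sqrt_ge1 n0; set q := Num.sqrt n%:R in q1 *.
have q0 : 0 < q by lra.
rewrite Ex_sum -mulrA -sum_ord_const; apply: ler_sum => i _.
have hN : (N <= n)%N by rewrite (leq_trans _ hn) // addnCA leq_addr.
have hN' : (N' <= n)%N by rewrite (leq_trans _ hn) // addnA leq_addl.
apply: (@le_trans _ _ ((Ex (L n) (fun G => expR (1 * (q^-1 * U n G 0 i))) +
    Ex (L n) (fun G => expR (-1 * (q^-1 * U n G 0 i)))) * q)).
  rewrite mulrC -ExD -ExZ; apply: Ex_le => // x _.
  rewrite -ler_pdivrMl // mul1r mulN1r -[X in X * _](gtr0_norm (_ : 0 < q^-1)) ?invr_gt0 //.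
  by rewrite -normrM ler_norm_expR.
rewrite ler_pM2r // lerD //.
  by rewrite (le_trans (hC n i hN)) // ler_norm.
by rewrite (le_trans (hC' n i hN')) // ler_norm.
Qed.

Let W_inv1 n : (W n)^-1 <= kappa.
Proof. by rewrite (le_trans (W_inv n)) // ler_piMr // invf_le1 // ler1n. Qed.

Let W_inv_ge0 n : 0 <= (W n)^-1. Proof. by rewrite invr_ge0 ltW. Qed.

Let quad_ge0 a : 0 <= quad Q a.
Proof.
have [C [N [C0' hJ hN]]] := usum_mean.
pose beta := \sum_i `|a 0 i|.
have ab : bounded a beta by move=> i; rewrite /beta (bigD1 i) //= lerDl sumr_ge0.
pose D := beta ^+ 2 * (r%:R * K1 * kappa * (1 + C)).
have D0 : 0 <= D by rewrite mulr_ge0 ?sqr_ge0 // !mulr_ge0 // addr_ge0.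
rewrite -oppr_le0; apply: (@le0_root4 _ _ D N) => n hn.
have n0 : (0 < n)%N by apply: leq_trans hn; apply: leq_trans hJ.
have q1 := sqrt_ge1 n0; set q := Num.sqrt n%:R in q1 *.
have q0 : 0 < q by lra.
have qn : q ^+ 2 = n%:R by rewrite sqr_sqrtr.
have t1 := @root4_ge1 R n n0; have t0 : 0 < root4 n :> R by lra.
have tq : root4 n ^+ 2 = q := sqr_root4 n.
pose c := beta ^+ 2 * (r%:R * K1) / W n.
have c0 : 0 <= c by rewrite mulr_ge0 ?W_inv_ge0 // mulr_ge0 ?sqr_ge0 // mulr_ge0.
apply: (@le_trans _ _ (c * (1 + C * q))).
  apply: (@le_trans _ _ (Ex (L n) (fun G => c * (1 + usum n G)))).
    rewrite -(Ex_cst (- quad Q a) (lawL n)); apply: Ex_le => // x xL.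
    have h : 0 <= Ex (J n x.2) (fun u => dot a u ^+ 2).
      by apply: Ex_ge0 => [|e _]; [exact: lawJ|exact: sqr_ge0].
    have := square xL ab; rewrite ler_norml => /andP[_].
    have -> : beta ^+ 2 * (r%:R * K1 * (1 + usum n x.2) / W n) = c * (1 + usum n x.2).
      by rewrite /c; field; rewrite gt_eqF.
    by lra.
  by rewrite ExZ ExD Ex_cst // ler_wpM2l // lerD2l hN.
have c1 : c <= beta ^+ 2 * (r%:R * K1) * (kappa / n%:R).
  have cK : 0 <= beta ^+ 2 * (r%:R * K1) by rewrite mulr_ge0 ?sqr_ge0 // mulr_ge0.
  apply: (ler_wpM2l cK).
  rewrite (le_trans (W_inv n)) // ler_wpM2l //.
  by rewrite lef_pV2 ?posrE ?ltr0n // ler_nat.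
apply: (@le_trans _ _ (beta ^+ 2 * (r%:R * K1) * (kappa / n%:R) * ((1 + C) * q))).
  rewrite ler_pM // ?addr_ge0 ?mulr_ge0 ?(ltW q0) //.
  by rewrite [leRHS]mulrDl mul1r lerD2r.
rewrite -qn -tq (_ : _ * _ = D / root4 n ^+ 2); last by rewrite /D; field; rewrite gt_eqF.
rewrite ler_wpM2l // lef_pV2 ?posrE ?exprn_gt0 // expr2 ler_peMl // ltW //.
Qed.


(** One step of the chain, seen through characteristic functions: the drift
    is absorbed in the coefficient [a], and the conditional variance produces a
    Gaussian factor. *)
Let cos_step : exists C N1, [/\ 0 <= C, (J0 <= N1)%N &
  forall n a beta c, (N1 <= n)%N -> 0 <= beta <= 1 -> beta * (K1 * (1 + kappa)) <= 1 / 2 ->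
  bounded a beta ->
  `|Ex (L n.+1) (fun G => cos (dot a (U n.+1 G) + c)) -
    expR (- (quad Q a / 2)) * Ex (L n) (fun G => cos (dot (T n a) (U n G) + c))| <=
  C * (beta / n.+1%:R + beta ^+ 2 / Num.sqrt n.+1%:R + beta ^+ 3)].
Proof.
have [C [N [C0' hJ hN]]] := usum_mean.
pose q := l1 Q; pose lA := l1 A; pose K2 := K1 * (1 + kappa).
have q_ge0 : 0 <= q := l1_ge0 Q; have lA0 : 0 <= lA := l1_ge0 A.
have K20 : 0 <= K2 by rewrite mulr_ge0 // addr_ge0.
have K12 : K1 <= K2 by rewrite /K2 ler_peMr // lerDl.
pose D := r%:R * K1 + K2 * lA + q * lA.
have D0 : 0 <= D by rewrite !addr_ge0 // mulr_ge0.
exists (K1 ^+ 3 + q ^+ 2 + K1 * kappa + D * kappa * (1 + C)), N; split=> //.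
  by rewrite !addr_ge0 ?sqr_ge0 ?exprn_ge0 ?mulr_ge0 // addr_ge0.
move=> n a beta c hn /andP[b0 b1] bK ab.
rewrite -/K2 in bK.
have bK1 : beta * K1 <= 1 / 2 by rewrite (le_trans _ bK) // ler_wpM2l.
have bK0 : 0 <= beta * K1 by rewrite mulr_ge0.
have Wi0 := W_inv_ge0 n; have Wi1 := W_inv1 n; have Win := W_inv n.
pose v := quad Q a.
have v0 : 0 <= v by exact: quad_ge0.
have vq : v <= beta ^+ 2 * q by rewrite (le_trans _ (quad_l1 Q ab)) // ler_norm.
pose bound G := beta ^+ 3 * (K1 ^+ 3 + q ^+ 2) + beta * K1 / W n +
  beta ^+ 2 * D / W n * (1 + usum n G).
have step x : x \in L n ->
  `|Ex (J n x.2) (fun u => cos (dot a (U n x.2 + u) + c)) -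
    expR (- (v / 2)) * cos (dot (T n a) (U n x.2) + c)| <= bound x.2.
  move=> xL; set s := dot a (U n x.2) + c.
  pose m1 := Ex (J n x.2) (fun u => dot a u).
  pose m2 := Ex (J n x.2) (fun u => dot a u ^+ 2).
  pose y := dot a (U n x.2 *m A^T) / W n.
  have lJ := lawJ xL.
  have m1b : `|m1| <= beta * K1 by apply: Ex_norm_le => // e eJ; exact: dot_step eJ ab.
  have yd : `|m1 + y| <= beta * K1 / W n by exact: drift.
  have yK : `|y| <= beta * K2.
    have -> : y = (m1 + y) - m1 by ring.
    rewrite (le_trans (ler_normB _ _)) // /K2 mulrDr mulr1 mulrDr addrC lerD //.
    by rewrite (le_trans yd) // mulrA ler_wpM2l.
  have yS : `|y| <= beta * lA * usum n x.2 / W n.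
    rewrite normrM (ger0_norm Wi0) ler_wpM2r // dotE (le_trans (ler_norm_sum _ _ _)) //.
    rewrite -mulrA [X in _ <= _ * X]mulr_suml mulr_sumr; apply: ler_sum => i _.
    rewrite normrM ler_pM // mxE (le_trans (ler_norm_sum _ _ _)) // mulr_suml.
    apply: ler_sum => j _; rewrite normrM mulrC mxE ler_wpM2l //.
    by rewrite /usum (bigD1 j) //= lerDl sumr_ge0.
  have e1 : `|Ex (J n x.2) (fun u => cos (dot a (U n x.2 + u) + c)) -
      (cos s - m1 * sin s - m2 / 2 * cos s)| <= (beta * K1) ^+ 3.
    have -> : cos s - m1 * sin s - m2 / 2 * cos s = Ex (J n x.2) (fun u =>
        cos s - sin s * dot a u - (cos s / 2) * dot a u ^+ 2).
      by rewrite !ExB !ExZ Ex_cst // /m1 /m2; ring.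
    rewrite -ExB; apply: Ex_norm_le => // e eJ; have de := dot_step xL eJ ab.
    rewrite dotDr (_ : _ + _ + c = s + dot a e.2); last by rewrite /s; ring.
    have -> : cos s - sin s * dot a e.2 - (cos s / 2) * dot a e.2 ^+ 2 =
       cos s - dot a e.2 * sin s - dot a e.2 ^+ 2 / 2 * cos s by ring.
    rewrite (le_trans (cos_shift_taylor3 _ _)) //; first by lra.
    by rewrite lerXn2r ?nnegrE.
  have e3 : `|m2 - v| <= beta ^+ 2 * (r%:R * K1 * (1 + usum n x.2) / W n) by exact: square.
  have y1 : `|y| <= 1 by lra.
  have -> : dot (T n a) (U n x.2) + c = s - y by rewrite dot_T /s /y; ring.
  apply: le_trans (cos_compare e1 yd e3 y1 v0) _.
  have S0 := usum_ge0 n x.2; set S := usum n x.2 in yS e3 S0 *.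
  have y2 : y ^+ 2 <= beta * K2 * (beta * lA * S / W n).
    by rewrite -(real_normK (num_real y)) expr2 ler_pM.
  have v2 : v ^+ 2 <= beta ^+ 3 * q ^+ 2.
    apply: (@le_trans _ _ ((beta ^+ 2 * q) ^+ 2)); first by rewrite lerXn2r ?nnegrE // mulr_ge0 ?sqr_ge0.
    rewrite exprMn -exprM ler_wpM2r ?sqr_ge0 // /= (exprS _ 3) ler_piMl //.
    by rewrite exprn_ge0.
  have vy : v * `|y| <= (beta ^+ 2 * q) * (lA * S / W n).
    rewrite ler_pM // (le_trans yS) // -!mulrA ler_piMl // !mulr_ge0 //.
  have rest : 0 <= beta ^+ 2 * (K2 * lA + q * lA) / W n.
    by rewrite mulr_ge0 // mulr_ge0 ?sqr_ge0 // addr_ge0 // mulr_ge0.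
  rewrite /bound -/S.
  have -> : beta ^+ 3 * (K1 ^+ 3 + q ^+ 2) + beta * K1 / W n + beta ^+ 2 * D / W n * (1 + S) =
    (beta * K1) ^+ 3 + beta * K1 / W n + beta ^+ 2 * (r%:R * K1 * (1 + S) / W n) +
    beta * K2 * (beta * lA * S / W n) + beta ^+ 3 * q ^+ 2 + (beta ^+ 2 * q) * (lA * S / W n)
    + beta ^+ 2 * (K2 * lA + q * lA) / W n.
    by rewrite /D; ring.
  by lra.
rewrite (L_step n (fun u => cos (dot a u + c))) -ExZ -ExB.
apply: (@le_trans _ _ (Ex (L n) bound)).
  apply: le_trans (Ex_norm _ (lawL n)) _; apply: Ex_le => // x xL; exact: step.
rewrite /bound ExD Ex_cst // ExZ ExD Ex_cst //.
have n0 : (0 < n)%N by apply: leq_trans hn; apply: leq_trans hJ.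
set z := Num.sqrt n.+1%:R.
have z1 : 1 <= z by exact: sqrt_ge1.
have z2 : z ^+ 2 = n.+1%:R by rewrite sqr_sqrtr.
have U1 : 1 + Ex (L n) (usum n) <= (1 + C) * z.
  have h : Ex (L n) (usum n) <= C * z.
    by rewrite (le_trans (hN n hn)) // ler_wpM2l // ler_sqrt // ler_nat.
  by rewrite mulrDl mul1r lerD.
have z0 : 0 < z by lra.
have t1 : beta * K1 / W n <= K1 * kappa * (beta / n.+1%:R).
  have -> : K1 * kappa * (beta / n.+1%:R) = beta * K1 * (kappa / n.+1%:R) by ring.
  by rewrite ler_wpM2l.
have t2 : beta ^+ 2 * D / W n * (1 + Ex (L n) (usum n)) <= D * kappa * (1 + C) * (beta ^+ 2 / z).
  apply: (@le_trans _ _ (beta ^+ 2 * D * (kappa / n.+1%:R) * ((1 + C) * z))).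
    have u0 : 0 <= Ex (L n) (usum n) by apply: Ex_ge0.
    rewrite ler_pM // ?addr_ge0 ?mulr_ge0 ?sqr_ge0 //.
    by apply: (ler_wpM2l _ Win); rewrite mulr_ge0 ?sqr_ge0.
  by rewrite -z2 le_eqVlt; apply/orP; left; apply/eqP; field; rewrite gt_eqF.
have p1 : 0 <= beta / n.+1%:R by rewrite divr_ge0.
have p2 : 0 <= beta ^+ 2 / z by rewrite divr_ge0 ?sqr_ge0 // ltW.
have p3 : 0 <= beta ^+ 3 by rewrite exprn_ge0.
have q1 : 0 <= K1 ^+ 3 + q ^+ 2 by rewrite addr_ge0 ?sqr_ge0 ?exprn_ge0.
have q2 : 0 <= K1 * kappa by rewrite mulr_ge0.
have q3 : 0 <= D * kappa * (1 + C) by rewrite !mulr_ge0 // addr_ge0.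
set A1 := K1 ^+ 3 + q ^+ 2 in q1 *; set A2 := K1 * kappa in q2 t1 *.
set A3 := D * kappa * (1 + C) in q3 t2 *.
move: t1 t2 p1 p2 p3.
set B1 := beta / n.+1%:R; set B2 := beta ^+ 2 / z; set B3 := beta ^+ 3 => t1 t2 p1 p2 p3.
have -> : (A1 + A2 + A3) * (B1 + B2 + B3) =
  B3 * A1 + A2 * B1 + A3 * B2 + (A1 * B1 + A1 * B2 + A2 * B2 + A2 * B3 + A3 * B1 + A3 * B3) by ring.
have hh : 0 <= A1 * B1 + A1 * B2 + A2 * B2 + A2 * B3 + A3 * B1 + A3 * B3.
  by clear - q1 q2 q3 p1 p2 p3; clearbody A1 A2 A3 B1 B2 B3; do ?[apply: addr_ge0|apply: mulr_ge0].
by lra.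
Qed.


Let M n : 'M[R]_r := 1%:M - (W n)^-1 *: A.

(** The variance produced by the Gaussian factors collected from time [N] on. *)
Fixpoint variance N k : 'M[R]_r :=
  if k is k'.+1 then
    M (N + k')%N *m variance N k' *m (M (N + k')%N)^T + Q
  else 0.

Let quad_variance N k a :
  quad (variance N k.+1) a = quad (variance N k) (T (N + k)%N a) + quad Q a.
Proof.
rewrite /= quadD; congr (_ + _).
by rewrite /quad /T -/(M _) trmx_mul !mulmxA.
Qed.

Let variance_ge0 N k a : 0 <= quad (variance N k) a.
Proof.
elim: k a => [|k ih] a; first by rewrite /quad mulmx0 mul0mx mxE.
by rewrite quad_variance addr_ge0.
Qed.

Let isqrtS n : isqrt_sum n.+1 = isqrt_sum n + (Num.sqrt n.+1%:R)^-1 :> R.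
Proof. by rewrite /isqrt_sum big_ord_recr. Qed.

Let cos_bound : exists C C1 N, [/\ 0 <= C, 0 <= C1, (J0 <= N)%N &
  forall k a beta c, 0 <= beta <= 1 -> beta * (K1 * (1 + kappa)) <= 1 / 2 ->
  bounded a beta ->
  `|Ex (L (N + k)%N) (fun G => cos (dot a (U (N + k)%N G) + c)) -
    expR (- (quad (variance N k) a / 2)) * cos c| <=
  C1 * beta + C * (beta * harm (N + k)%N + beta ^+ 2 * isqrt_sum (N + k)%N +
                   beta ^+ 3 * (N + k)%:R)].
Proof.
have [C [N [C0' hJ hN]]] := cos_step.
pose E1 := 2 * Ex (L N) (usum N).
have E10 : 0 <= E1 by rewrite mulr_ge0 // Ex_ge0.
exists C, E1, N; split=> //.
elim=> [|k ih] a beta c /[dup] b01 /andP[b0 b1] bK ab.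
  rewrite addn0 /quad mulmx0 mul0mx mxE mul0r oppr0 expR0 mul1r.
  apply: (@le_trans _ _ (E1 * beta)); last first.
    rewrite lerDl mulr_ge0 // addr_ge0 // ?addr_ge0 // mulr_ge0 ?harm_ge0 ?isqrt_sum_ge0 //.
      exact: sqr_ge0.
    exact: exprn_ge0.
  rewrite -(Ex_cst (cos c) (lawL N)) -ExB (le_trans (Ex_norm _ (lawL N))) //.
  rewrite /E1 -mulrA [X in 2 * X]mulrC -!ExZ; apply: Ex_le => // x xL.
  rewrite [dot _ _ + c]addrC (le_trans (cos_lipschitz _ _)) // ler_wpM2l //.
  exact: dot_usum.
rewrite addnS; set n := (N + k)%N in ih *.
have hn : (N <= n)%N by exact: leq_addr.
have step := hN n a beta c hn b01 bK ab.
have Tb : bounded (T n a) beta by apply: T_bounded => //; exact: leq_trans hn.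
have ihT := ih _ _ c b01 bK Tb.
set e := expR (- (quad Q a / 2)) in step *.
have e0 : 0 <= e by exact: expR_ge0.
have e1 : e <= 1 by apply: expRN_le1; rewrite divr_ge0.
have -> : expR (- (quad (variance N k.+1) a / 2)) = e * expR (- (quad (variance N k) (T n a) / 2)).
  by rewrite quad_variance -expRD; congr expR; rewrite /n; field.
set X := Ex (L n.+1) _ in step *; set Y := Ex (L n) _ in step ihT *.
set z := expR _ in ihT *.
have -> : X - e * z * cos c = (X - e * Y) + e * (Y - z * cos c) by ring.
rewrite (le_trans (ler_normD _ _)) // [leRHS](_ : _ =
  C * (beta / n.+1%:R + beta ^+ 2 / Num.sqrt n.+1%:R + beta ^+ 3) +
  (E1 * beta + C * (beta * harm n + beta ^+ 2 * isqrt_sum n + beta ^+ 3 * n%:R))).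
  by rewrite lerD // normrM (ger0_norm e0) (le_trans _ ihT) // ler_piMl.
by rewrite harmS isqrtS -natr1; ring.
Qed.

(** The accumulated variance grows linearly, at a rate which solves the
    Lyapunov equation of the drift. *)
Let variance_linear S N : lyap A lam S = Q -> (J0 <= N)%N -> exists C, 0 <= C /\
  forall k, l1 (variance N k - (N + k)%:R *: S) <= C * (1 + harm (N + k)%N).
Proof.
move=> lS hN; pose X := A *m S + S *m A^T.
have SX : Q = S + lam^-1 *: X by rewrite -lS.
pose C := kappa * (w0 / lam * l1 X + lam^-1 * l1 (A *m S *m A^T)).
have li : 0 <= lam^-1 by rewrite invr_ge0 ltW.
have C00 : 0 <= C by rewrite mulr_ge0 // addr_ge0 // mulr_ge0 ?l1_ge0 // mulr_ge0 // ltW.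
have hb k : l1 (variance N k - (N + k)%:R *: S) <= N%:R * l1 S + C * harm (N + k)%N.
  elim: k => [|k ih].
    by rewrite addn0 sub0r -scaleNr l1Z normrN normr_nat lerDl mulr_ge0 ?harm_ge0.
  rewrite addnS /=; set n := (N + k)%N in ih *.
  have Wn := W_gt0 n.
  pose F := (lam^-1 - n%:R / W n) *: X + (n%:R / W n / W n) *: (A *m S *m A^T).
  have -> : M n *m variance N k *m (M n)^T + Q - n.+1%:R *: S =
      M n *m (variance N k - n%:R *: S) *m (M n)^T + F.
    have mB (Y X1 X2 X3 : 'M[R]_r) : Y *m (X1 - X2) *m X3 = Y *m X1 *m X3 - Y *m X2 *m X3.
      by rewrite mulmxBr mulmxBl.
    rewrite mB -!addrA; congr (_ + _).
    have MSM : M n *m (n%:R *: S) *m (M n)^T =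
        n%:R *: S - (n%:R / W n) *: X + (n%:R / W n / W n) *: (A *m S *m A^T).
      have -> : (M n)^T = 1%:M - (W n)^-1 *: A^T.
        by apply/matrixP => i j; rewrite !mxE eq_sym.
      rewrite /M -scalemxAr -scalemxAl mulmxBl mul1mx mulmxBr mulmx1 mulmxBl.
      rewrite -!scalemxAr -!scalemxAl /X.
      by apply/matrixP => i j; rewrite !mxE; ring.
    by rewrite MSM SX /F -natr1; apply/matrixP => i j; rewrite !mxE; ring.
  rewrite (le_trans (l1D _ _)) // harmS mulrDr addrA lerD //.
    rewrite (le_trans (l1_conj _ _)) // => j; apply: contraction_col => //.
    by apply: J0P; exact: leq_trans hN (leq_addr _ _).
  have nW : n%:R / W n <= lam^-1.
    by rewrite ler_pdivrMr // ler_pdivlMl // mulrC /W lerDl ltW.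
  have nW0 : 0 <= n%:R / W n by rewrite mulr_ge0 // W_inv_ge0.
  rewrite (le_trans (l1D _ _)) // !l1Z [C * _]mulrC /C mulrA.
  have -> : `|lam^-1 - n%:R / W n| = (W n)^-1 * (w0 / lam).
    rewrite ger0_norm ?subr_ge0 // /W; field; rewrite (gt_eqF lam_gt0) //=.
    by move: Wn; rewrite /W => Wn; rewrite gt_eqF.
  rewrite ger0_norm; last by rewrite mulr_ge0 // W_inv_ge0.
  apply: (@le_trans _ _ ((W n)^-1 * (w0 / lam * l1 X + lam^-1 * l1 (A *m S *m A^T)))).
    have Y0 := l1_ge0 (A *m S *m A^T).
    set Y1 := l1 X; set Y2 := l1 _ in Y0 *.
    have -> : (W n)^-1 * (w0 / lam) * Y1 + n%:R / W n / W n * Y2 =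
      (W n)^-1 * (w0 / lam * Y1 + n%:R / W n * Y2) by ring.
    by rewrite ler_wpM2l // lerD2l ler_wpM2r.
  rewrite ler_wpM2r //.
    by rewrite addr_ge0 // mulr_ge0 ?l1_ge0 // mulr_ge0 // ltW.
  by rewrite mulrC W_inv.
have a0 : 0 <= N%:R * l1 S := mulr_ge0 (ler0n _ _) (l1_ge0 S).
exists (N%:R * l1 S + C); split; first exact: addr_ge0.
move=> k; rewrite (le_trans (hb k)) // mulrDr mulr1 mulrDl -addrA lerD2l.
have := @harm_ge0 R (N + k)%N; set h := harm _ => h0.
have := mulr_ge0 a0 h0.
by lra.
Qed.


Let root4_facts n : (0 < n)%N -> let t : R := root4 n in
  [/\ 1 <= t, 0 < t, t ^+ 2 = Num.sqrt n%:R & t ^+ 4 = n%:R].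
Proof.
move=> n0 t; have t1 : 1 <= t := root4_ge1 n0.
split=> //; first by lra.
  exact: sqr_root4.
by rewrite (exprM _ 2 2) sqr_root4 sqr_sqrtr.
Qed.

Let lyap_sym S : lyap A lam S = Q -> S^T = S.
Proof.
move=> lS; apply/eqP; rewrite -subr_eq0; apply/eqP.
apply: (lyap_inj (A := A) (lam := lam)) => //.
have lT : lyap A lam S^T = Q.
  rewrite -[RHS]Q_sym -lS /lyap; apply/matrixP => i j; rewrite !mxE.
  congr (_ + _ * _); rewrite addrC; congr (_ + _); apply: eq_bigr => l _.
    by rewrite !mxE mulrC.
  by rewrite !mxE mulrC.
by rewrite addrC -scaleN1r lyap_is_linear lS lT scaleN1r addNr.
Qed.

Let lyap_psd S : lyap A lam S = Q -> forall a, 0 <= quad S a.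
Proof.
move=> lS a; have [C [C00 hC]] := variance_linear lS (leqnn J0).
pose b := \sum_i `|a 0 i|.
have ab : bounded a b by move=> i; rewrite /b (bigD1 i) //= lerDl sumr_ge0.
rewrite -oppr_le0; apply: (@le0_root4 _ _ (b ^+ 2 * (C * 5)) J0) => n hn.
have n0 : (0 < n)%N by apply: leq_trans hn.
have [t1 t0 t2 t4] := root4_facts n0; set t := root4 n in t1 t0 t2 t4 *.
have := hC (n - J0)%N; rewrite subnKC // => h.
have := quad_l1 (variance J0 (n - J0) - n%:R *: S) ab.
rewrite quadB quadZr ler_norml => /andP[_ hq].
have v0 := variance_ge0 J0 (n - J0) a.
have hh : 1 + harm n <= 5 * t by have := @harm_le R n; rewrite -/t; lra.
have nn : 0 < n%:R :> R by rewrite ltr0n.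
rewrite -(ler_pM2l nn) mulrN.
apply: (@le_trans _ _ (b ^+ 2 * (C * (5 * t)))).
  have := ler_wpM2l C00 hh; set y := C * (5 * t) => h2.
  have := ler_wpM2l (sqr_ge0 b) (le_trans h h2); lra.
have -> : n%:R * (b ^+ 2 * (C * 5) / t) = b ^+ 2 * (C * (5 * t)) * (n%:R / t ^+ 2).
  by field; rewrite gt_eqF.
have X0 : 0 <= C * (5 * t) by apply: mulr_ge0 => //; rewrite mulr_ge0 // ltW.
apply: ler_peMr; first by rewrite mulr_ge0 ?sqr_ge0.
have -> : n%:R / t ^+ 2 = t ^+ 2 by rewrite -t4; field; rewrite gt_eqF.
by rewrite expr_ge1 // ltW.
Qed.

Let cos_cvg S : lyap A lam S = Q -> forall a c,
  Ex (L n) (fun G => cos (dot a ((Num.sqrt n%:R)^-1 *: U n G) + c)) @[n --> \oo] -->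
  expR (- (quad S a / 2)) * cos c.
Proof.
move=> lS a c; have [C [C1 [N [C00 C10 hN hC]]]] := cos_bound.
have [D [D0 hD]] := variance_linear lS hN.
pose b := \sum_i `|a 0 i|.
have b0 : 0 <= b by rewrite sumr_ge0.
have ab : bounded a b by move=> i; rewrite /b (bigD1 i) //= lerDl sumr_ge0.
pose K2 := K1 * (1 + kappa).
have K20 : 0 <= K2 by rewrite mulr_ge0 // addr_ge0.
pose N2 := (N + ((Num.truncn (b ^+ 2)).+1 + (Num.truncn (4 * (b * K2) ^+ 2)).+1))%N.
pose CC := C1 * b + C * (4 * b + 2 * b ^+ 2 + b ^+ 3) + b ^+ 2 * (5 * D).
apply: (@cvg_root4 _ _ _ CC N2) => n hn.
have hnN : (N <= n)%N by rewrite (leq_trans _ hn) // leq_addr.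
have n0 : (0 < n)%N by apply: leq_trans hnN; apply: leq_trans hN.
have [t1 t0 t2 t4] := root4_facts n0; set t := root4 n in t1 t0 t2 t4 *.
rewrite -t2.
have hbt : b <= t ^+ 2.
  rewrite -(@ler_pXn2r _ 2) ?nnegrE ?sqr_ge0 // -exprM t4.
  apply: le_trans (ltW (truncnS_gt _)) _; rewrite ler_nat (leq_trans _ hn) //.
  by rewrite /N2 addnCA leq_addr.
have hKt : 2 * (b * K2) <= t ^+ 2.
  have bK0 : 0 <= 2 * (b * K2) by rewrite mulr_ge0 // mulr_ge0.
  rewrite -(@ler_pXn2r _ 2) ?nnegrE ?sqr_ge0 // -exprM t4 exprMn.
  have -> : 2 ^+ 2 = 4 :> R by ring.
  apply: le_trans (ltW (truncnS_gt _)) _; rewrite ler_nat (leq_trans _ hn) //.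
  by rewrite /N2 addnA leq_addl.
have tt0 : 0 < t ^+ 2 by rewrite exprn_gt0.
pose beta := b / t ^+ 2.
have be0 : 0 <= beta by rewrite divr_ge0 // ltW.
have be1 : beta <= 1 by rewrite ler_pdivrMr // mul1r.
have bK : beta * K2 <= 1 / 2 by rewrite /beta mulrAC ler_pdivrMr //; lra.
pose a' := (t ^+ 2)^-1 *: a.
have ab' : bounded a' beta.
  move=> j; rewrite /a' mxE normrM ger0_norm ?invr_ge0 ?(ltW tt0) // mulrC.
  by rewrite ler_wpM2r // invr_ge0 ltW.
have := hC (n - N)%N a' beta c; rewrite subnKC // be0 be1 => /(_ isT bK ab') hcos.
have -> : Ex (L n) (fun G => cos (dot a ((t ^+ 2)^-1 *: U n G) + c)) =
  Ex (L n) (fun G => cos (dot a' (U n G) + c)).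
  by apply: eq_Ex => x _; rewrite /a' dotZr dotZl.
have := hD (n - N)%N; rewrite subnKC // => h.
set Vn := variance N (n - N) in h hcos.
set E := Ex (L n) _ in hcos *.
have hh : 1 + harm n <= 5 * t by have := @harm_le R n; rewrite -/t; lra.
have qq : `|quad Vn a' - quad S a| <= b ^+ 2 * (5 * D) / t.
  have -> : quad Vn a' - quad S a = quad (Vn - n%:R *: S) a'.
    by rewrite quadB quadZr /a' !quadZl -t4; field; rewrite gt_eqF.
  rewrite (le_trans (quad_l1 _ ab')) // /beta expr_div_n -exprM t4.
  apply: (@le_trans _ _ (b ^+ 2 / n%:R * (D * (5 * t)))).
    rewrite ler_wpM2l ?(le_trans h) ?ler_wpM2l //.
    by rewrite divr_ge0 ?sqr_ge0.
  have -> : b ^+ 2 / n%:R * (D * (5 * t)) = b ^+ 2 * (5 * D) / t * (t ^+ 2)^-1.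
    by rewrite -t4; field; rewrite gt_eqF.
  rewrite ler_piMr ?invf_le1 ?expr_ge1 ?(ltW t0) //.
  by rewrite divr_ge0 ?(ltW t0) // mulr_ge0 ?sqr_ge0 // mulr_ge0.
have S0 := lyap_psd lS a.
have V0 : 0 <= quad Vn a' by exact: variance_ge0.
set e1 := expR _ in hcos; set e2 := expR (- (quad S a / 2)).
have ee : `|e1 - e2| <= b ^+ 2 * (5 * D) / t.
  rewrite (le_trans (expRN_lipschitz _ _)) ?divr_ge0 // -mulrBl normrM.
  rewrite (@ger0_norm _ 2^-1) ?invr_ge0 // (le_trans _ qq) //.
  by have := normr_ge0 (quad Vn a' - quad S a); lra.
have -> : E - e2 * cos c = (E - e1 * cos c) + (e1 - e2) * cos c by ring.
rewrite (le_trans (ler_normD _ _)) // /CC [leRHS]mulrDl lerD //; last first.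
  by rewrite normrM (le_trans _ ee) // ler_piMr // cos_max.
apply: le_trans hcos _; rewrite mulrDl lerD //.
  rewrite -mulrA ler_wpM2l // /beta ler_wpM2l // lef_pV2 ?posrE // expr2.
  by rewrite ler_peMl // ltW.
rewrite -[leRHS]mulrA; apply: (ler_wpM2l C00).
rewrite [leRHS]mulrDl [X in _ <= X + _]mulrDl !lerD //.
- rewrite /beta; have -> : 4 * b / t = b / t ^+ 2 * (4 * t) by field; rewrite gt_eqF.
  by rewrite ler_wpM2l // harm_le.
- have tle : (t ^+ 2)^-1 <= t^-1.
    by rewrite lef_pV2 ?posrE // expr2 ler_peMl // ltW.
  apply: (@le_trans _ _ (beta ^+ 2 * (2 * t ^+ 2))).
    by rewrite ler_wpM2l ?sqr_ge0 // t2 isqrt_sum_le.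
  rewrite /beta; have -> : (b / t ^+ 2) ^+ 2 * (2 * t ^+ 2) = 2 * b ^+ 2 / t ^+ 2 by field; rewrite gt_eqF.
  by rewrite ler_wpM2l // mulr_ge0 ?sqr_ge0.
- have tle : (t ^+ 2)^-1 <= t^-1.
    by rewrite lef_pV2 ?posrE // expr2 ler_peMl // ltW.
  rewrite /beta -t4; have -> : (b / t ^+ 2) ^+ 3 * t ^+ 4 = b ^+ 3 / t ^+ 2 by field; rewrite gt_eqF.
  by rewrite ler_wpM2l // exprn_ge0.
Qed.

Let mean_cvg i : (Num.sqrt n%:R)^-1 * Ex (L n) (fun G => U n G 0 i) @[n --> \oo] --> (0 : R).
Proof.
apply: (@cvg_root4 _ _ _ (B0 + 4 * (K1 * kappa)) J0) => n hn.
have n0 : (0 < n)%N by apply: leq_trans hn.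
have [t1 t0 t2 t4] := root4_facts n0; set t := root4 n in t1 t0 t2 t4 *.
rewrite subr0 -t2 normrM ger0_norm ?invr_ge0 ?sqr_ge0 //.
have ab : bounded (delta_mx 0 i) 1.
  by move=> j; rewrite mxE eqxx; case: eqP => _; rewrite ?normr1 ?normr0.
have := mean_bound hn ler01 ab; rewrite !mul1r.
rewrite (eq_Ex (h' := fun G => U n G 0 i)); last by move=> x _; exact: dot_delta.
move=> h; have h4 := @harm_le R n; rewrite -/t in h4.
have KK : 0 <= K1 * kappa by rewrite mulr_ge0.
apply: (@le_trans _ _ ((t ^+ 2)^-1 * ((B0 + 4 * (K1 * kappa)) * t))).
  rewrite ler_wpM2l ?invr_ge0 ?sqr_ge0 // (le_trans h) // mulrDl lerD //.
    by rewrite ler_peMr.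
  by have := ler_wpM2l KK h4; lra.
by rewrite le_eqVlt; apply/orP; left; apply/eqP; field; rewrite gt_eqF.
Qed.

Theorem linear_drift_clt : exists S : 'M[R]_r,
  [/\ S^T = S,
      forall a, 0 <= quad S a,
      forall a c,
        Ex (L n) (fun G => cos (dot a ((Num.sqrt n%:R)^-1 *: U n G) + c)) @[n --> \oo] -->
        expR (- (quad S a / 2)) * cos c,
      forall theta, exists C N0, forall n i, (N0 <= n)%N ->
        Ex (L n) (fun G => expR (theta * ((Num.sqrt n%:R)^-1 * U n G 0 i))) <= C
    & forall i, (Num.sqrt n%:R)^-1 * Ex (L n) (fun G => U n G 0 i) @[n --> \oo] --> (0 : R)].
Proof.
have [S lS] := lyap_surj lam_gt0 A_off A_diag A_col Q.
exists S; split.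
- exact: lyap_sym.
- exact: lyap_psd.
- exact: cos_cvg.
- exact: exp_moment.
- exact: mean_cvg.
Qed.

End LinearDrift.

(** * Out-degrees in a growing network *)

Section Degrees.
Implicit Types (G B : network).

Definition one_sink G := forall v : vertex G, outdeg v = 0%N <-> v = south G.

Lemma outdeg_south G : one_sink G -> outdeg (south G) = 0%N.
Proof. by move=> h; apply/h. Qed.

Lemma outdeg_gt0 G (v : vertex G) : one_sink G -> (0 < outdeg v)%N = (v != south G).
Proof.
move=> h; rewrite lt0n; congr (~~ _).
by apply/eqP/eqP => /h.
Qed.

Definition north_deg B := outdeg (north B).

Lemma north_deg_gt0 B : one_sink B -> (0 < north_deg B)%N.
Proof. by move=> h; rewrite outdeg_gt0. Qed.

Definition inner_vertex B (y : 'I_(inner B)) : vertex B := rshift 2 y.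

Lemma inner_vertex_gt0 B (y : 'I_(inner B)) : one_sink B -> (0 < outdeg (inner_vertex y))%N.
Proof. by move=> h; rewrite outdeg_gt0. Qed.

Lemma tail_neq_south G (a : vertex G * vertex G) : one_sink G -> a \in arcs G ->
  a.1 != south G.
Proof.
move=> h aG; rewrite -outdeg_gt0 // /outdeg -has_count; apply/hasP; exists a => //.
Qed.

Section Attach.
Variables (G B : network) (a : vertex G * vertex G).
Hypotheses (G_sink : one_sink G) (B_sink : one_sink B) (aG : a \in arcs G).

Let old (x : vertex G) : vertex (attach a B) := lshift (inner B) x.
Let new (y : 'I_(inner B)) : vertex (attach a B) := rshift (inner G).+2 y.

(* No arc of the block leaves its south pole, so a tail is fused with [a.1] or
   is an inner vertex. *)
Let tail_old b x : b \in arcs B ->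
  (fuse a b.1 == lshift (inner B) x) = (b.1 == north B) && (a.1 == x).
Proof.
move=> bB; have := tail_neq_south B_sink bB; rewrite /fuse => bS.
case: fintype.splitP => j hj.
  case: (j =P ord0) => j0.
    have -> : b.1 = north B by apply: val_inj; rewrite /= hj j0.
    by rewrite eqxx (inj_eq (@lshift_inj _ _)).
  case: j j0 hj => -[|[|j]] // hj j0 bj; first by case: j0; exact: val_inj.
  by case/negP: bS; apply/eqP/val_inj.
rewrite eq_rlshift; case: eqP => // e.
by move: hj; rewrite e.
Qed.

Let tail_new b y : b \in arcs B ->
  (fuse a b.1 == rshift (inner G).+2 y) = (b.1 == inner_vertex y).
Proof.
move=> bB; rewrite /fuse; case: fintype.splitP => j hj.
  case: ifP => _; rewrite eq_lrshift; symmetry; apply/eqP => e; move: hj; rewrite e /=;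
  by case: j => -[|[|j]].
rewrite eq_rshift; apply/eqP/eqP => [<-|e]; first exact: val_inj.
by apply: val_inj; move: hj; rewrite e /= !add2n => -[].
Qed.

Lemma outdeg_old x :
  (outdeg (old x) + (a.1 == x) = outdeg x + (a.1 == x) * north_deg B)%N.
Proof.
rewrite /outdeg /= count_cat !count_map.
rewrite (permP (perm_to_rem aG) (fun b => b.1 == x)) /=.
rewrite addnC addnA; congr (_ + _)%N.
rewrite (@eq_in_count _ _ (fun b => (b.1 == north B) && (a.1 == x))); last first.
  by move=> b bB; exact: tail_old.
case: (a.1 == x); last by rewrite mul0n (eq_count (a2 := pred0)) ?count_pred0 // => b /=; rewrite andbF.
by rewrite mul1n; apply: eq_count => b /=; rewrite andbT.
Qed.

Lemma outdeg_new y : outdeg (new y) = outdeg (inner_vertex y).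
Proof.
rewrite /outdeg /= count_cat !count_map (eq_count (a2 := pred0)) ?count_pred0 ?add0n.
  by apply: eq_in_count => b bB; exact: tail_new.
by move=> b /=; exact: eq_lrshift.
Qed.

Lemma attach_one_sink : one_sink (attach a B).
Proof.
move=> v; rewrite -[v](splitK (m := (inner G).+2)); case: (fintype.split _) => x /=.
  have aS := tail_neq_south G_sink aG.
  have := outdeg_old x; rewrite /old; case: eqP => [<-|_] /=.
    rewrite mul1n addn1 => h.
    have d0 : (0 < outdeg a.1)%N by rewrite outdeg_gt0.
    have n0 := north_deg_gt0 B_sink.
    split=> [e|/(congr1 val) /= e]; last by case/eqP: aS; exact: val_inj.
    move: h n0 d0; rewrite e; case: (outdeg a.1) => // d; case: (north_deg B) => // b.
    by rewrite addSn addnS.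
  rewrite !addn0 => ->; split=> [/G_sink ->|/(congr1 val) /= e]; first exact: val_inj.
  by apply/G_sink; exact: val_inj.
rewrite -/(new x) outdeg_new; split=> [e|/(congr1 val)//].
by have := inner_vertex_gt0 x B_sink; rewrite e.
Qed.

End Attach.

Section Statistics.
Context {R : realType}.
Implicit Types (phi : nat -> R).

Definition stat phi G : R := \sum_(v : vertex G | v != south G) phi (outdeg v).

Definition inner_stat phi B : R := \sum_(y : 'I_(inner B)) phi (outdeg (inner_vertex y)).

Lemma stat_block phi B : stat phi B = phi (north_deg B) + inner_stat phi B.
Proof.
rewrite /stat (bigD1 (north B)) //=; congr (_ + _).
rewrite /vertex (@big_split_ord _ _ _ 2 (inner B)) /=.
rewrite big_mkcond !big_ord_recl big_ord0 /= !add0r.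
by apply: eq_big => // y; rewrite ?andbT.
Qed.

Lemma stat_attach phi G B (a : vertex G * vertex G) : one_sink G -> one_sink B ->
  a \in arcs G ->
  stat phi (attach a B) = stat phi G - phi (outdeg a.1) +
    phi ((outdeg a.1).-1 + north_deg B)%N + inner_stat phi B.
Proof.
move=> hG hB aG; have aS := tail_neq_south hG aG.
have d0 : (0 < outdeg a.1)%N by rewrite outdeg_gt0.
rewrite {1}/stat /vertex /attach /= (@big_split_ord _ _ _ (inner G).+2 (inner B)) /=.
congr (_ + _); last by apply: eq_bigr => y _; congr phi; exact: outdeg_new.
rewrite /stat [RHS]addrC [in RHS](bigD1 a.1) //= [phi (outdeg a.1) + _]addrC addrK.
rewrite (bigD1 a.1) /=; last by move: aS; apply: contra => /eqP/(congr1 val) e; exact/eqP/val_inj.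
congr (_ + _).
  congr phi; have := outdeg_old hB aG a.1; rewrite eqxx mul1n addn1 => e.
  by apply: succn_inj; rewrite [LHS]e -addSn prednK.
apply: eq_big => [x|x /andP[_ xa]].
  congr (_ && _); congr (~~ _); apply/eqP/eqP => [/(congr1 val) e|->]; exact: val_inj.
congr phi; have := outdeg_old hB aG x; rewrite eq_sym (negbTE xa) mul0n !addn0 => e.
exact: e.
Qed.

End Statistics.
End Degrees.

(** * One growth step *)

Section Step.
Context {R : realType}.
Implicit Types (G B : network) (phi : nat -> R).

Lemma sum_tails G (c : vertex G -> R) :
  \sum_(a <- arcs G) c a.1 = \sum_v (outdeg v)%:R * c v.
Proof.
transitivity (\sum_(a <- arcs G) \sum_v (a.1 == v)%:R * c v).
  apply: eq_bigr => a _; rewrite (bigD1 a.1) //= eqxx mul1r big1 ?addr0 // => v.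
  by rewrite eq_sym => /negbTE ->; rewrite mul0r.
rewrite exchange_big; apply: eq_bigr => v _ /=.
rewrite -mulr_suml -natr_sum /outdeg -sum1_count [in RHS]big_mkcond /=.
by congr (_%:R * _); apply: eq_bigr => a _; case: (a.1 == v).
Qed.

Lemma num_outdeg_stat G k : one_sink G -> (0 < k)%N ->
  (num_outdeg G k)%:R = stat (fun d => (d == k)%:R) G :> R.
Proof.
move=> hG k0; rewrite /num_outdeg /stat -natr_sum; congr (_%:R).
rewrite cardsE -sum1_card big_mkcond [RHS]big_mkcond /=; apply: eq_bigr => v _.
rewrite -(outdeg_gt0 v hG) unfold_in -[eqn _ _]/(outdeg v == k).
case: (outdeg v =P k) => [->|_]; first by rewrite k0.
by case: ifP.
Qed.

Lemma stat_finite_support phi K G : one_sink G -> (forall d, (K < d)%N -> phi d = 0) ->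
  stat phi G = \sum_(1 <= d < K.+1) phi d * (num_outdeg G d)%:R.
Proof.
move=> hG phi0.
rewrite (eq_big_nat _ _ (F2 := fun d => \sum_(v : vertex G | v != south G) phi d * (outdeg v == d)%:R)); last first.
  by move=> d /andP[d0 _]; rewrite num_outdeg_stat // /stat mulr_sumr.
rewrite exchange_big /=; apply: eq_bigr => v vS.
have d0 : (0 < outdeg v)%N by rewrite outdeg_gt0.
case: (leqP (outdeg v) K) => dK.
  rewrite (@big_cat_nat _ _ _ (outdeg v)) //= ?leqW // [X in _ + X]big_ltn // eqxx mulr1.
  rewrite !big1_seq ?addr0 ?add0r // => e; rewrite mem_index_iota => /andP[_ /andP[e1 e2]].
    by rewrite (ltn_eqF e1) mulr0.
  by rewrite (gtn_eqF e2) mulr0.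
rewrite phi0 // big1_seq // => e; rewrite mem_index_iota => /andP[_ /andP[e1 e2]].
by rewrite (gtn_eqF (leq_trans e2 dK)) mulr0.
Qed.

Variables (chi rho : R) (m : nat) (blocks : 'I_m -> network) (p : 'I_m -> R).
Hypothesis chi_ge0 : 0 <= chi.
Hypothesis chi_rho_gt0 : 0 < chi + rho.
Hypothesis p_gt0 : forall i, 0 < p i.
Hypothesis p_sum1 : \sum_(i < m) p i = 1.
Hypothesis blocks_sink : forall i, one_sink (blocks i).
Let w := w chi rho.

Lemma w_gt0 d : (0 < d)%N -> 0 < w d.
Proof.
move=> d0; rewrite /w /Defs.w; apply: lt_le_trans chi_rho_gt0 _.
by rewrite lerD2r ler_peMr // ler1n.
Qed.

Lemma total_gt0 G : one_sink G -> 0 < stat w G.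
Proof.
move=> hG; rewrite /stat (bigD1 (north G)) //= ltr_pwDl //.
  by rewrite w_gt0 // outdeg_gt0.
by rewrite sumr_ge0 // => v /andP[vS _]; rewrite ltW // w_gt0 // outdeg_gt0.
Qed.

(** The networks reachable in one step, with their probabilities. *)
Definition successors G : seq (R * network) :=
  [seq (latch_prob chi rho a.1 * (outdeg a.1)%:R^-1 * p i, attach a (blocks i)) |
    a <- arcs G, i <- enum 'I_m].

Lemma mem_successors G x : x \in successors G -> exists a i,
  [/\ a \in arcs G, x.1 = latch_prob chi rho a.1 * (outdeg a.1)%:R^-1 * p i &
    x.2 = attach a (blocks i)].
Proof. by case/allpairsP => -[a i] [aG _ ->]; exists a, i. Qed.

Lemma Ex_successors G h : Ex (successors G) h =
  \sum_(a <- arcs G) \sum_(i < m)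
    latch_prob chi rho a.1 * (outdeg a.1)%:R^-1 * p i * h (attach a (blocks i)).
Proof. by rewrite /Ex big_allpairs_dep; apply: eq_bigr => a _; rewrite big_enum. Qed.

Lemma Ex_successors_deg G h (H : nat -> 'I_m -> R) : one_sink G ->
  (forall a i, a \in arcs G -> h (attach a (blocks i)) = H (outdeg a.1) i) ->
  Ex (successors G) h = stat (fun d => w d * \sum_i p i * H d i) G / stat w G.
Proof.
move=> hG hH; rewrite Ex_successors.
pose c (v : vertex G) := w (outdeg v) / stat w G * (outdeg v)%:R^-1 * \sum_i p i * H (outdeg v) i.
transitivity (\sum_(a <- arcs G) c a.1).
  rewrite big_seq [RHS]big_seq; apply: eq_bigr => a aG; rewrite /c mulr_sumr.
  by apply: eq_bigr => i _; rewrite hH // mulrA.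
rewrite sum_tails (bigID (fun v => v == south G)) /= big_pred1_eq outdeg_south // mul0r add0r.
rewrite /stat mulr_suml; apply: eq_bigr => v vS; rewrite /c -/(stat w G).
have d0 : (outdeg v)%:R != 0 :> R by rewrite pnatr_eq0 -lt0n outdeg_gt0.
by rewrite -[LHS]mulr1 /c; field; rewrite d0 (gt_eqF (total_gt0 hG)).
Qed.

Lemma successors_gt0 G x : one_sink G -> x \in successors G -> 0 < x.1.
Proof.
move=> hG /mem_successors[a [i [aG -> _]]].
have aS := tail_neq_south hG aG; have d0 : (0 < outdeg a.1)%N by rewrite outdeg_gt0.
rewrite mulr_gt0 // mulr_gt0 ?invr_gt0 ?ltr0n //.
by rewrite divr_gt0 ?w_gt0 //; exact: total_gt0.
Qed.

Lemma successors_law G : one_sink G -> is_law (successors G).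
Proof.
move=> hG; split=> [x /(successors_gt0 hG)/ltW //|].
have -> : \sum_(x <- successors G) x.1 = Ex (successors G) (fun=> 1).
  by apply: eq_bigr => x _; rewrite mulr1.
rewrite (Ex_successors_deg (H := fun _ _ => 1)) //.
have -> : \sum_i p i * 1 = 1 by rewrite -mulr_suml mulr1.
have -> : stat (fun d => w d * 1) G = stat w G by apply: eq_bigr => v _; rewrite mulr1.
by rewrite divff // gt_eqF // total_gt0.
Qed.

Lemma successors_sink G x : one_sink G -> x \in successors G -> one_sink x.2.
Proof. by move=> hG /mem_successors[a [i [aG _ ->]]]; exact: attach_one_sink. Qed.

Lemma step_prob_successors G H : one_sink G ->
  step_prob chi rho blocks p G H = Ex (successors G) (fun X => (X == H)%:R).
Proof.
move=> hG; rewrite Ex_successors /step_prob.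
pose F (a : vertex G * vertex G) := \sum_(i < m) p i * (attach a (blocks i) == H)%:R.
transitivity (\sum_(v : vertex G | v != south G) \sum_(a <- arcs G | a.1 == v)
    latch_prob chi rho a.1 * (outdeg a.1)%:R^-1 * F a).
  apply: eq_bigr => v _; rewrite mulr_sumr; apply: eq_bigr => a /eqP <-.
  by rewrite mulrA.
rewrite (exchange_big_dep xpredT) //= big_seq [RHS]big_seq; apply: eq_bigr => a aG.
rewrite (big_pred1 a.1) => [|v /=].
  by rewrite /F mulr_sumr; apply: eq_bigr => i _; rewrite !mulrA.
have [->|va] := eqVneq v a.1; first by rewrite /= ?andbT tail_neq_south.
by rewrite andbF.
Qed.

Variable s : R.
Hypothesis s_const : forall i, excess chi rho (blocks i) = s.
Definition growth_rate := s - rho.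

Lemma inner_weight i :
  inner_stat w (blocks i) + chi * ((north_deg (blocks i))%:R - 1) = growth_rate.
Proof.
rewrite /growth_rate -(s_const i) /excess (bigD1 (south (blocks i))) //= outdeg_south //.
rewrite mulr0 add0r -/(stat w (blocks i)) stat_block /w /Defs.w; ring.
Qed.

Lemma total_block i : stat w (blocks i) = growth_rate + (chi + rho).
Proof. by rewrite stat_block -(inner_weight i) /w /Defs.w; ring. Qed.

Lemma total_attach G (a : vertex G * vertex G) i : one_sink G -> a \in arcs G ->
  stat w (attach a (blocks i)) = stat w G + growth_rate.
Proof.
move=> hG aG; rewrite stat_attach // -(inner_weight i) -!addrA; congr (_ + _).
have d0 : (0 < outdeg a.1)%N by rewrite outdeg_gt0 // tail_neq_south.
rewrite /w /Defs.w -(prednK d0) /= natrD -natr1; ring.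
Qed.

Lemma total_successors G x : one_sink G -> x \in successors G ->
  stat w x.2 = stat w G + growth_rate.
Proof. by move=> hG /mem_successors[a [i [aG _ ->]]]; exact: total_attach. Qed.

Lemma inner_weight_ge0 i : 0 <= inner_stat w (blocks i).
Proof. by rewrite sumr_ge0 // => y _; rewrite ltW // w_gt0 // inner_vertex_gt0. Qed.

Lemma growth_rate_ge0 : 0 <= growth_rate.
Proof.
case: m blocks p p_sum1 blocks_sink s_const inner_weight inner_weight_ge0 => [|m'] b q q1 bS sc h h0.
  by move: q1; rewrite big_ord0 => /eqP; rewrite eq_sym oner_eq0.
rewrite -(h ord0) addr_ge0 // mulr_ge0 // subr_ge0 ler1n.
by rewrite north_deg_gt0.
Qed.

(** Without growth of the total weight, every block is a bundle of parallel
    arcs. *)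
Lemma growth_rate0 : growth_rate = 0 -> forall i, inner (blocks i) = 0%N.
Proof.
move=> e i; have := inner_weight i; rewrite e => h.
have n0 : 0 <= chi * ((north_deg (blocks i))%:R - 1).
  by rewrite mulr_ge0 // subr_ge0 ler1n north_deg_gt0.
have h0 : inner_stat w (blocks i) = 0.
  by apply/eqP; rewrite eq_le inner_weight_ge0 andbT; lra.
case E: (inner (blocks i)) => [//|l].
have y : 'I_(inner (blocks i)) by rewrite E; exact: ord0.
have pos (z : 'I_(inner (blocks i))) : true -> 0 <= w (outdeg (inner_vertex z)).
  by move=> _; rewrite ltW // w_gt0 // inner_vertex_gt0.
have /psumr_eq0P := h0 => /(_ pos y isT) wy.
by have := w_gt0 (inner_vertex_gt0 y (@blocks_sink i)); rewrite wy ltxx.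
Qed.

End Step.

(** * Out-degree counts and their increments *)

Section Counts.
Context {R : realType}.
Variables (chi rho : R) (m : nat) (blocks : 'I_m -> network) (p : 'I_m -> R).
Hypothesis chi_ge0 : 0 <= chi.
Hypothesis chi_rho_gt0 : 0 < chi + rho.
Hypothesis p_gt0 : forall i, 0 < p i.
Hypothesis p_sum1 : \sum_(i < m) p i = 1.
Hypothesis blocks_sink : forall i, one_sink (blocks i).
Variable s : R.
Hypothesis s_const : forall i, excess chi rho (blocks i) = s.
Variables (r : nat) (k : 'I_r -> nat) (psi : 'rV[R]_r).
Hypothesis k_gt0 : forall j, (0 < k j)%N.
Hypothesis k_incr : forall i j : 'I_r, (i < j)%N -> (k i < k j)%N.
Let w := w chi rho.
Let sigma := growth_rate rho s.
Implicit Types (G : network) (H : 'rV[R]_r -> R).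

Let k_inj : injective k.
Proof.
move=> i j e; apply/val_inj/eqP; move: e; rewrite /=.
by case: ltngtP => // /k_incr; rewrite ltn_neqAle => /andP[/eqP h _] e; case: h.
Qed.

Definition max_degree : nat := \max_(j < r) k j.
Let K := max_degree.

Let k_le j : (k j <= K)%N. Proof. exact: leq_bigmax. Qed.

Definition shape d i : 'rV[R]_r := \row_l
  (inner_stat (fun e => (e == k l)%:R) (blocks i) - (d == k l)%:R +
   ((d.-1 + north_deg (blocks i))%N == k l)%:R).

Lemma counts_attach G (a : vertex G * vertex G) i : one_sink G -> a \in arcs G ->
  outdeg_counts R k (attach a (blocks i)) = outdeg_counts R k G + shape (outdeg a.1) i.
Proof.
move=> hG aG; apply/rowP => l; rewrite !mxE.
rewrite !num_outdeg_stat //; last exact: attach_one_sink.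
rewrite stat_attach //; ring.
Qed.

Lemma shape_large d e i : (K < d)%N -> (K < e)%N -> shape d i = shape e i.
Proof.
move=> dK eK; apply/rowP => l; rewrite !mxE.
have n0 := north_deg_gt0 (@blocks_sink i).
have h c : (K < c)%N -> (c == k l) = false /\ ((c.-1 + north_deg (blocks i))%N == k l) = false.
  move=> cK; have kc : (k l < c)%N := leq_ltn_trans (k_le l) cK.
  split; first by rewrite gtn_eqF.
  rewrite gtn_eqF // (leq_trans kc) //.
  by case: c kc {cK} => // c _ /=; rewrite -addn1 leq_add2l.
by have [-> ->] := h d dK; have [-> ->] := h e eK.
Qed.

(** The law of the increment of the counts, centred at its limiting mean. *)
Definition increments G : seq (R * 'rV[R]_r) :=
  [seq (x.1, outdeg_counts R k x.2 - outdeg_counts R k G - sigma *: psi) |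
    x <- successors chi rho blocks p G].

Lemma Ex_increments G H : Ex (increments G) H =
  Ex (successors chi rho blocks p G)
    (fun X => H (outdeg_counts R k X - outdeg_counts R k G - sigma *: psi)).
Proof. by rewrite /Ex /increments big_map. Qed.

Definition avg H d : R := \sum_(i < m) p i * H (shape d i - sigma *: psi).
Definition avg_limit H : R := avg H K.+1.
Definition slope H j : R := w (k j) * (avg H (k j) - avg_limit H).
Definition defect H : R := \sum_(1 <= d < K.+1) w d * `|avg H d - avg_limit H|.

Lemma avg_large H d : (K < d)%N -> avg H d = avg_limit H.
Proof.
by move=> dK; apply: eq_bigr => i _; rewrite (@shape_large d K.+1).
Qed.

Lemma defect_ge0 H : 0 <= defect H.
Proof.
rewrite /defect big_nat_cond sumr_ge0 // => d /andP[/andP[d0 _] _].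
by rewrite mulr_ge0 // ltW // w_gt0.
Qed.

Lemma Ex_increments_stat G H : one_sink G ->
  Ex (increments G) H = stat (fun d => w d * avg H d) G / stat w G.
Proof.
move=> hG; rewrite Ex_increments.
rewrite (@Ex_successors_deg _ _ _ _ _ _ chi_ge0 chi_rho_gt0 _ _
  (fun d i => H (shape d i - sigma *: psi))) //.
move=> a i aG; rewrite counts_attach //; congr (H (_ - _)).
by rewrite addrC addKr.
Qed.

(** A degree outside [k] is carried by at most one vertex. *)
Definition sparse G := one_sink G /\
  forall l, (0 < l <= K)%N -> l \notin codom k -> (num_outdeg G l <= 1)%N.

Let split_degrees (F : nat -> R) : \sum_(1 <= d < K.+1) F d =
  \sum_j F (k j) + \sum_(1 <= d < K.+1 | d \notin codom k) F d.
Proof.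
rewrite (bigID (fun d => d \in codom k)) /=; congr (_ + _).
rewrite -big_filter (perm_big (codom k)).
  by rewrite big_image.
apply: uniq_perm; first by rewrite filter_uniq // iota_uniq.
  by rewrite map_inj_uniq // enum_uniq.
move=> d; rewrite mem_filter andb_idr // => /codomP[j ->].
by rewrite mem_index_iota k_gt0 ltnS k_le.
Qed.

Definition fluctuation G := outdeg_counts R k G - stat w G *: psi.

Lemma increments_expand G H : sparse G ->
  `|Ex (increments G) H - (avg_limit H + \sum_j slope H j * psi 0 j) -
    (\sum_j slope H j * fluctuation G 0 j) / stat w G| <= defect H / stat w G.
Proof.
move=> [hG sp]; have W0 : 0 < stat w G by exact: total_gt0.
rewrite Ex_increments_stat //; set W := stat w G in W0 *.
pose F d := w d * (avg H d - avg_limit H) * (num_outdeg G d)%:R.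
have e : stat (fun d => w d * avg H d) G = W * avg_limit H + \sum_(1 <= d < K.+1) F d.
  rewrite -(@stat_finite_support _ (fun d => w d * (avg H d - avg_limit H)) K G) //.
    rewrite /W /stat mulr_suml -big_split; apply: eq_bigr => v _ /=; ring.
  by move=> d dK; rewrite avg_large // subrr mulr0.
rewrite e split_degrees.
have -> : \sum_j F (k j) = \sum_j slope H j * fluctuation G 0 j + W * \sum_j slope H j * psi 0 j.
  rewrite mulr_sumr -big_split; apply: eq_bigr => j _ /=.
  by rewrite /F /slope /fluctuation !mxE -/W; ring.
set X := \sum_(1 <= d < K.+1 | _) F d; set Y := \sum_j slope H j * psi 0 j.
set Z := \sum_j slope H j * fluctuation G 0 j.
have -> : (W * avg_limit H + (Z + W * Y + X)) / W - (avg_limit H + Y) - Z / W = X / W.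
  by field; rewrite gt_eqF.
rewrite normrM (@ger0_norm _ W^-1) ?invr_ge0 ?(ltW W0) // ler_wpM2r ?invr_ge0 ?(ltW W0) //.
rewrite (le_trans (ler_norm_sum _ _ _)) // /defect [leRHS](bigID (fun d => d \in codom k)) /=.
apply: ler_wpDl.
  rewrite big_nat_cond sumr_ge0 // => d /andP[/andP[d0 _] _].
  by rewrite mulr_ge0 // ltW // w_gt0.
rewrite big_nat_cond [leRHS]big_nat_cond; apply: ler_sum => d /andP[/andP[d0 dK] dk].
have wd : 0 < w d by exact: w_gt0.
rewrite /F !normrM (gtr0_norm wd) ler_piMr ?mulr_ge0 ?(ltW wd) //.
by rewrite normr_nat -[leRHS]/(1%:R) ler_nat sp // d0 -ltnS.
Qed.


Lemma increments_law G : one_sink G -> is_law (increments G).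
Proof.
move=> hG; have [s0 s1] : is_law (successors chi rho blocks p G) by exact: successors_law.
split=> [x /mapP[y yS ->] /=|]; first exact: s0.
by rewrite /increments big_map.
Qed.

Let coord (l : 'I_r) : 'rV[R]_r -> R := fun u => u 0 l.

Definition transfer (l j : 'I_r) : R :=
  \sum_i p i * ((k j + north_deg (blocks i))%N == (k l).+1)%:R.

Definition drift_mx : 'M[R]_r :=
  \matrix_(l, j) (w (k j) * ((l == j)%:R - transfer l j)).

Let shape_limit i l :
  shape K.+1 i 0 l = inner_stat (fun e => (e == k l)%:R) (blocks i).
Proof.
rewrite mxE gtn_eqF ?ltnS ?k_le // subr0 /= gtn_eqF ?addr0 // (leq_ltn_trans (k_le l)) //.
by rewrite -addn1 leq_add2l north_deg_gt0.
Qed.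

Lemma slope_coord l j : slope (coord l) j = - drift_mx l j.
Proof.
rewrite /slope mxE -mulrN; congr (_ * _).
transitivity (\sum_i p i * (((k j + north_deg (blocks i))%N == (k l).+1)%:R - (l == j)%:R)); last first.
  rewrite (eq_bigr (fun i => p i * ((k j + north_deg (blocks i))%N == (k l).+1)%:R - p i * (l == j)%:R)).
    by rewrite sumrB -mulr_suml p_sum1 mul1r opprB.
  by move=> i _; rewrite mulrBr.
rewrite /avg_limit /avg -sumrB; apply: eq_bigr => i _; rewrite -mulrBr; congr (_ * _).
rewrite /coord !mxE -/(shape K.+1 i 0 l) /=.
have := shape_limit i l; rewrite mxE /= => ->.
rewrite (inj_eq k_inj) [j == l]eq_sym.
have -> : ((k j).-1 + north_deg (blocks i) == k l)%N = (k j + north_deg (blocks i) == (k l).+1)%N.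
  by rewrite -eqSS -addSn prednK.
ring.
Qed.

Lemma f_inner_stat d : f blocks p d =
  \sum_i p i * inner_stat (fun e => (e == d)%:R) (blocks i).
Proof.
apply: eq_bigr => i _; congr (_ * _).
rewrite /inner_stat -natr_sum; congr (_%:R).
pose P (v : vertex (blocks i)) := [&& v != north _, v != south _ & outdeg v == d].
transitivity (\sum_v P v)%N.
  by rewrite cardsE -sum1_card big_mkcond; apply: eq_bigr => v _; rewrite unfold_in -[X in (if X then _ else _)]/(P v); case: (P v).
rewrite /vertex (@big_split_ord _ _ _ 2 (inner (blocks i))) /= !big_ord_recl big_ord0 /=.
rewrite !add0n; apply: eq_bigr => y _; exact: erefl.
Qed.

Hypothesis psi_eq : forall l, f blocks p (k l) + \sum_j w (k j) * transfer l j * psi 0 j =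
  (sigma + w (k l)) * psi 0 l.

Lemma mean_balance l : avg_limit (coord l) + \sum_j slope (coord l) j * psi 0 j = 0.
Proof.
have -> : avg_limit (coord l) = f blocks p (k l) - sigma * psi 0 l.
  have -> : sigma * psi 0 l = \sum_i p i * (sigma * psi 0 l) by rewrite -mulr_suml p_sum1 mul1r.
  rewrite f_inner_stat /avg_limit /avg -sumrB.
  apply: eq_bigr => i _; rewrite -mulrBr; congr (_ * _).
  by rewrite -shape_limit /coord !mxE.
have -> : \sum_j slope (coord l) j * psi 0 j =
    \sum_j w (k j) * transfer l j * psi 0 j - w (k l) * psi 0 l.
  rewrite (eq_bigr (fun j => w (k j) * transfer l j * psi 0 j - (l == j)%:R * (w (k j) * psi 0 j))); last first.
    by move=> j _; rewrite slope_coord mxE; ring.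
  rewrite sumrB; congr (_ - _); rewrite (bigD1 l) //= eqxx mul1r big1 ?addr0 // => j.
  by rewrite eq_sym => /negbTE ->; rewrite mul0r.
by have := psi_eq l; lra.
Qed.

Let transfer_ge0 l j : 0 <= transfer l j.
Proof. by rewrite sumr_ge0 // => i _; rewrite mulr_ge0 // ltW. Qed.

(* A latch of degree [k j] moves to at most one new degree. *)
Let transfer_col j : \sum_l transfer l j <= 1.
Proof.
rewrite exchange_big /= -[leRHS]p_sum1; apply: ler_sum => i _; rewrite -mulr_sumr ler_piMr // ?(ltW (p_gt0 _)) //.
case: (pickP (fun l => (k j + north_deg (blocks i))%N == (k l).+1)) => [l /eqP e|no].
  rewrite (bigD1 l) //= e eqxx big1 ?addr0 // => l' ll'.
  by rewrite eqSS (inj_eq k_inj) eq_sym (negbTE ll').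
by rewrite big1 // => l _; rewrite no.
Qed.

Lemma drift_off l j : l != j -> drift_mx l j <= 0.
Proof.
move=> /negbTE lj; rewrite mxE lj sub0r mulrN oppr_le0 mulr_ge0 // ltW // w_gt0 //.
Qed.

Lemma drift_diag j : 0 <= drift_mx j j.
Proof.
rewrite mxE eqxx mulr_ge0 ?(ltW (w_gt0 _ _ _)) // subr_ge0.
apply: le_trans (transfer_col j); rewrite (bigD1 j) //= lerDl sumr_ge0 //.
Qed.

Lemma drift_col j : 0 <= \sum_l drift_mx l j.
Proof.
rewrite (eq_bigr (fun l => w (k j) * ((l == j)%:R - transfer l j))); last by move=> l _; rewrite mxE.
rewrite -mulr_sumr mulr_ge0 ?(ltW (w_gt0 _ _ _)) // sumrB subr_ge0.
rewrite (le_trans (transfer_col j)) // (bigD1 j) //= eqxx lerDl sumr_ge0 //.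
Qed.

Let pair (i j : 'I_r) : 'rV[R]_r -> R := fun u => u 0 i * u 0 j.

Definition noise_mx : 'M[R]_r := \matrix_(i, j)
  (avg_limit (pair i j) + \sum_l slope (pair i j) l * psi 0 l).

Lemma noise_sym : noise_mx^T = noise_mx.
Proof.
apply/matrixP => i j; rewrite !mxE; have -> // : pair j i = pair i j.
by apply/funext => u; rewrite /pair mulrC.
Qed.

Let size_bound : R := 2 + \sum_i (inner (blocks i))%:R + \sum_l `|sigma * psi 0 l|.
Let error_bound : R := size_bound + \sum_l defect (coord l) +
  \sum_i \sum_j (defect (pair i j) + \sum_l `|slope (pair i j) l|).

Let size_bound_ge0 : 0 <= size_bound.
Proof. by apply: addr_ge0; [apply: addr_ge0 => //|]; exact: sumr_ge0. Qed.

Let defects_ge0 : 0 <= \sum_l defect (coord l).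
Proof. by rewrite sumr_ge0 // => l _; exact: defect_ge0. Qed.

Let pairs_ge0 : 0 <= \sum_i \sum_j (defect (pair i j) + \sum_l `|slope (pair i j) l|).
Proof.
by do 2 rewrite sumr_ge0 // => ? _; rewrite addr_ge0 ?defect_ge0 // sumr_ge0.
Qed.

Let error_bound_ge0 : 0 <= error_bound.
Proof. by apply: addr_ge0 => //; exact: addr_ge0. Qed.

Lemma increments_bounded G x l : one_sink G -> x \in increments G -> `|x.2 0 l| <= error_bound.
Proof.
move=> hG /mapP[y yS ->] /=; have [a [i [aG _ ->]]] := mem_successors yS.
apply: (@le_trans _ _ size_bound); last first.
  by rewrite /error_bound -addrA lerDl addr_ge0.
rewrite counts_attach // [outdeg_counts R k G + _]addrC addrK !mxE.
rewrite (le_trans (ler_normB _ _)) // lerD //; last first.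
  by rewrite (bigD1 l) //= lerDl sumr_ge0.
set I := inner_stat _ _; have I0 : 0 <= I by rewrite sumr_ge0.
have I1 : I <= \sum_i (inner (blocks i))%:R.
  apply: (@le_trans _ _ (inner (blocks i))%:R); last by rewrite (bigD1 i) //= lerDl sumr_ge0.
  rewrite /I /inner_stat -natr_sum ler_nat -[X in (_ <= X)%N]card_ord -sum1_card.
  by apply: leq_sum => z _; case: eqP.
have b01 (b : bool) : 0 <= (b%:R : R) <= 1 by case: b; rewrite ?ler01 ?lexx.
have /andP[a0 a1] := b01 (outdeg a.1 == k l).
have /andP[c0 c1] := b01 (((outdeg a.1).-1 + north_deg (blocks i))%N == k l).
by rewrite ler_norml; apply/andP; split; lra.
Qed.

Lemma increments_mean G l : sparse G ->
  `|Ex (increments G) (coord l) + (fluctuation G *m drift_mx^T) 0 l / stat w G| <=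
  error_bound / stat w G.
Proof.
move=> hG; have W0 : 0 < stat w G by apply: total_gt0 => //; case: hG.
have := increments_expand (coord l) hG; rewrite mean_balance subr0.
have -> : (\sum_j slope (coord l) j * fluctuation G 0 j) / stat w G =
   - ((fluctuation G *m drift_mx^T) 0 l / stat w G).
  rewrite -mulNr; congr (_ / _); rewrite [in RHS]mxE -sumrN; apply: eq_bigr => j _.
  by rewrite slope_coord [drift_mx^T _ _]mxE mulNr mulrC.
rewrite opprK => h; apply: (le_trans h); rewrite ler_wpM2r ?invr_ge0 ?(ltW W0) //.
apply: (@le_trans _ _ (\sum_l defect (coord l))).
  by rewrite (bigD1 l) //= lerDl sumr_ge0 // => j _; exact: defect_ge0.
have := size_bound_ge0; have := pairs_ge0; rewrite /error_bound.
set X := \sum_i _; set Y := \sum_l _ => X0 Z0; lra.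
Qed.

Lemma increments_square G i j : sparse G ->
  `|Ex (increments G) (pair i j) - noise_mx i j| <=
  error_bound * (1 + \sum_l `|fluctuation G 0 l|) / stat w G.
Proof.
move=> hG; have W0 : 0 < stat w G by apply: total_gt0 => //; case: hG.
have := increments_expand (pair i j) hG; rewrite mxE.
set e := Ex _ _ - _; set Z := \sum_l slope _ l * _; set S := \sum_l `|_| => h.
have S0 : 0 <= S by rewrite sumr_ge0.
pose T := \sum_l `|slope (pair i j) l|.
have T0 : 0 <= T by rewrite sumr_ge0.
have hZ : `|Z| <= T * S.
  rewrite (le_trans (ler_norm_sum _ _ _)) // mulr_suml; apply: ler_sum => l _.
  by rewrite normrM ler_wpM2l // /S (bigD1 l) //= lerDl sumr_ge0.
have D0 := defect_ge0 (pair i j).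
have eb : defect (pair i j) + T <= error_bound.
  rewrite /error_bound; apply: ler_wpDl; first by rewrite addr_ge0.
  have q0 (i' j' : 'I_r) : 0 <= defect (pair i' j') + \sum_l `|slope (pair i' j') l|.
    by rewrite addr_ge0 ?defect_ge0 // sumr_ge0.
  rewrite (bigD1 i) //= (bigD1 j) //= -addrA lerDl addr_ge0 ?sumr_ge0 // => ? _.
  by rewrite sumr_ge0.
have -> : e = (e - Z / stat w G) + Z / stat w G by rewrite subrK.
rewrite (le_trans (ler_normD _ _)) //.
apply: (@le_trans _ _ (defect (pair i j) / stat w G + T * S / stat w G)).
  by rewrite lerD // normrM (@ger0_norm _ _^-1) ?invr_ge0 ?(ltW W0) // ler_wpM2r ?invr_ge0 ?(ltW W0).
rewrite -mulrDl ler_wpM2r ?invr_ge0 ?(ltW W0) //.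
have := ler_wpM2r S0 eb; rewrite mulrDl => h2.
have := mulr_ge0 D0 S0; lra.
Qed.

Variable L : nat -> seq (R * network).
Hypothesis sigma_gt0 : 0 < sigma.
Hypothesis lawL : forall n, is_law (L n).
Hypothesis L_step : forall n h,
  Ex (L n.+1) h = Ex (L n) (fun G => Ex (successors chi rho blocks p G) h).
Let w0 := sigma + (chi + rho).
Hypothesis L_sparse : forall n x, x \in L n -> sparse x.2.
Hypothesis L_total : forall n x, x \in L n -> stat w x.2 = n%:R * sigma + w0.

Theorem outdeg_counts_clt : let U n G := outdeg_counts R k G - (n%:R * sigma + w0) *: psi in
  exists S : 'M[R]_r,
  [/\ S^T = S,
      forall a, 0 <= quad S a,
      forall a c,
        Ex (L n) (fun G => cos (dot a ((Num.sqrt n%:R)^-1 *: U n G) + c)) @[n --> \oo] -->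
        expR (- (quad S a / 2)) * cos c,
      forall theta, exists C N0, forall n i, (N0 <= n)%N ->
        Ex (L n) (fun G => expR (theta * ((Num.sqrt n%:R)^-1 * U n G 0 i))) <= C
    & forall i, (Num.sqrt n%:R)^-1 * Ex (L n) (fun G => U n G 0 i) @[n --> \oo] --> (0 : R)].
Proof.
move=> U.
have Ufl n x : x \in L n -> U n x.2 = fluctuation x.2.
  by move=> xL; rewrite /fluctuation (L_total xL).
have w00 : 0 < w0 by rewrite addr_gt0.
apply: (linear_drift_clt (J := fun _ => increments) (A := drift_mx) (Q := noise_mx)
  sigma_gt0 w00 error_bound_ge0) => //.
- by move=> n x /L_sparse[hG _]; exact: increments_law.
- move=> n h; rewrite L_step; apply: eq_Ex => x _; rewrite Ex_increments.
  apply: eq_Ex => y _; congr h; rewrite /U -natr1.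
  by apply/rowP => l; rewrite !mxE; ring.
- by move=> n x e i /L_sparse[hG _]; exact: increments_bounded.
- by move=> n x i xL; rewrite Ufl // -(L_total xL); apply: increments_mean; exact: L_sparse xL.
- move=> n x i j xL; rewrite /usum Ufl // -(L_total xL).
  by apply: increments_square; exact: L_sparse xL.
- exact: noise_sym.
- exact: drift_off.
- exact: drift_diag.
- exact: drift_col.
Qed.

End Counts.

(** * Random elements with finite support *)

Section FiniteSupport.
Context {R : realType} {d : measure_display} {T : measurableType d}.
Variables (P : probability T R) (V : countType) (Y : T -> V).
Hypothesis Y_meas : forall v, measurable [set t | Y t = v].

Lemma measurable_discrete (A : set V) : measurable [set t | A (Y t)].
Proof.
have -> : [set t | A (Y t)] = \bigcup_n
    (if unpickle n is Some v then (if `[< A v >] then [set t | Y t = v] else set0) else set0).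
  apply/seteqP; split=> t /=.
    move=> At; exists (pickle (Y t)) => //; rewrite pickleK.
    by case: asboolP.
  by case=> n _; case: (unpickle n) => // v; case: asboolP => // Av ->.
apply: bigcupT_measurable => n; case: (unpickle n) => // v.
by case: ifP.
Qed.

Lemma measurable_fun_discrete (h : V -> R) : measurable_fun setT (h \o Y).
Proof.
by move=> _ A _; rewrite setTI; exact: (measurable_discrete (h @^-1` A)).
Qed.

Lemma prob_mem_seq (s : seq V) : uniq s ->
  P [set t | Y t \in s] = (\sum_(v <- s) P [set t | Y t = v])%E.
Proof.
elim: s => [_|v s ih /= /andP[vs us]].
  by rewrite big_nil [X in P X](_ : _ = set0) ?measure0 //; apply/seteqP; split.
rewrite big_cons -ih // -measureU //.
- congr (P _); apply/seteqP; split=> t /=; rewrite in_cons.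
    by case/orP => [/eqP|]; [left|right].
  by case=> [->|->]; rewrite ?eqxx ?orbT.
- exact: (measurable_discrete (fun v => v \in s)).
- apply/seteqP; split=> t //= -[-> h]; by rewrite h in vs.
Qed.

Variable L : seq (R * V).
Hypothesis L_law : is_law L.
Hypothesis Y_law : forall v, P [set t | Y t = v] = (Ex L (fun x => (x == v)%:R))%:E.

Let support := undup (map snd L).

Let Ex_support h : Ex L h = \sum_(v <- support) h v * Ex L (fun x => (x == v)%:R).
Proof.
under [RHS]eq_bigr do rewrite -ExZ.
rewrite -Ex_sum; apply: eq_Ex => x xL.
have xs : x.2 \in support by rewrite mem_undup; apply/mapP; exists x.
rewrite (bigD1_seq x.2) ?undup_uniq //= eqxx mulr1 big1 ?addr0 // => v.
by rewrite eq_sym => /negbTE ->; rewrite mulr0.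
Qed.

Lemma prob_support : P [set t | Y t \in support] = 1%E.
Proof.
rewrite prob_mem_seq ?undup_uniq //.
under eq_bigr do rewrite Y_law.
rewrite sumEFin; congr (_%:E).
rewrite -[RHS](Ex_cst 1 L_law) (Ex_support (fun=> 1)).
by apply: eq_bigr => v _; rewrite mul1r.
Qed.

Lemma prob_off_support (A : set V) : (forall x, x \in L -> ~ A x.2) ->
  P [set t | A (Y t)] = 0%E.
Proof.
move=> LA; apply/eqP; rewrite eq_le measure_ge0 andbT.
have mS := measurable_discrete (fun v => v \in support).
have <- : P (~` [set t | Y t \in support]) = 0%E.
  by rewrite probability_setC // prob_support subee.
apply: le_measure; rewrite ?inE; [exact: measurable_discrete|exact: measurableC|].
move=> t At /=; rewrite /support mem_undup => /mapP[x xL e].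
by apply: (LA x xL); rewrite -e.
Qed.

Let integral_sum (s : seq V) (c : V -> R) :
  let F t := (\sum_(v <- s) c v * \1_[set t | Y t = v] t)%:E in
  P.-integrable setT F /\
  (\int[P]_t F t = \sum_(v <- s) (c v)%:E * P [set t | Y t = v])%E.
Proof.
elim: s => [|v s [ih1 ih2]] F.
  have -> : F = (fun=> 0%E) by apply/funext => t; rewrite /F big_nil.
  by rewrite big_nil integral0; split=> //; exact: integrable0.
have FE : F = (fun t => ((c v)%:E * (\1_[set t | Y t = v] t)%:E +
    (\sum_(v <- s) c v * \1_[set t | Y t = v] t)%:E)%E).
  by apply/funext => t; rewrite /F big_cons EFinD EFinM.
have i1 : P.-integrable setT (fun t => (\1_[set t | Y t = v] t)%:E).
  by apply: integrable_indic => //; rewrite ?ltey_eq ?fin_num_measure.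
have i2 : P.-integrable setT (fun t => ((c v)%:E * (\1_[set t | Y t = v] t)%:E)%E).
  exact: integrableZl.
rewrite FE; split; first exact: integrableD.
rewrite integralD // ih2 big_cons; congr (_ + _)%E.
by rewrite integralZl // integral_indic // setIT.
Qed.

(** The expectation of a function of [Y] is a finite sum. *)
Lemma expectation_finite (h : V -> R) : ('E_P[fun t => h (Y t)] = (Ex L h)%:E)%E.
Proof.
have [iF eF] := integral_sum support h.
rewrite expectation.unlock.
have -> : (\int[P]_t (h (Y t))%:E = \int[P]_t (\sum_(v <- support) h v * \1_[set t | Y t = v] t)%:E)%E.
  apply: ae_eq_integral => //.
  - by apply/measurable_EFinP; exact: measurable_fun_discrete.
  - exact: measurable_int iF.
  - exists [set t | ~ (Y t \in support)]; split.
    + exact: (measurable_discrete (fun v => ~ (v \in support))).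
    + by apply: (prob_off_support (A := fun v => ~ (v \in support))) => x xL; apply; rewrite mem_undup; apply/mapP; exists x.
    move=> t /= ht hs; apply: ht => _; congr (_%:E).
    rewrite (bigD1_seq (Y t)) ?undup_uniq //= indicE mem_set // mulr1 big1 ?addr0 // => v vY.
    by rewrite indicE memNset ?mulr0 //= => e; rewrite e eqxx in vY.
rewrite eF Ex_support -sumEFin; apply: eq_bigr => v _.
by rewrite Y_law -EFinM.
Qed.

End FiniteSupport.

(** * The law of the network after [n] steps *)

Section Chain.
Context {R : realType}.
Variables (chi rho : R) (m : nat) (blocks : 'I_m -> network) (p : 'I_m -> R).
Hypothesis chi_ge0 : 0 <= chi.
Hypothesis chi_rho_gt0 : 0 < chi + rho.
Hypothesis p_gt0 : forall i, 0 < p i.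
Hypothesis p_sum1 : \sum_(i < m) p i = 1.
Hypothesis blocks_sink : forall i, one_sink (blocks i).
Variable s : R.
Hypothesis s_const : forall i, excess chi rho (blocks i) = s.
Context {d : measure_display} {T : measurableType d}.
Variables (P : probability T R) (B : nat -> T -> network).
Hypothesis B_grown : grown chi rho blocks p P B.
Let w := w chi rho.
Let sigma := growth_rate rho s.
Let x0 : network := @Network 0 [::].

Definition history n t : seq network := mkseq (B^~ t) n.+1.

Let historyS n t : history n.+1 t = rcons (history n t) (B n.+1 t).
Proof. exact: mkseqS. Qed.

Lemma last_history n t : last x0 (history n t) = B n t.
Proof. by rewrite /history mkseqS last_rcons. Qed.

Lemma history_meas n l : measurable [set t | history n t = l].
Proof.
have [mB _ _] := B_grown.
elim: n l => [|n ih] l.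
  case: l => [|G [|G' l]]; try by rewrite (_ : [set _ | _] = set0) //; apply/seteqP; split.
  rewrite (_ : [set _ | _] = [set t | B 0%N t = G]) //.
  by apply/seteqP; split=> t; rewrite /history /=; [case|exact: (congr1 (fun G => [:: G]))].
case/lastP: l => [|l G].
  rewrite (_ : [set _ | _] = set0) //; apply/seteqP; split=> t //=.
rewrite (_ : [set _ | _] = [set t | history n t = l] `&` [set t | B n.+1 t = G]).
  exact: measurableI.
by apply/seteqP; split=> t /=; rewrite historyS; [move/rcons_inj=> []|case=> -> ->].
Qed.

Let history_event n l : size l = n.+1 ->
  [set t | history n t = l] = [set t | forall j, (j <= n)%N -> B j t = nth x0 l j].
Proof.
move=> sl; apply/seteqP; split=> t /= h.
  by move=> j jn; rewrite -h nth_mkseq.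
apply: (@eq_from_nth _ x0); rewrite size_mkseq // => j jn.
by rewrite nth_mkseq // h.
Qed.

Lemma prob_history_step n l G : size l = n.+1 ->
  P [set t | history n.+1 t = rcons l G] =
  (P [set t | history n t = l] * (step_prob chi rho blocks p (last x0 l) G)%:E)%E.
Proof.
move=> sl; have [_ _ hB] := B_grown.
rewrite history_event ?size_rcons ?sl // (hB n (nth x0 (rcons l G))).
have -> : nth x0 (rcons l G) n = last x0 l.
  by rewrite nth_rcons sl ltnSn -nth_last sl.
rewrite nth_rcons sl ltnn eqxx history_event //; congr (P _ * _)%E.
apply/seteqP; split=> t /= h j jn; have := h j jn; by rewrite nth_rcons sl ltnS jn.
Qed.

Let prob0 G : R := fine (P [set t | B 0%N t = G]).

Definition initial_law : seq (R * network) :=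
  [seq (prob0 G, G) | G <- undup (codom blocks) & 0 < prob0 G].

Let B0_meas G : measurable [set t | B 0%N t = G].
Proof. by have [mB _ _] := B_grown. Qed.

Let prob0E G : P [set t | B 0%N t = G] = (prob0 G)%:E.
Proof. by rewrite fineK // fin_num_measure. Qed.

Let prob0_ge0 G : 0 <= prob0 G.
Proof. by rewrite -lee_fin -prob0E. Qed.

Let Ex_initial h : Ex initial_law h = \sum_(G <- undup (codom blocks)) prob0 G * h G.
Proof.
rewrite /Ex /initial_law big_map big_filter big_mkcond; apply: eq_bigr => G _.
case: ifP => // /negbT; rewrite -leNgt => h0.
by rewrite (_ : prob0 G = 0) ?mul0r //; apply/eqP; rewrite eq_le h0 prob0_ge0.
Qed.

Let prob0_blocks : P [set t | B 0%N t \in undup (codom blocks)] = 1%E.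
Proof.
have [_ h _] := B_grown; rewrite -h; congr (P _).
by apply/seteqP; split=> t /=; rewrite mem_undup; [move/codomP|case=> i ->; exact: codom_f].
Qed.

Let prob0_sum : \sum_(G <- undup (codom blocks)) prob0 G = 1.
Proof.
have := prob0_blocks; rewrite (prob_mem_seq P B0_meas) ?undup_uniq //.
by under eq_bigr do rewrite prob0E; rewrite sumEFin => -[].
Qed.

Lemma initial_is_law : is_law initial_law.
Proof.
split=> [x /mapP[G _ ->] /=|]; first exact: prob0_ge0.
rewrite -prob0_sum -[RHS](eq_bigr _ (fun G _ => mulr1 (prob0 G))) -(Ex_initial (fun=> 1)).
by apply: eq_bigr => x _; rewrite mulr1.
Qed.

Lemma prob_initial G : P [set t | B 0%N t = G] = (Ex initial_law (fun X => (X == G)%:R))%:E.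
Proof.
rewrite prob0E Ex_initial; congr (_%:E).
have [Gb|Gb] := boolP (G \in undup (codom blocks)).
  rewrite (bigD1_seq G) ?undup_uniq //= eqxx mulr1 big1 ?addr0 // => X /negbTE ->.
  by rewrite mulr0.
rewrite big1_seq => [|X /andP[_ XG]]; last first.
  by case: eqP => [e|_]; [rewrite -e XG in Gb|rewrite mulr0].
have u : uniq (G :: undup (codom blocks)) by rewrite /= Gb undup_uniq.
have := prob_mem_seq P B0_meas u; rewrite big_cons -(prob_mem_seq P B0_meas) ?undup_uniq //.
rewrite prob0_blocks prob0E => e.
have : (P [set t | B 0%N t \in G :: undup (codom blocks)] <= 1)%E.
  by apply: probability_le1; exact: (measurable_discrete B0_meas (fun v => v \in _ :: _)).
rewrite e -EFinD lee_fin => h.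
by apply/eqP; rewrite eq_le prob0_ge0 andbT; lra.
Qed.

Fixpoint history_law n : seq (R * seq network) :=
  if n is n'.+1 then
    [seq (x.1 * y.1, rcons x.2 y.2) | x <- history_law n',
       y <- successors chi rho blocks p (last x0 x.2)]
  else [seq (x.1, [:: x.2]) | x <- initial_law].

Lemma Ex_history0 h : Ex (history_law 0) h = Ex initial_law (fun G => h [:: G]).
Proof. by rewrite /Ex /= big_map. Qed.

Lemma Ex_historyS n h : Ex (history_law n.+1) h =
  Ex (history_law n) (fun l => Ex (successors chi rho blocks p (last x0 l)) (fun G => h (rcons l G))).
Proof.
rewrite /Ex /= big_allpairs_dep; apply: eq_bigr => x _.
by rewrite mulr_sumr; apply: eq_bigr => y _; rewrite mulrA.
Qed.

Lemma history_law_mem n x : x \in history_law n ->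
  [/\ 0 < x.1, size x.2 = n.+1, one_sink (last x0 x.2) &
    stat w (last x0 x.2) = n%:R * sigma + (sigma + (chi + rho))].
Proof.
elim: n x => [|n ih] x /=.
  case/mapP => y /mapP[G]; rewrite mem_filter mem_undup => /andP[pG /codomP[i Gi]] -> -> /=.
  by split=> //; rewrite Gi // mul0r add0r; exact: total_block.
case/allpairsPdep => -[q l] [y [/ih[/= q0 sl hl tl] yS ->]] /=; split.
- by rewrite mulr_gt0 // (successors_gt0 _ _ _ _ yS).
- by rewrite size_rcons sl.
- by rewrite last_rcons; exact: successors_sink yS.
- rewrite last_rcons (@total_successors _ _ _ _ _ _ blocks_sink _ s_const _ _ hl yS) tl.
  by rewrite -natr1 /sigma; ring.
Qed.

Lemma history_law_is_law n : is_law (history_law n).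
Proof.
split=> [x /history_law_mem[/ltW]//|].
have -> : \sum_(x <- history_law n) x.1 = Ex (history_law n) (fun=> 1).
  by apply: eq_bigr => x _; rewrite mulr1.
elim: n => [|n ih]; first by rewrite Ex_history0 Ex_cst //; exact: initial_is_law.
rewrite Ex_historyS -[RHS]ih; apply: eq_Ex => x /history_law_mem[_ _ hl _].
by rewrite Ex_cst //; exact: successors_law.
Qed.

Lemma prob_history n l :
  P [set t | history n t = l] = (Ex (history_law n) (fun x => (x == l)%:R))%:E.
Proof.
have size_law n' l' : size l' != n'.+1 -> P [set t | history n' t = l'] = 0%E.
  move=> sl; rewrite [X in P X](_ : _ = set0) ?measure0 //.
  by apply/seteqP; split=> t //= e; move: sl; rewrite -e size_mkseq eqxx.
have [sl|sl] := eqVneq (size l) n.+1; last first.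
  rewrite size_law // (@eq_Ex _ _ _ _ (fun=> 0)) => [|x /history_law_mem[_ sx _ _]].
    by rewrite Ex_cst //; exact: history_law_is_law.
  by case: eqP => // e; rewrite -e sx eqxx in sl.
elim: n l sl => [|n ih] l sl.
  case: l sl => [|G [|]] // _; rewrite Ex_history0.
  rewrite (@eq_Ex _ _ _ _ (fun X => (X == G)%:R)); last first.
    by move=> x _; rewrite eqseq_cons eqxx andbT.
  rewrite -prob_initial; congr (P _).
  by apply/seteqP; split=> t; rewrite /history /=; [case|exact: (congr1 (fun G => [:: G]))].
case/lastP: l sl => // l G; rewrite size_rcons => -[sl].
rewrite prob_history_step // ih // Ex_historyS -EFinM; congr (_%:E).
rewrite mulrC -ExZ; apply: eq_Ex => x /history_law_mem[_ _ hl _].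
case: eqP => [e|ne].
  rewrite mulr1 e step_prob_successors //; last by rewrite -e.
  by apply: eq_Ex => y _; rewrite eqseq_rcons eqxx.
rewrite mulr0 (@eq_Ex _ _ _ _ (fun=> 0)) => [|y _].
  by rewrite Ex_cst //; exact: successors_law.
by rewrite eqseq_rcons; case: eqP.
Qed.

(** The law of [B n]. *)
Definition network_law n : seq (R * network) :=
  [seq (x.1, last x0 x.2) | x <- history_law n].

Lemma Ex_network n h : Ex (network_law n) h = Ex (history_law n) (fun l => h (last x0 l)).
Proof. by rewrite /Ex big_map. Qed.

Lemma network_law_is_law n : is_law (network_law n).
Proof.
have [h0 h1] := history_law_is_law n.
by split=> [x /mapP[y yL ->]|]; [exact: h0|rewrite big_map].
Qed.

Lemma network_lawS n h : Ex (network_law n.+1) h =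
  Ex (network_law n) (fun G => Ex (successors chi rho blocks p G) h).
Proof.
rewrite !Ex_network Ex_historyS; apply: eq_Ex => x _; apply: eq_Ex => y _.
by rewrite last_rcons.
Qed.

Lemma network_law_sink n x : x \in network_law n -> one_sink x.2.
Proof. by case/mapP => y /history_law_mem[_ _ h _] ->. Qed.

Lemma network_law_total n x : x \in network_law n ->
  stat w x.2 = n%:R * sigma + (sigma + (chi + rho)).
Proof. by case/mapP => y /history_law_mem[_ _ _ h] ->. Qed.

Lemma expectation_network n (h : network -> R) :
  ('E_P[fun t => h (B n t)] = (Ex (network_law n) h)%:E)%E.
Proof.
rewrite Ex_network -(expectation_finite (@history_meas n) (history_law_is_law n) (prob_history n)
  (fun l => h (last x0 l))).
by congr expectation; apply/funext => t; rewrite last_history.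
Qed.

Let event_meas (A : nat -> set network) : measurable [set t | exists n, A n (B n t)].
Proof.
rewrite (_ : [set t | _] = \bigcup_n [set t | A n (B n t)]).
  apply: bigcupT_measurable => n.
  by apply: measurable_discrete; have [mB _ _] := B_grown.
by apply/seteqP; split=> t [n h]; exists n.
Qed.

Lemma network_law_essential n x l : x \in network_law n -> (0 < l)%N ->
  (2 <= num_outdeg x.2 l)%N -> essential P B l.
Proof.
move=> /mapP[y yL ->] /= l0 h2; split=> //.
have [y0 _ _ _] := history_law_mem yL.
apply: (@lt_le_trans _ _ (P [set t | history n t = y.2])).
  rewrite prob_history lte_fin (lt_le_trans y0) //.
  rewrite /Ex (big_rem _ yL) /= eqxx mulr1 lerDl big_seq sumr_ge0 // => z /mem_rem zL.
  by have [/ltW z0 _ _ _] := history_law_mem zL; rewrite mulr_ge0.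
apply: le_measure; rewrite ?inE; [exact: history_meas|exact: (event_meas (fun _ G => (2 <= num_outdeg G l)%N))|].
by move=> t /= e; exists n; rewrite -last_history e.
Qed.

(** If the total weight did not grow, the networks would only have their two
    poles, and no out-degree could be essential. *)
Lemma essential_growth l : essential P B l -> 0 < sigma.
Proof.
move=> [l0 Pl]; rewrite lt_def (growth_rate_ge0 chi_ge0 chi_rho_gt0 p_sum1 blocks_sink s_const) andbT; apply/eqP => e.
have b0 := growth_rate0 chi_ge0 chi_rho_gt0 blocks_sink s_const e.
have L0 n x : x \in network_law n -> inner x.2 = 0%N.
  move=> /mapP[y yL ->] /=; elim: n y yL => [|n ih] y /=.
    by case/mapP => z /mapP[G]; rewrite mem_filter mem_undup => /andP[_ /codomP[i Gi]] -> -> /=; rewrite Gi b0.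
  case/allpairsPdep => z [u [zL uS ->]] /=; rewrite last_rcons.
  have [a [i [_ _ ->]]] := mem_successors uS.
  by rewrite /= (ih z zL) b0.
have Bm n : forall v, measurable [set t | B n t = v] by have [mB _ _] := B_grown.
have z n : P [set t | (2 <= num_outdeg (B n t) l)%N] = 0%E.
  have -> : [set t | (2 <= num_outdeg (B n t) l)%N] =
    [set t | [set h | (2 <= num_outdeg (last x0 h) l)%N] (history n t)].
    by apply/funext => t; rewrite /mkset last_history.
  apply: (prob_off_support (@history_meas n) (history_law_is_law n) (prob_history n)) => x xL /=.
  have xN : (x.1, last x0 x.2) \in network_law n by apply/mapP; exists x.
  have := network_law_sink xN; have := L0 _ _ xN => /=; set G := last x0 x.2.
  move=> G0 hG; apply/negP; rewrite -ltnNge ltnS /num_outdeg.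
  have -> : 1%N = #|[set~ south G]%SET| by rewrite cardsC1 card_ord G0.
  apply: subset_leq_card; apply/fintype.subsetP => v; rewrite !inE -(outdeg_gt0 v hG) => /eqP ->.
  exact: l0.
suff : P [set t | exists n, (2 <= num_outdeg (B n t) l)%N] = 0%E by move=> z0; rewrite z0 ltxx in Pl.
apply/eqP; rewrite eq_le measure_ge0 andbT.
rewrite (_ : [set t | _] = \bigcup_n [set t | (2 <= num_outdeg (B n t) l)%N]); last first.
  by apply/seteqP; split=> t => [[n h]|[n _ h]]; exists n.
have mE n : measurable [set t | (2 <= num_outdeg (B n t) l)%N].
  exact: (measurable_discrete (Bm n) (fun G => (2 <= num_outdeg G l)%N)).
have mU : measurable (\bigcup_n [set t | (2 <= num_outdeg (B n t) l)%N]) by exact: bigcupT_measurable.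
have := measure_sigma_subadditive P mE mU (@subset_refl _ _).
by rewrite [X in (_ <= X)%E -> _]eseries0 // => n _ _; exact: z.
Qed.

End Chain.

(** * From the chain to the limit theorem *)

Section Rates.
Context {R : realType}.
Variables (chi rho : R) (m : nat) (blocks : 'I_m -> network) (p : 'I_m -> R).
Hypothesis chi_ge0 : 0 <= chi.
Hypothesis chi_rho_gt0 : 0 < chi + rho.
Hypothesis p_gt0 : forall i, 0 < p i.
Hypothesis p_sum1 : \sum_(i < m) p i = 1.
Hypothesis blocks_sink : forall i, one_sink (blocks i).
Variable s : R.
Hypothesis s_const : forall i, excess chi rho (blocks i) = s.
Let w := w chi rho.
Let sigma := growth_rate rho s.

Let sum_pick (F : nat -> R) n d : (d < n)%N -> (0 < d)%N || (F 0%N == 0) ->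
  \sum_(1 <= e < n) F e * (d == e)%:R = F d.
Proof.
move=> dn; have [->|d0] := posnP d => /= h.
  rewrite (eqP h) big1_seq // => e; rewrite mem_index_iota => /andP[_ /andP[e0 _]].
  by rewrite ltn_eqF // mulr0.
rewrite (bigD1_seq d) ?iota_uniq ?mem_index_iota ?d0 //= eqxx mulr1 big1 ?addr0 // => e.
by rewrite eq_sym => /negbTE ->; rewrite mulr0.
Qed.

Lemma g_sum d : g blocks p d = \sum_i p i * (north_deg (blocks i) == d.+1)%:R.
Proof.
rewrite /g big_mkcond; apply: eq_bigr => i _; rewrite -/(north_deg (blocks i)).
by case: eqP; rewrite ?mulr1 ?mulr0.
Qed.

Let size_bound : nat := (\max_i size (arcs (blocks i))).+2.

Let outdeg_small i (v : vertex (blocks i)) n : (size_bound <= n)%N -> (outdeg v < n)%N.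
Proof.
move=> hn; apply: leq_trans hn; rewrite /size_bound ltnS leqW //.
by apply: leq_trans (leq_bigmax i); exact: count_size.
Qed.

Lemma lambda1E : lambda1 chi rho blocks p = sigma.
Proof.
apply/cvg_lim => //.
apply: (cvg_trans (G := (fun=> sigma) @ \oo)); last exact: cvg_cst.
apply: near_eq_cvg; near=> n.
have hn : (size_bound <= n)%N by near: n; exact: nbhs_infty_ge.
rewrite big_split /=.
have -> : \sum_(1 <= i < n) w i * f blocks p i = \sum_i p i * inner_stat w (blocks i).
  rewrite (eq_bigr (fun e => \sum_i p i * (w e * inner_stat (fun d => (d == e)%:R) (blocks i)))); last first.
    by move=> e _; rewrite f_inner_stat mulr_sumr; apply: eq_bigr => i _; ring.
  rewrite exchange_big; apply: eq_bigr => i _ /=; rewrite -mulr_sumr; congr (_ * _).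
  rewrite (eq_bigr (fun e => \sum_y w e * (outdeg (@inner_vertex (blocks i) y) == e)%:R)); last first.
    by move=> e _; rewrite /inner_stat mulr_sumr.
  rewrite exchange_big; apply: eq_bigr => y _ /=.
  by rewrite sum_pick ?outdeg_small // inner_vertex_gt0.
have -> : \sum_(1 <= i < n) chi * i%:R * g blocks p i =
    \sum_i p i * (chi * ((north_deg (blocks i))%:R - 1)).
  rewrite (eq_bigr (fun e => \sum_i p i * (chi * e%:R * ((north_deg (blocks i)).-1 == e)%:R))); last first.
    move=> e _; rewrite g_sum mulr_sumr; apply: eq_bigr => i _.
    by rewrite -[in LHS](prednK (north_deg_gt0 (@blocks_sink i))) eqSS; ring.
  rewrite exchange_big; apply: eq_bigr => i _ /=; rewrite -mulr_sumr; congr (_ * _).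
  have h : ((north_deg (blocks i)).-1 < n)%N.
    by apply: leq_ltn_trans (leq_pred _) _; exact: outdeg_small.
  rewrite (sum_pick (F := fun e => chi * e%:R)) //; last by rewrite mulr0 eqxx orbT.
  by rewrite -[in RHS](prednK (north_deg_gt0 (@blocks_sink i))) -natr1 addrK.
rewrite -big_split /= (eq_bigr (fun i => p i * sigma)) => [|i _].
  by rewrite -mulr_suml p_sum1 mul1r.
by rewrite -mulrDr (inner_weight blocks_sink s_const).
Unshelve. all: by end_near. Qed.

Variables (r : nat) (k : 'I_r -> nat) (psi : 'rV[R]_r).
Hypothesis k_gt0 : forall j, (0 < k j)%N.
Hypothesis k_incr : forall i j : 'I_r, (i < j)%N -> (k i < k j)%N.
Hypothesis sigma_gt0 : 0 < sigma.

Let transferE l j : transfer blocks p k l j = if (j <= l)%N then g blocks p (k l - k j)%N else 0.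
Proof.
case: ifP => jl.
  have kk : (k j <= k l)%N.
    by move: jl; rewrite leq_eqVlt => /orP[/eqP/val_inj -> //|/k_incr/ltnW].
  rewrite g_sum; apply: eq_bigr => i _; congr (_ * (_ : bool)%:R).
  by rewrite -subSn // -{1}(subnKC (leqW kk)) eqn_add2l.
have kk : (k l < k j)%N by apply: k_incr; rewrite ltnNge jl.
rewrite /transfer big1 // => i _; rewrite gtn_eqF ?mulr0 //.
by rewrite -addn1 leq_add // north_deg_gt0.
Qed.

Let g0_le1 : g blocks p 0 <= 1.
Proof.
rewrite g_sum -[leRHS]p_sum1; apply: ler_sum => i _; rewrite ler_piMr ?(ltW (p_gt0 _)) //.
by case: eqP.
Qed.

Lemma psi_balance : (forall i : 'I_r, psi 0 i =
     (lambda1 chi rho blocks p + w (k i) * (1 - g blocks p 0))^-1 *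
     (f blocks p (k i) +
      \sum_(j < r | (j < i)%N) w (k j) * g blocks p (k i - k j)%N * psi 0 j)) ->
  forall l, f blocks p (k l) + \sum_j w (k j) * transfer blocks p k l j * psi 0 j =
  (sigma + w (k l)) * psi 0 l.
Proof.
move=> hpsi l; have := hpsi l; rewrite lambda1E.
set D := sigma + _; set S := \sum_(j < r | _) _ => e.
have D0 : 0 < D.
  by rewrite ltr_wpDr // mulr_ge0 ?subr_ge0 // ltW // w_gt0.
have -> : \sum_j w (k j) * transfer blocks p k l j * psi 0 j = S + w (k l) * g blocks p 0 * psi 0 l.
  rewrite (bigID (fun j : 'I_r => (j < l)%N)) /=; congr (_ + _).
    by apply: eq_bigr => j jl; rewrite transferE (ltnW jl).
  rewrite (bigD1 l) ?ltnn //= transferE leqnn subnn big1 ?addr0 // => j /andP[jl nl].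
  have lj : (l < j)%N by rewrite ltn_neqAle eq_sym nl leqNgt jl.
  by rewrite transferE leqNgt lj /= mulr0 mul0r.
have e' : D * psi 0 l = f blocks p (k l) + S by rewrite e mulrA divff ?mul1r // gt_eqF.
by rewrite addrA -e' /D; ring.
Qed.

End Rates.

Section Shift.
Context {R : realType} {r : nat}.

Lemma cvg_row0 (e : nat -> 'rV[R]_r) : (forall i, e n 0 i @[n --> \oo] --> (0 : R)) ->
  e n @[n --> \oo] --> (0 : 'rV[R]_r).
Proof.
move=> h; apply/cvgrPdist_le => eps eps0.
have : \forall n \near \oo, forall i, `|e n 0 i| <= eps.
  apply: (@filter_forall _ _ _ \oo _) => i.
  have [N _ hN] := (@cvgrPdist_le _ _ _ _ _ _ _).1 (h i) _ eps0.
  by exists N => // n /hN /=; rewrite sub0r normrN.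
case=> N _ hN; exists N => // n /hN /= hn.
rewrite sub0r normrN [leLHS](_ : _ = mx_norm (e n)) // mx_normrE (bigmax_le _ (ltW eps0)) //= => -[i j] _.
by rewrite ord1.
Qed.

Variables (V : eqType) (L : nat -> seq (R * V)) (X : nat -> V -> 'rV[R]_r).
Variable (S : 'M[R]_r).
Hypothesis lawL : forall n, is_law (L n).
Hypothesis L_char : forall a c,
  Ex (L n) (fun G => cos (dot a (X n G) + c)) @[n --> \oo] -->
  expR (- (quad S a / 2)) * cos c.
Hypothesis L_exp : forall theta, exists C N0, forall n i, (N0 <= n)%N ->
  Ex (L n) (fun G => expR (theta * X n G 0 i)) <= C.
Variables (mu : probability (r.-tuple R) R).
Hypothesis mu_normal : is_multinormal S mu.
Context {d : measure_display} {T : measurableType d}.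
Variables (P : probability T R) (B : nat -> T -> V).
Hypothesis B_law : forall n (h : V -> R), ('E_P[fun t => h (B n t)] = (Ex (L n) h)%:E)%E.

(** Deterministic translations which tend to 0 do not change the limit. *)
Lemma shifted_cvg (e : nat -> 'rV[R]_r) : e n @[n --> \oo] --> (0 : 'rV[R]_r) ->
  let Z n t := X n (B n t) + e n in
  cvg_in_distribution P Z mu /\ cvg_all_moments P Z mu.
Proof.
move=> he Z.
pose L' n := [seq (x.1, X n x.2 + e n) | x <- L n].
have ExL' n h : Ex (L' n) h = Ex (L n) (fun G => h (X n G + e n)).
  by rewrite /Ex big_map.
have small eps : 0 < eps -> exists N, forall n, (N <= n)%N -> `|e n| <= eps.
  move=> eps0; have := (@cvgrPdist_le _ _ _ _ _ _ _).1 he _ eps0.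
  by case=> N _ hN; exists N => n /hN /=; rewrite sub0r normrN.
apply: (@char_determines _ _ S mu _ L') => //.
- by move=> a c; exact: multinormal_char.
- move=> n; have [l0 l1] := lawL n; split=> [x /mapP[y yL ->]|]; first exact: l0.
  by rewrite big_map.
- move=> a c; pose b := \sum_i `|a 0 i|.
  have b0 : 0 <= b by rewrite sumr_ge0.
  have diff n : `|Ex (L' n) (fun x => cos (dot a x + c)) -
      Ex (L n) (fun G => cos (dot a (X n G) + c))| <= 2 * (b * `|e n|).
    rewrite ExL' -ExB; apply: Ex_norm_le => // x _.
    rewrite dotDr addrAC (le_trans (cos_lipschitz _ _)) // ler_wpM2l //.
    rewrite dotE (le_trans (ler_norm_sum _ _ _)) // mulr_suml; apply: ler_sum => i _.
    by rewrite normrM ler_wpM2l // norm_coord_le.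
  apply/cvgrPdist_le => eps eps0.
  have eps2 : 0 < eps / 2 by rewrite divr_gt0.
  have [N1 hN1] : exists N, forall n, (N <= n)%N ->
      `|expR (- (quad S a / 2)) * cos c - Ex (L n) (fun G => cos (dot a (X n G) + c))| <= eps / 2.
    have := (@cvgrPdist_le _ _ _ _ _ _ _).1 (@L_char a c) _ eps2.
    by case=> N _ hN; exists N => n /hN.
  have [N2 hN2] : exists N, forall n, (N <= n)%N -> `|e n| <= eps / (4 * (b + 1)).
    by apply: small; rewrite divr_gt0 // mulr_gt0 // ltr_wpDl.
  near=> n; have n1 : (N1 <= n)%N by near: n; exact: nbhs_infty_ge.
  have n2 : (N2 <= n)%N by near: n; exact: nbhs_infty_ge.
  have h1 := hN2 n n2; have h2 := diff n; have h3 := hN1 n n1.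
  rewrite -(subrK (Ex (L n) (fun G => cos (dot a (X n G) + c))) (_ * cos c)) -addrA.
  rewrite [X in `|_ + X|](_ : _ = - (Ex (L' n) (fun x => cos (dot a x + c)) -
    Ex (L n) (fun G => cos (dot a (X n G) + c)))); last by rewrite opprB.
  rewrite (le_trans (ler_normD _ _)) //.
  have h4 : 2 * (b * `|e n|) <= eps / 2.
    apply: (@le_trans _ _ (2 * ((b + 1) * (eps / (4 * (b + 1)))))).
      by rewrite ler_wpM2l // ler_pM // lerDl.
    have b1 : b + 1 != 0 by rewrite gt_eqF // ltr_wpDl.
    by rewrite le_eqVlt; apply/orP; left; apply/eqP; field.
  rewrite normrN; lra.
- move=> theta i; have [C [N0 hC]] := L_exp theta.
  have [N hN] := small 1 ltr01.
  exists (expR `|theta| * C), (N0 + N)%N => n hn; rewrite ExL'.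
  rewrite (@eq_Ex _ _ _ _ (fun G => expR (theta * e n 0 i) * expR (theta * X n G 0 i))); last first.
    by move=> x _; rewrite mxE mulrDr addrC expRD.
  have n0 : (N0 <= n)%N := leq_trans (leq_addr _ _) hn.
  have nN : (N <= n)%N := leq_trans (leq_addl _ _) hn.
  rewrite ExZ ler_pM ?expR_ge0 ?hC //.
    by apply: Ex_ge0 => // x _; exact: expR_ge0.
  rewrite ler_expR (le_trans (ler_norm _)) // normrM ler_piMr //.
  by rewrite (le_trans (norm_coord_le _ _)) // hN.
- by move=> n h; rewrite ExL' -B_law.
Unshelve. all: by end_near. Qed.

End Shift.

Section Sparsity.
Context {R : realType}.
Variables (chi rho : R) (m : nat) (blocks : 'I_m -> network) (p : 'I_m -> R).
Hypothesis chi_ge0 : 0 <= chi.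
Hypothesis chi_rho_gt0 : 0 < chi + rho.
Hypothesis p_gt0 : forall i, 0 < p i.
Hypothesis p_sum1 : \sum_(i < m) p i = 1.
Hypothesis blocks_sink : forall i, one_sink (blocks i).
Variable s : R.
Hypothesis s_const : forall i, excess chi rho (blocks i) = s.
Context {d : measure_display} {T : measurableType d}.
Variables (P : probability T R) (B : nat -> T -> network).
Hypothesis B_grown : grown chi rho blocks p P B.
Variables (r : nat) (k : 'I_r -> nat).
Hypothesis k_first : first_elements (essential P B) k.

Lemma network_law_sparse n x : x \in network_law chi rho blocks p P B n ->
  sparse k x.2.
Proof.
move=> xL; split=> [|l /andP[l0 lK] lk]; first exact: (network_law_sink chi_ge0 chi_rho_gt0 p_gt0 blocks_sink s_const xL).
rewrite leqNgt; apply/negP => h.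
have [_ _ hk] := k_first.
have el := network_law_essential chi_ge0 chi_rho_gt0 p_gt0 p_sum1 blocks_sink s_const B_grown xL l0 h.
have aux r' (k' : 'I_r' -> nat) : (l <= max_degree k')%N -> exists j, (l <= k' j)%N.
  case: r' k' => [|r'] k' lK'; first by move: lK'; rewrite /max_degree big_ord0 leqNgt l0.
  have [|j kj] := @bigop.eq_bigmax _ k'; first by rewrite card_ord.
  by exists j; rewrite -kj.
have [j lj] := aux _ k lK.
by have [j' e] := hk l j el lj; case/codomP: lk; exists j'.
Qed.

End Sparsity.

Section Final.
Context {R : realType}.

Lemma cvg_invsqrt (x : R) : (Num.sqrt n%:R)^-1 * x @[n --> \oo] --> (0 : R).
Proof.
apply: (@cvg_root4 _ _ _ `|x| 1) => n n1; rewrite subr0 normrM mulrC ler_wpM2l //.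
have t1 := @root4_ge1 R n n1; have t0 : 0 < root4 n :> R by lra.
rewrite -sqr_root4 ger0_norm ?invr_ge0 ?sqr_ge0 // lef_pV2 ?posrE ?exprn_gt0 //.
by rewrite expr2 ler_peMl // ltW.
Qed.

End Final.

Unset Implicit Arguments.

Theorem corollary1p9 (R : realType) (chi rho : R)
  (chi_ge0 : 0 <= chi) (chi_rho_gt0 : 0 < chi + rho)
  (m : nat) (blocks : 'I_m -> network) (p : 'I_m -> R)
  (blocks_bipolar : forall i, bipolar (blocks i))
  (p_gt0 : forall i, 0 < p i) (p_sum1 : \sum_(i < m) p i = 1)
  (d : measure_display) (T : measurableType d) (P : probability T R)
  (B : nat -> T -> network) (B_grown : grown chi rho blocks p P B)
  (r : nat) (r_gt0 : (0 < r)%N) (k : 'I_r -> nat)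
  (k_first : first_elements (essential P B) k)
  (psi : 'rV[R]_r)
  (psi_def : forall i : 'I_r,
     psi 0 i =
     (lambda1 chi rho blocks p +
      w chi rho (k i) * (1 - g blocks p 0))^-1 *
     (f blocks p (k i) +
      \sum_(j < r | (j < i)%N)
        w chi rho (k j) * g blocks p (k i - k j)%N * psi 0 j))
  (s : R) (s_const : forall i, excess chi rho (blocks i) = s) :
  let lambda1 := lambda1 chi rho blocks p in
  let Y := fun (n : nat) (t : T) => outdeg_counts R k (B n t) in
  let EY := fun n : nat => mean_vector P (Y n) in
  let scale := fun n : nat => (Num.sqrt (n%:R : R))^-1 in
  exists (Sigma : 'M[R]_r) (mu : probability (r.-tuple R) R),
  is_multinormal Sigma mu /\
  (let Z := fun n t => scale n *: (Y n t - (n%:R * lambda1) *: psi) in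
   cvg_in_distribution P Z mu /\ cvg_all_moments P Z mu) /\
  scale n *: (EY n - (n%:R * lambda1) *: psi) @[n --> \oo] --> (0 : 'rV[R]_r) /\
  (let Z' := fun n t => scale n *: (Y n t - EY n) in
   cvg_in_distribution P Z' mu /\ cvg_all_moments P Z' mu).
Proof.
have blocks_sink i : one_sink (blocks i) by have [_ _ h] := blocks_bipolar i.
have [k_incr k_ess k_least] := k_first.
have k_gt0 j : (0 < k j)%N by have [] := k_ess j.
pose sigma := growth_rate rho s.
have sigma_gt0 : 0 < sigma.
  exact: (essential_growth chi_ge0 chi_rho_gt0 p_gt0 p_sum1 blocks_sink s_const B_grown (k_ess (Ordinal r_gt0))).
move=> lambda1 Y EY scale.
have lE : lambda1 = sigma by exact: (lambda1E p_sum1 blocks_sink s_const).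
have balance := psi_balance chi_ge0 chi_rho_gt0 p_gt0 p_sum1 blocks_sink s_const k_gt0 k_incr sigma_gt0 psi_def.
pose L := network_law chi rho blocks p P B.
have lawL n : is_law (L n) by exact: (network_law_is_law chi_ge0 chi_rho_gt0 p_gt0 p_sum1 blocks_sink s_const B_grown).
have B_law n (h : network -> R) : ('E_P[fun t => h (B n t)] = (Ex (L n) h)%:E)%E.
  exact: (expectation_network chi_ge0 chi_rho_gt0 p_gt0 p_sum1 blocks_sink s_const B_grown).
pose w0 := sigma + (chi + rho).
pose U n G := outdeg_counts R k G - (n%:R * sigma + w0) *: psi.
have [S [S_sym S_psd S_char S_exp S_mean]] : exists S : 'M[R]_r,
  [/\ S^T = S,
      forall a, 0 <= quad S a,
      forall a c,
        Ex (L n) (fun G => cos (dot a ((Num.sqrt n%:R)^-1 *: U n G) + c)) @[n --> \oo] -->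
        expR (- (quad S a / 2)) * cos c,
      forall theta, exists C N0, forall n i, (N0 <= n)%N ->
        Ex (L n) (fun G => expR (theta * ((Num.sqrt n%:R)^-1 * U n G 0 i))) <= C
    & forall i, (Num.sqrt n%:R)^-1 * Ex (L n) (fun G => U n G 0 i) @[n --> \oo] --> (0 : R)].
  apply: (outdeg_counts_clt chi_ge0 chi_rho_gt0 p_gt0 p_sum1 blocks_sink k_gt0 k_incr balance sigma_gt0 lawL).
  - by move=> n h; exact: network_lawS.
  - by move=> n x; exact: (network_law_sparse chi_ge0 chi_rho_gt0 p_gt0 p_sum1 blocks_sink s_const B_grown k_first).
  - by move=> n x; exact: (network_law_total chi_ge0 chi_rho_gt0 p_gt0 blocks_sink s_const).
have [mu mu_normal] := multinormal_exists S_sym S_psd.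
exists S, mu; split=> //.
pose X n G := (Num.sqrt n%:R)^-1 *: U n G.
have X_exp theta : exists C N0, forall n i, (N0 <= n)%N ->
    Ex (L n) (fun G => expR (theta * X n G 0 i)) <= C.
  have [C [N0 hC]] := S_exp theta; exists C, N0 => n i hn.
  apply: le_trans (hC n i hn); rewrite le_eqVlt; apply/orP; left; apply/eqP.
  by apply: eq_Ex => x _; rewrite /X mxE.
have shift := shifted_cvg lawL S_char X_exp mu_normal B_law.
have EYE n i : EY n 0 i = Ex (L n) (fun G => U n G 0 i) + (n%:R * sigma + w0) * psi 0 i.
  rewrite mxE (_ : (fun t => Y n t 0 i) = (fun t => outdeg_counts R k (B n t) 0 i)) //.
  rewrite (B_law n (fun G => outdeg_counts R k G 0 i)) /=.
  rewrite -[X in _ + X](Ex_cst _ (lawL n)) -ExD; apply: eq_Ex => x _.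
  by rewrite /U !mxE subrK.
split; last split.
- have he : (fun n => scale n *: (w0 *: psi)) n @[n --> \oo] --> (0 : 'rV[R]_r).
    by apply: cvg_row0 => i; under eq_fun do rewrite mxE; exact: cvg_invsqrt.
  have := shift _ he; rewrite (_ : (fun n t => _) = (fun n t => scale n *: (Y n t - (n%:R * lambda1) *: psi))) //.
  apply/funext => n; apply/funext => t; rewrite lE /X /U -scalerDr; congr (_ *: _).
  by apply/rowP => i; rewrite !mxE; ring.
- apply: cvg_row0 => i.
  rewrite (_ : (fun n => _) = (fun n => scale n * Ex (L n) (fun G => U n G 0 i) + scale n * (w0 * psi 0 i))).
    by rewrite -[X in _ --> X]addr0; apply: cvgD; [exact: S_mean|exact: cvg_invsqrt].
  apply/funext => n; rewrite -mulrDr mxE; congr (_ * _).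
  by rewrite mxE EYE lE !mxE; ring.
have he : (fun n => - (scale n *: (EY n - (n%:R * sigma + w0) *: psi))) n @[n --> \oo] --> (0 : 'rV[R]_r).
  apply: cvg_row0 => i.
  rewrite (_ : (fun n => _) = (fun n => - (scale n * Ex (L n) (fun G => U n G 0 i)))).
    by rewrite -[X in _ --> X]oppr0; apply: cvgN; exact: S_mean.
  apply/funext => n; rewrite mxE mxE; congr (- (_ * _)).
  by rewrite mxE EYE !mxE; ring.
have := shift _ he; rewrite (_ : (fun n t => _) = (fun n t => scale n *: (Y n t - EY n))) //.
apply/funext => n; apply/funext => t; rewrite /X /U -(scalerN (scale n)) -scalerDr; congr (_ *: _).
by apply/rowP => i; rewrite !mxE; ring.
Qed.
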